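(* There exists a unipotent germ of complex analytic diffeomorphism $\varphi$ at $(\mathbb{C}^2,0)$ whose formal class is non-embeddable; that is, $\log\varphi$ is not formally conjugated (by any formal diffeomorphism of $(\mathbb{C}^2,0)$) to any germ of convergent vector field.
   Context: A formal vector field on $(\mathbb{C}^n,0)$ is a derivation $\hat X=\sum_j \hat a_j\,\partial/\partial x_j$ of $\mathbb{C}[[x_1,\dots,x_n]]$; it is nilpotent if $\hat X(0)=0$ and its linear part $j^1\hat X$ is nilpotent. A formal diffeomorphism $\hat\sigma$ is an $n$-tuple of formal power series without constant term with invertible linear part; it is unipotent if $1$ is the only eigenvalue of $j^1\hat\sigma$. For $\hat X$ nilpotent, $\exp(\hat X)$ is the unipotent formal diffeomorphism determined by $g\circ\exp(\hat X)=\sum_{j\ge 0}\hat X^j(g)/j!$ for all $g\in\mathbb{C}[[x_1,\dots,x_n]]$. The map $\exp$ is a bijection from formal nilpotent vector fields onto formal unipotent diffeomorphisms; its inverse is denoted $\log$, and $\log\varphi$ is called the infinitesimal generator of $\varphi$. A formal diffeomorphism $\hat\sigma$ conjugates formal vector fields $X$ and $Y$ if $\hat\sigma_*X=Y$, where $(\hat\sigma_*X)(g)=[X(g\circ\hat\sigma)]\circ\hat\sigma^{-1}$. The formal class of a unipotent germ $\varphi$ is embeddable if $\log\varphi$ is formally conjugated to a convergent (complex analytic) germ of vector field. *)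

(* Defs.v *)
From mathcomp Require Import all_boot all_order all_algebra.
From mathcomp Require Import all_classical all_reals all_analysis.
From mathcomp Require Import complex.

Set Implicit Arguments.
Unset Strict Implicit.
Unset Printing Implicit Defensive.

Import Order.TTheory GRing.Theory Num.Theory.
Import ComplexField.Normc.

Local Open Scope classical_set_scope.
Local Open Scope ring_scope.
Local Open Scope complex_scope.

(* [f i j] is the coefficient of x^i y^j, where (x, y) = (x_1, x_2). *)
Definition fps (K : Type) := nat -> nat -> K.

Section FormalSeries.
Variable K : fieldType.
Implicit Types (f g : fps K) (s t X Y : fps K * fps K).

Definition fone : fps K := fun i j => ((i == 0%N) && (j == 0%N))%:R.
Definition fx : fps K := fun i j => ((i == 1%N) && (j == 0%N))%:R.
Definition fy : fps K := fun i j => ((i == 0%N) && (j == 1%N))%:R.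

Definition fadd f g : fps K := fun i j => f i j + g i j.

Definition fmul f g : fps K := fun i j =>
  \sum_(k < i.+1) \sum_(l < j.+1) f k l * g (i - k)%N (j - l)%N.

Definition fexpn f k : fps K := iter k (fmul f) fone.

Definition fdx f : fps K := fun i j => i.+1%:R * f i.+1 j.
Definition fdy f : fps K := fun i j => j.+1%:R * f i j.+1.

(* g o s.  Only meaningful when s has no constant term; then s_1^k s_2^l has
   order at least k + l, so that the terms left out of the sum vanish. *)
Definition fcomp g s : fps K := fun i j =>
  \sum_(k < (i + j).+1) \sum_(l < (i + j).+1)
    g k l * fmul (fexpn s.1 k) (fexpn s.2 l) i j.

(* Pairs of series serve both as formal maps (s_1, s_2) and as formal vector
   fields X_1 d/dx + X_2 d/dy. *)
Definition fid : fps K * fps K := (fx, fy).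

Definition fmap_comp s t : fps K * fps K := (fcomp s.1 t, fcomp s.2 t).

Definition no_constant_term s := s.1 0%N 0%N = 0 /\ s.2 0%N 0%N = 0.

(* The linear part j^1 s, with row i holding the linear part of s_i. *)
Definition linear_part s : 'M[K]_2 :=
  \matrix_(i < 2, j < 2)
    let f := if i == 0 then s.1 else s.2 in
    if j == 0 then f 1%N 0%N else f 0%N 1%N.

(* The derivation g |-> X(g). *)
Definition vf_apply X g : fps K :=
  fadd (fmul X.1 (fdx g)) (fmul X.2 (fdy g)).

Definition nilpotent_vf X :=
  no_constant_term X /\ exists k : nat, linear_part X ^+ k = 0.

Definition formal_diffeo s :=
  no_constant_term s /\ linear_part s \in unitmx.

Definition unipotent_diffeo s :=
  formal_diffeo s /\ forall a : K, eigenvalue (linear_part s) a <-> a = 1.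

(* Convergence of the series of u_k to g in the Krull topology: each
   coefficient of the partial sums is eventually that of g. *)
Definition fseries_cvg (u : nat -> fps K) g :=
  forall i j, \forall n \near \oo, \sum_(k < n) u k i j = g i j.

(* s = exp X *)
Definition is_exp X s :=
  unipotent_diffeo s /\
  forall g, fseries_cvg (fun k i j => iter k (vf_apply X) g i j / k`!%:R)
                        (fcomp g s).

(* s_* X = Y, with t the inverse of s *)
Definition conjugates s X Y :=
  formal_diffeo s /\
  exists t, [/\ formal_diffeo t, fmap_comp s t = fid, fmap_comp t s = fid &
    forall g, vf_apply Y g = fcomp (vf_apply X (fcomp g s)) t].

End FormalSeries.

Section Embeddability.
Variable R : realType.
Implicit Types (f : fps R[i]) (s X Y : fps R[i] * fps R[i]).

(* Absolute convergence at (r, r), hence on the closed polydisc of radius r. *)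
Definition convergent f := exists2 r : R, 0 < r &
  summable [set: nat * nat]
    (fun p => (normc (f p.1 p.2) * r ^+ (p.1 + p.2))%:E).

Definition convergent_pair s := convergent s.1 /\ convergent s.2.

(* The nilpotent X with exp X = s.  It is unique and exists for every unipotent
   s; the default value, the zero vector field, plays no role. *)
Definition flog s : fps R[i] * fps R[i] :=
  xget ((fun _ _ => 0), (fun _ _ => 0)) [set X | nilpotent_vf X /\ is_exp X s].

Definition embeddable_formal_class s :=
  exists2 Y, convergent_pair Y & exists h, conjugates h (flog s) Y.

End Embeddability.

(* Main.v *)
(* Let X_0 = y (d/dx + 2 x d/dy), whose leaves are the level sets of u = x^2 - y, and
   let phi_(c,d) be y |-> y - c y^2 followed by x |-> x + d y^2 along the leaves, and
   then by exp(X_0).  The generator X of phi_(c,d) vanishes on the axis y = 0, and each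
   leaf of X / y meets this axis in two points, which a formal involution iota
   exchanges.  If X is conjugate to a convergent Y, the foliation of Y has an analytic
   transverse coordinate, the axis becomes an analytic curve of zeros of Y, and iota
   converges.

   The N-th coefficient of iota is a polynomial of degree at most N in c.  If phi_(c,d)
   were embeddable for all real c and d, then Baire's theorem and Lagrange
   interpolation would bound exponentially the coefficients of these polynomials, in
   particular those of c; these are polynomials in d, and the same argument bounds
   exponentially the coefficients of c d.  But the latter are products of a
   coefficient of z / (1 - exp(-z)) and of k! times a coefficient of the derivative of
   z coth z, and they grow factorially. *)
Require Import Defs.
From HB Require Import structures.
From mathcomp Require Import all_boot all_order all_algebra.
From mathcomp Require Import all_classical all_reals all_analysis.
From mathcomp Require Import complex ring lra zify.

Import Defs.

Set Implicit Arguments.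
Unset Strict Implicit.
Unset Printing Implicit Defensive.

Import Order.TTheory GRing.Theory Num.Theory.

Local Open Scope ring_scope.

(** * The ring of formal series *)

(** The conjugacy with Y is only formal, so it might reparametrise the axis by a divergent series
    and make any statement on iota in the coordinate x meaningless. An intrinsic coordinate prevents
    this: the eigenvalue of X transverse to the axis is 2 x for every c and d, because both
    perturbations are trivial modulo y^2. On the side of Y this eigenvalue is given by analytic data
    along the curve of zeros; hence that curve, parametrised by x, is analytic. Two parameters are
    used because the first order in c alone gives nothing: for d = 0 the coefficient of c in the
    first integral is even on the axis and leaves iota unchanged to that order. The term in c d does
    break the symmetry x -> -x. Growth is computed with weights 1 and 2 of x and y, for which u is
    homogeneous. The equations then restrict to the single leaf u = 1, parametrised by x, where X_0
    acts on polynomials as (x^2 - 1) d/dx and which meets the axis at x = 1 and x = -1. Integration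
    between these two points removes the derivatives of all polynomials vanishing at both. *)

Section FpsRing.
Variable A : comNzRingType.
Implicit Types f g h : fps A.

HB.instance Definition _ := gen_eqMixin (fps A).
HB.instance Definition _ := gen_choiceMixin (fps A).

Lemma fpsP f g : (forall i j, f i j = g i j) -> f = g.
Proof. by move=> e; apply/funext => i; apply/funext => j. Qed.

Definition fps0 : fps A := fun _ _ => 0.
Definition fps_opp f : fps A := fun i j => - f i j.
Definition fps_add f g : fps A := fun i j => f i j + g i j.

Let addA : associative fps_add.
Proof. by move=> f g h; apply: fpsP => i j; exact: addrA. Qed.
Let addC : commutative fps_add.
Proof. by move=> f g; apply: fpsP => i j; exact: addrC. Qed.
Let add0 : left_id fps0 fps_add.
Proof. by move=> f; apply: fpsP => i j; exact: add0r. Qed.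
Let addN : left_inverse fps0 fps_opp fps_add.
Proof. by move=> f; apply: fpsP => i j; exact: addNr. Qed.

HB.instance Definition _ := GRing.isZmodule.Build (fps A) addA addC add0 addN.

(** Same bodies as [fone] and [fmul], over any commutative ring: over a field the ring operations
    are convertible with those of the statement. *)
Definition fps_one : fps A := fun i j => ((i == 0%N) && (j == 0%N))%:R.
Definition fps_mul f g : fps A := fun i j =>
  \sum_(k < i.+1) \sum_(l < j.+1) f k l * g (i - k)%N (j - l)%N.

(** Commutativity and associativity are checked one coefficient at a time on square truncations,
    where they are inherited from [{poly {poly A}}]. *)
Definition bipoly (n : nat) f : {poly {poly A}} :=
  \poly_(i < n) \poly_(j < n) f i j.

Let bipolyE n f i j : (i < n)%N -> (j < n)%N -> (bipoly n f)`_i`_j = f i j.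
Proof. by move=> i_n j_n; rewrite !coef_poly i_n coef_poly j_n. Qed.

Let bipoly_mul n f g i j : (i < n)%N -> (j < n)%N ->
  (bipoly n f * bipoly n g)`_i`_j = fps_mul f g i j.
Proof.
move=> i_n j_n; rewrite coefM coef_sum; apply: eq_bigr => k _.
rewrite coefM; apply: eq_bigr => l _.
by rewrite !bipolyE //; have := ltn_ord k; have := ltn_ord l; lia.
Qed.

(** A coefficient of a product sees only lower coefficients of the factors, so each factor may be
    replaced by any polynomial agreeing there. Associativity needs this freedom, a product of
    truncations not being a truncation. *)
Let mul_bipoly n f g i j : (i < n)%N -> (j < n)%N -> forall p q : {poly {poly A}},
  (forall k l, (k <= i)%N -> (l <= j)%N -> p`_k`_l = f k l) ->
  (forall k l, (k <= i)%N -> (l <= j)%N -> q`_k`_l = g k l) ->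
  (p * q)`_i`_j = fps_mul f g i j.
Proof.
move=> i_n j_n p q pf qg; rewrite coefM coef_sum; apply: eq_bigr => k _.
rewrite coefM; apply: eq_bigr => l _.
by rewrite pf ?qg ?leq_subr ?leq_ord.
Qed.

Let mulC : commutative fps_mul.
Proof.
move=> f g; apply: fpsP => i j; pose n := (i + j).+1.
have i_n : (i < n)%N by rewrite /n; lia.
have j_n : (j < n)%N by rewrite /n; lia.
by rewrite -(bipoly_mul f g i_n j_n) -(bipoly_mul g f i_n j_n) mulrC.
Qed.

Let mulA : associative fps_mul.
Proof.
move=> f g h; apply: fpsP => i j; pose n := (i + j).+1.
have i_n : (i < n)%N by rewrite /n; lia.
have j_n : (j < n)%N by rewrite /n; lia.
rewrite -(mul_bipoly i_n j_n (p := bipoly n f) (q := bipoly n g * bipoly n h)).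
- rewrite mulrA; apply: (mul_bipoly i_n j_n) => k l ki lj.
  + by rewrite bipoly_mul //; lia.
  + by rewrite bipolyE //; lia.
- by move=> k l ki lj; rewrite bipolyE //; lia.
- by move=> k l ki lj; rewrite bipoly_mul //; lia.
Qed.

Let mul1 : left_id fps_one fps_mul.
Proof.
move=> f; apply: fpsP => i j.
rewrite /fps_mul big_ord_recl big_ord_recl /= /fps_one eqxx mul1r !subn0.
rewrite [X in _ + X + _]big1 ?addr0; last by move=> k _; rewrite mul0r.
by rewrite big1 ?addr0 // => k _; rewrite big1 // => l _; rewrite mul0r.
Qed.

Let mulD : left_distributive fps_mul fps_add.
Proof.
move=> f g h; apply: fpsP => i j; rewrite /fps_mul /fps_add -big_split.
apply: eq_bigr => k _; rewrite -big_split; apply: eq_bigr => l _.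
by rewrite mulrDl.
Qed.

Let one_neq0 : fps_one != 0.
Proof.
apply/eqP => /(congr1 (fun f : fps A => f 0%N 0%N)) /eqP.
by rewrite /fps_one /= oner_eq0.
Qed.

HB.instance Definition _ := GRing.Zmodule_isComNzRing.Build (fps A)
  mulA mulC mul1 mulD one_neq0.

Definition fps_scale (a : A) f : fps A := fun i j => a * f i j.

Let scaleA a b f : fps_scale a (fps_scale b f) = fps_scale (a * b) f.
Proof. by apply: fpsP => i j; exact: mulrA. Qed.
Let scale1 : left_id 1 fps_scale.
Proof. by move=> f; apply: fpsP => i j; exact: mul1r. Qed.
Let scaleDr : right_distributive fps_scale +%R.
Proof. by move=> a f g; apply: fpsP => i j; exact: mulrDr. Qed.
Let scaleDl f : {morph fps_scale^~ f: a b / a + b}.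
Proof. by move=> a b; apply: fpsP => i j; exact: mulrDl. Qed.

HB.instance Definition _ := GRing.Zmodule_isLmodule.Build A (fps A)
  scaleA scale1 scaleDr scaleDl.

Let scaleAl (a : A) f g : a *: (f * g) = a *: f * g.
Proof.
apply: fpsP => i j.
change (a * fps_mul f g i j = fps_mul (fps_scale a f) g i j).
rewrite /fps_mul mulr_sumr; apply: eq_bigr => k _; rewrite mulr_sumr.
by apply: eq_bigr => l _; rewrite mulrA.
Qed.

HB.instance Definition _ := GRing.Lmodule_isLalgebra.Build A (fps A) scaleAl.

Lemma scaleAr (a : A) f g : a *: (f * g) = f * (a *: g).
Proof. by rewrite mulrC scaleAl mulrC. Qed.

HB.instance Definition _ := GRing.Lalgebra_isAlgebra.Build A (fps A) scaleAr.

Lemma fpsD f g i j : (f + g) i j = f i j + g i j. Proof. by []. Qed.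
Lemma fpsN f i j : (- f) i j = - f i j. Proof. by []. Qed.
Lemma fpsB f g i j : (f - g) i j = f i j - g i j. Proof. by []. Qed.
Lemma fpsZ a f i j : (a *: f) i j = a * f i j. Proof. by []. Qed.
Lemma fps0E i j : (0 : fps A) i j = 0. Proof. by []. Qed.
Lemma fps1E i j : (1 : fps A) i j = ((i == 0%N) && (j == 0%N))%:R. Proof. by []. Qed.
Lemma fpsM f g i j : (f * g) i j =
  \sum_(k < i.+1) \sum_(l < j.+1) f k l * g (i - k)%N (j - l)%N.
Proof. by []. Qed.

Lemma fps_sum I (r : seq I) (P : pred I) (F : I -> fps A) i j :
  (\sum_(k <- r | P k) F k) i j = \sum_(k <- r | P k) F k i j.
Proof.
by elim/big_rec2: _ => // k f a _ <-.
Qed.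

End FpsRing.

(** * Weighted orders, derivations *)

Section Orders.
Variable K : fieldType.
Implicit Types f g h : fps K.

Definition mono k l : fps K := fun i j => ((i == k) && (j == l))%:R.
Arguments mono (k l)%_N.

Lemma fexpnE f n : fexpn f n = f ^+ n.
Proof. by elim: n => // n IH; rewrite exprS -IH. Qed.

Lemma fps_mul0 f g : (f * g) 0%N 0%N = f 0%N 0%N * g 0%N 0%N.
Proof. by rewrite fpsM !big_ord1. Qed.

Lemma mul_fx f i j : (fx K * f) i j = if i is i'.+1 then f i' j else 0.
Proof.
rewrite fpsM; case: i => [|i].
  by rewrite big_ord1 big1 // => l _; rewrite /fx mul0r.
rewrite big_ord_recl big1 ?add0r; last by move=> l _; rewrite /fx mul0r.
rewrite big_ord_recl /= [X in _ + X]big1 ?addr0; last first.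
  by move=> k _; rewrite big1 // => l _; rewrite /fx /= mul0r.
rewrite big_ord_recl big1 ?addr0; last by move=> l _; rewrite /fx /= mul0r.
by rewrite /fx /= mul1r subn1 subn0.
Qed.

Lemma mul_fy f i j : (fy K * f) i j = if j is j'.+1 then f i j' else 0.
Proof.
rewrite fpsM big_ord_recl [X in _ + X]big1 ?addr0; last first.
  by move=> k _; rewrite big1 // => l _; rewrite /fy /= mul0r.
rewrite subn0; case: j => [|j]; first by rewrite big_ord1 /fy mul0r.
rewrite big_ord_recl /fy /= mul0r add0r big_ord_recl /= mul1r subn1.
by rewrite big1 ?addr0 // => l _; rewrite mul0r.
Qed.

Lemma mono00 : mono 0 0 = 1. Proof. by []. Qed.
Lemma fxE : fx K = mono 1 0. Proof. by []. Qed.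
Lemma fyE : fy K = mono 0 1. Proof. by []. Qed.

Lemma monoSl k l : mono k.+1 l = fx K * mono k l.
Proof. by apply: fpsP => -[|i] j; rewrite mul_fx. Qed.

Lemma monoSr k l : mono k l.+1 = fy K * mono k l.
Proof.
by apply: fpsP => i [|j]; rewrite mul_fy /mono ?eqSS //= andbF.
Qed.

Lemma monoE k l : mono k l = fx K ^+ k * fy K ^+ l.
Proof.
elim: k => [|k IH]; last by rewrite monoSl IH exprS mulrA.
by elim: l => [|l IH]; rewrite ?mulr1 // monoSr IH exprS mul1r mul1r.
Qed.

Lemma monoM k l k' l' : mono k l * mono k' l' = mono (k + k') (l + l').
Proof. by rewrite !monoE !exprD mulrACA. Qed.

Lemma fdxD f g : fdx (f + g) = fdx f + fdx g.
Proof. by apply: fpsP => i j; rewrite fpsD /fdx fpsD mulrDr. Qed.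
Lemma fdyD f g : fdy (f + g) = fdy f + fdy g.
Proof. by apply: fpsP => i j; rewrite fpsD /fdy fpsD mulrDr. Qed.
Lemma fdxZ a f : fdx (a *: f) = a *: fdx f.
Proof. by apply: fpsP => i j; rewrite fpsZ /fdx fpsZ mulrCA. Qed.
Lemma fdyZ a f : fdy (a *: f) = a *: fdy f.
Proof. by apply: fpsP => i j; rewrite fpsZ /fdy fpsZ mulrCA. Qed.

Lemma fdx_mono k l : fdx (mono k l) = k%:R *: mono k.-1 l.
Proof.
apply: fpsP => i j; rewrite fpsZ /fdx /mono; case: k => [|k] /=.
  by rewrite mul0r mulr0.
by rewrite eqSS; case: eqP => [->|] //=; rewrite !mulr0.
Qed.

Lemma fdy_mono k l : fdy (mono k l) = l%:R *: mono k l.-1.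
Proof.
apply: fpsP => i j; rewrite fpsZ /fdy /mono; case: l => [|l] /=.
  by rewrite andbF mul0r mulr0.
rewrite eqSS; case: (j =P l) => [->|]; rewrite ?andbF ?mulr0 //.
Qed.

(** Order at least [n] when x has weight [p] and y has weight [q]. The weights 1, 1 describe the
    Krull topology; the weights 2, 3 measure the gain of the contractions. *)
Definition ordw (p q n : nat) f : Prop :=
  forall i j, (p * i + q * j < n)%N -> f i j = 0.
Arguments ordw (p q n)%_N f.

Section Weight.
Variables p q : nat.
Notation ordw := (ordw p q).

Lemma ordw_0 n : ordw n 0. Proof. by []. Qed.
Lemma ordw0n f : ordw 0 f. Proof. by []. Qed.
Lemma ordwW m n f : (m <= n)%N -> ordw n f -> ordw m f.
Proof. by move=> mn fn i j ij; apply: fn; apply: leq_trans mn. Qed.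
Lemma ordwD n f g : ordw n f -> ordw n g -> ordw n (f + g).
Proof. by move=> fn gn i j ij; rewrite fpsD fn ?gn ?addr0. Qed.
Lemma ordwN n f : ordw n f -> ordw n (- f).
Proof. by move=> fn i j ij; rewrite fpsN fn ?oppr0. Qed.
Lemma ordwB n f g : ordw n f -> ordw n g -> ordw n (f - g).
Proof. by move=> fn gn; apply: ordwD => //; apply: ordwN. Qed.
Lemma ordwBC n f g : ordw n (f - g) -> ordw n (g - f).
Proof. by move=> fg; rewrite -opprB; apply: ordwN. Qed.
Lemma ordw_trans n f g h : ordw n (f - g) -> ordw n (g - h) -> ordw n (f - h).
Proof. by move=> fg gh; rewrite -(subrKA g); apply: ordwD. Qed.
Lemma ordwZ n a f : ordw n f -> ordw n (a *: f).
Proof. by move=> fn i j ij; rewrite fpsZ fn ?mulr0. Qed.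
Lemma ordw_sum n I (r : seq I) (P : pred I) (F : I -> fps K) :
  (forall i, P i -> ordw n (F i)) -> ordw n (\sum_(i <- r | P i) F i).
Proof.
by move=> h; elim/big_ind: _ => //; exact: ordwD.
Qed.

Lemma ordwM m n f g : ordw m f -> ordw n g -> ordw (m + n) (f * g).
Proof.
move=> fm gn i j ij; rewrite fpsM big1 // => k _; rewrite big1 // => l _.
have [kl|kl] := ltnP (p * k + q * l) m; first by rewrite fm ?mul0r.
rewrite gn ?mulr0 // !mulnBr.
have := leq_mul (leqnn p) (leq_ord k); have := leq_mul (leqnn q) (leq_ord l).
lia.
Qed.

Lemma ordwX m k f : ordw m f -> ordw (m * k) (f ^+ k).
Proof.
move=> fm; elim: k => [|k IH]; first by rewrite muln0.
by rewrite mulnS exprS; apply: ordwM.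
Qed.

Lemma ordw_mono k l : ordw (p * k + q * l) (mono k l).
Proof.
move=> i j; rewrite /mono; case: (i =P k) => [->|//].
by case: (j =P l) => [->|//]; rewrite ltnn.
Qed.

Lemma ordw_eq0 f : (0 < p)%N -> (0 < q)%N -> (forall n, ordw n f) -> f = 0.
Proof. by move=> _ _ h; apply: fpsP => i j; apply: (h _ _ _ (ltnSn _)). Qed.

End Weight.

Lemma ordw_deg p q n f : (0 < p)%N -> (0 < q)%N -> ordw 1 1 n f -> ordw p q n f.
Proof. by move=> p0 q0 fn i j ij; apply: fn; nia. Qed.

Lemma ordw_fdx p q n f : ordw p q n f -> ordw p q (n - p) (fdx f).
Proof. by move=> fn i j ij; rewrite /fdx fn ?mulr0 // mulnS; lia. Qed.

Lemma ordw_fdy p q n f : ordw p q n f -> ordw p q (n - q) (fdy f).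
Proof. by move=> fn i j ij; rewrite /fdy fn ?mulr0 // mulnS; lia. Qed.

Definition trunc n f : fps K := \sum_(k < n) \sum_(l < n) f k l *: mono k l.

Lemma truncE n f i j : (i < n)%N -> (j < n)%N -> trunc n f i j = f i j.
Proof.
move=> i_n j_n; rewrite /trunc fps_sum (bigD1 (Ordinal i_n)) //= fps_sum.
rewrite (bigD1 (Ordinal j_n)) //= fpsZ /mono !eqxx mulr1 big1 ?addr0; last first.
  move=> l /eqP lj; rewrite fpsZ /mono eqxx (_ : (j == l) = false) ?mulr0 //.
  by apply/eqP => e; apply: lj; apply: val_inj.
rewrite big1 ?addr0 // => k /eqP ki; rewrite fps_sum big1 // => l _.
rewrite fpsZ /mono (_ : (i == k) = false) ?mulr0 //.
by apply/eqP => e; apply: ki; apply: val_inj.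
Qed.

Lemma trunc_deg n f : ordw 1 1 n (f - trunc n f).
Proof. by move=> i j ij; rewrite fpsB truncE ?subrr //; lia. Qed.

Definition lin (Phi : fps K -> fps K) :=
  (forall f g, Phi (f + g) = Phi f + Phi g) /\
  (forall a f, Phi (a *: f) = a *: Phi f).

(** Continuity at 0 for the Krull topology. Together with linearity it makes each coefficient of
    [Phi g] a finite combination of coefficients of [g]. *)
Definition cont (Phi : fps K -> fps K) :=
  forall n, exists m, forall f, ordw 1 1 m f -> ordw 1 1 n (Phi f).

Section LinCont.
Variable Phi : fps K -> fps K.
Hypothesis Phi_lin : lin Phi.

Lemma lin0 : Phi 0 = 0.
Proof. by rewrite -(scale0r (0 : fps K)) Phi_lin.2 !scale0r. Qed.
Lemma linN f : Phi (- f) = - Phi f.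
Proof. by rewrite -!scaleN1r Phi_lin.2. Qed.
Lemma linB f g : Phi (f - g) = Phi f - Phi g.
Proof. by rewrite Phi_lin.1 linN. Qed.
Lemma lin_sum I (r : seq I) (P : pred I) (F : I -> fps K) :
  Phi (\sum_(i <- r | P i) F i) = \sum_(i <- r | P i) Phi (F i).
Proof. by elim/big_rec2: _ => [|i f g _ <-]; rewrite ?lin0 ?Phi_lin.1. Qed.

Hypothesis Phi_cont : cont Phi.

Lemma lin_trunc i j : exists N, forall g,
  Phi g i j = \sum_(k < N) \sum_(l < N) g k l * Phi (mono k l) i j.
Proof.
have [m hm] := Phi_cont (i + j).+1; exists m => g.
have := hm _ (@trunc_deg m g) i j; rewrite !mul1n ltnS leqnn linB fpsB => /(_ isT).
move/eqP; rewrite subr_eq0 => /eqP ->; rewrite /trunc lin_sum fps_sum.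
apply: eq_bigr => k _; rewrite lin_sum fps_sum; apply: eq_bigr => l _.
by rewrite Phi_lin.2 fpsZ.
Qed.

(** Each coefficient of [Phi g] is a finite combination of those of the images of monomials, so a
    gain of order may be tested on monomials. *)
Lemma raise_ext p q r :
  (forall k l, ordw p q (p * k + q * l + r) (Phi (mono k l))) ->
  forall n g, ordw p q n g -> ordw p q (n + r) (Phi g).
Proof.
move=> h n g gn i j ij; have [N ->] := lin_trunc i j.
rewrite big1 // => k _; rewrite big1 // => l _.
have [kl|kl] := ltnP (p * k + q * l) n; first by rewrite gn ?mul0r.
by rewrite h ?mulr0 //; lia.
Qed.

End LinCont.

(** The principle behind the Leibniz rule, the multiplicativity of composition and the chain rule:
    both sides are linear and continuous, and monomials suffice. *)
Lemma lin_ext Phi Psi : lin Phi -> cont Phi -> lin Psi -> cont Psi ->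
  (forall k l, Phi (mono k l) = Psi (mono k l)) -> forall g, Phi g = Psi g.
Proof.
move=> Phi_lin Phi_c Psi_lin Psi_c h g; apply: fpsP => i j.
have lB : lin (fun f => Phi f - Psi f).
  split=> [f1 f2|a f]; first by rewrite Phi_lin.1 Psi_lin.1 opprD addrACA.
  by rewrite Phi_lin.2 Psi_lin.2 scalerBr.
have cB : cont (fun f => Phi f - Psi f).
  move=> n; have [m hm] := Phi_c n; have [m' hm'] := Psi_c n.
  exists (maxn m m') => f fm; apply: ordwB; [apply: hm|apply: hm'];
    by apply: ordwW fm; rewrite ?leq_maxl ?leq_maxr.
have [N /(_ g)] := lin_trunc lB cB i j; rewrite fpsB big1 => [|k _].
  by move/eqP; rewrite subr_eq0 => /eqP.
by rewrite big1 // => l _; rewrite h subrr mulr0.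
Qed.

Lemma lin_id : lin id. Proof. by []. Qed.
Lemma cont_id : cont id. Proof. by move=> n; exists n. Qed.
Lemma lin_comp Phi Psi : lin Phi -> lin Psi -> lin (Phi \o Psi).
Proof.
by move=> a b; split=> [f g|c f] /=; rewrite ?b.1 ?a.1 ?b.2 ?a.2.
Qed.
Lemma cont_comp Phi Psi : cont Phi -> cont Psi -> cont (Phi \o Psi).
Proof.
move=> a b n; have [m hm] := a n; have [m' hm'] := b m.
by exists m' => f fm; apply: hm; apply: hm'.
Qed.
Lemma lin_add Phi Psi : lin Phi -> lin Psi -> lin (fun f => Phi f + Psi f).
Proof.
move=> a b; split=> [f g|c f] /=; first by rewrite a.1 b.1 addrACA.
by rewrite a.2 b.2 scalerDr.
Qed.
Lemma cont_add Phi Psi : cont Phi -> cont Psi -> cont (fun f => Phi f + Psi f).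
Proof.
move=> a b n; have [m hm] := a n; have [m' hm'] := b n.
exists (maxn m m') => f fm; apply: ordwD; [apply: hm|apply: hm'];
  by apply: ordwW fm; rewrite ?leq_maxl ?leq_maxr.
Qed.
Lemma lin_mul h : lin (fun f => h * f).
Proof. by split=> [f g|c f]; rewrite ?mulrDr // scaleAr. Qed.
Lemma cont_mul h : cont (fun f => h * f).
Proof.
by move=> n; exists n => f fn; apply: (ordwM (@ordw0n 1 1 h) fn).
Qed.
Lemma lin_mulr h : lin (fun f => f * h).
Proof. by split=> [f g|c f]; rewrite ?mulrDl // scalerAl. Qed.
Lemma cont_mulr h : cont (fun f => f * h).
Proof.
by move=> n; exists n => f fn; rewrite -[n]addn0; apply: (ordwM fn (@ordw0n 1 1 h)).
Qed.
Lemma lin_fdx : lin (@fdx K).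
Proof. by split=> [f g|a f]; rewrite ?fdxD ?fdxZ. Qed.
Lemma lin_fdy : lin (@fdy K).
Proof. by split=> [f g|a f]; rewrite ?fdyD ?fdyZ. Qed.
Lemma cont_fdx : cont (@fdx K).
Proof.
by move=> n; exists n.+1 => f /ordw_fdx; rewrite subn1.
Qed.
Lemma cont_fdy : cont (@fdy K).
Proof.
by move=> n; exists n.+1 => f /ordw_fdy; rewrite subn1.
Qed.

Lemma fdxM f g : fdx (f * g) = fdx f * g + f * fdx g.
Proof.
move: f g; suff mono_case k l g :
    fdx (mono k l * g) = fdx (mono k l) * g + mono k l * fdx g.
  move=> f g; move: f; apply: lin_ext => [||||k l].
  - by apply: (lin_comp lin_fdx); apply: lin_mulr.
  - by apply: (cont_comp cont_fdx); apply: cont_mulr.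
  - apply: lin_add; last exact: lin_mulr.
    by apply: (lin_comp (lin_mulr _) lin_fdx).
  - apply: cont_add; last exact: cont_mulr.
    by apply: (cont_comp (cont_mulr _) cont_fdx).
  - exact: mono_case.
move: g; apply: lin_ext => [||||k' l'].
- by apply: (lin_comp lin_fdx); apply: lin_mul.
- by apply: (cont_comp cont_fdx); apply: cont_mul.
- apply: lin_add; first exact: lin_mul.
  by apply: (lin_comp (lin_mul _) lin_fdx).
- apply: cont_add; first exact: cont_mul.
  by apply: (cont_comp (cont_mul _) cont_fdx).
rewrite monoM !fdx_mono -scalerAl -scaleAr !monoM natrD scalerDl.
case: k => [|k]; first by rewrite !scale0r !add0r.
case: k' => [|k']; first by rewrite ?scale0r ?addr0 addn0.
by rewrite /= addSn addnS.
Qed.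

Lemma fdyM f g : fdy (f * g) = fdy f * g + f * fdy g.
Proof.
move: f g; suff mono_case k l g :
    fdy (mono k l * g) = fdy (mono k l) * g + mono k l * fdy g.
  move=> f g; move: f; apply: lin_ext => [||||k l].
  - by apply: (lin_comp lin_fdy); apply: lin_mulr.
  - by apply: (cont_comp cont_fdy); apply: cont_mulr.
  - apply: lin_add; last exact: lin_mulr.
    by apply: (lin_comp (lin_mulr _) lin_fdy).
  - apply: cont_add; last exact: cont_mulr.
    by apply: (cont_comp (cont_mulr _) cont_fdy).
  - exact: mono_case.
move: g; apply: lin_ext => [||||k' l'].
- by apply: (lin_comp lin_fdy); apply: lin_mul.
- by apply: (cont_comp cont_fdy); apply: cont_mul.
- apply: lin_add; first exact: lin_mul.
  by apply: (lin_comp (lin_mul _) lin_fdy).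
- apply: cont_add; first exact: cont_mul.
  by apply: (cont_comp (cont_mul _) cont_fdy).
rewrite monoM !fdy_mono -scalerAl -scaleAr !monoM natrD scalerDl.
case: l => [|l]; first by rewrite !scale0r !add0r.
case: l' => [|l']; first by rewrite ?scale0r ?addr0 addn0.
by rewrite /= addSn addnS.
Qed.

Section VectorField.
Variable X : fps K * fps K.
Notation D := (vf_apply X).

Lemma vfE g : D g = X.1 * fdx g + X.2 * fdy g. Proof. by []. Qed.

Lemma lin_vf : lin D.
Proof.
by apply: lin_add; apply: lin_comp (lin_mul _) _; [exact: lin_fdx|exact: lin_fdy].
Qed.
Lemma cont_vf : cont D.
Proof.
by apply: cont_add; apply: cont_comp (cont_mul _) _; [exact: cont_fdx|exact: cont_fdy].
Qed.
Lemma vfM f g : D (f * g) = D f * g + f * D g.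
Proof. by rewrite !vfE fdxM fdyM; ring. Qed.
Lemma vf1 : D 1 = 0.
Proof.
by rewrite vfE -mono00 fdx_mono fdy_mono !scale0r !mulr0 addr0.
Qed.
Lemma vfXn f n : D (f ^+ n) = (f ^+ n.-1 * D f) *+ n.
Proof.
elim: n => [|n IH]; first by rewrite vf1.
rewrite exprS vfM IH mulrS mulrC; congr (_ + _).
by case: n {IH} => [|n] /=; rewrite ?mulr0n ?mulr0 // mulrnAr mulrA exprS.
Qed.
Lemma vfx : D (fx K) = X.1.
Proof.
by rewrite vfE fxE fdx_mono fdy_mono scale0r scale1r mulr0 addr0 mono00 mulr1.
Qed.
Lemma vfy : D (fy K) = X.2.
Proof.
by rewrite vfE fyE fdx_mono fdy_mono scale0r scale1r mulr0 add0r mono00 mulr1.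
Qed.

(** The field raises the weighted order by [r]. This is a condition on the images of the
    coordinates, whose own weights are 2 and 3. *)
Definition raises (r : nat) := ordw 2 3 (r + 2) X.1 /\ ordw 2 3 (r + 3) X.2.

Lemma raisesP r n g : raises r -> ordw 2 3 n g -> ordw 2 3 (n + r) (D g).
Proof.
move=> [X1 X2] gn; apply: ordwD.
  by apply: ordwW (ordwM X1 (ordw_fdx gn)); lia.
by apply: ordwW (ordwM X2 (ordw_fdy gn)); lia.
Qed.

End VectorField.

End Orders.

Arguments mono {K} (k l)%_N.
Arguments ordw {K} (p q n)%_N f.
Arguments ordw_0 {K} p q n.
Arguments ordw0n {K p q} f.
Arguments ordwX {K p q m} k {f} _.
Arguments ordw_mono {K} p q k l.
Arguments trunc_deg {K} n f.
(* With these weights of [x] and [y], [y d/dx] raises the order, and so does every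
   nilpotent field whose linear part is a multiple of it. *)
Notation ord := (ordw 2 3).

(** * Composition, contractions, Hasse-Schmidt families *)

Section Composition.
Variable K : fieldType.
Implicit Types (f g h : fps K) (s t : fps K * fps K).

Notation nc := no_constant_term.

Lemma nc_ordw f : f 0%N 0%N = 0 -> ordw 1 1 1 f.
Proof. by move=> f0 [|i] [|j]. Qed.

Lemma ordw_nc p q f : (0 < p)%N -> ordw p q p f -> f 0%N 0%N = 0.
Proof. by move=> p0; apply; rewrite !muln0. Qed.

Lemma nc_pow s k l : nc s -> ordw 1 1 (k + l) (s.1 ^+ k * s.2 ^+ l).
Proof.
move=> [s1 s2].
have := ordwM (ordwX k (nc_ordw s1)) (ordwX l (nc_ordw s2)).
by rewrite !mul1n.
Qed.
Arguments nc_pow {s} k l _.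

Lemma sum_pad (V : nmodType) n N (F : nat -> V) : (n <= N)%N ->
  (forall k, (n <= k)%N -> F k = 0) -> \sum_(k < n) F k = \sum_(k < N) F k.
Proof.
move=> nN h; rewrite -!(big_mkord xpredT) [RHS](big_cat_nat (n := n)) //=.
by rewrite [X in _ + X]big_nat_cond [X in _ + X]big1 ?addr0 // => i /andP[/andP[/h]].
Qed.

Lemma fcompE N g s i j : nc s -> (i + j < N)%N -> fcomp g s i j =
  \sum_(k < N) \sum_(l < N) g k l * (s.1 ^+ k * s.2 ^+ l) i j.
Proof.
move=> s0 ijN; rewrite /fcomp.
have z k l : (i + j < k + l)%N -> (s.1 ^+ k * s.2 ^+ l) i j = 0.
  by move=> h; apply: (nc_pow k l s0); rewrite !mul1n.
rewrite -(sum_pad (n := (i + j).+1)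
  (F := fun k => \sum_(l < N) g k l * (s.1 ^+ k * s.2 ^+ l) i j)) //; last first.
  by move=> k ijk; rewrite big1 // => l _; rewrite z ?mulr0 //; lia.
apply: eq_bigr => k _.
rewrite -(sum_pad (n := (i + j).+1)
  (F := fun l => g k l * (s.1 ^+ k * s.2 ^+ l) i j)) //; last first.
  by move=> l ijl; rewrite z ?mulr0 //; lia.
by apply: eq_bigr => l _; rewrite !fexpnE.
Qed.

Lemma lin_fcomp s : lin (fun g => fcomp g s).
Proof.
split=> [f g|a f]; apply: fpsP => i j; rewrite ?fpsD ?fpsZ /fcomp.
  rewrite -big_split; apply: eq_bigr => k _ /=; rewrite -big_split.
  by apply: eq_bigr => l _; rewrite fpsD mulrDl.
rewrite mulr_sumr; apply: eq_bigr => k _; rewrite mulr_sumr.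
by apply: eq_bigr => l _; rewrite fpsZ mulrA.
Qed.

Lemma fcomp_deg s n f : nc s -> ordw 1 1 n f -> ordw 1 1 n (fcomp f s).
Proof.
move=> s0 fn i j ij; rewrite (fcompE _ s0 (ltnSn _)) big1 // => k _.
rewrite big1 // => l _; have [kl|kl] := ltnP (k + l) n.
  by rewrite fn ?mul0r // !mul1n.
by rewrite (nc_pow k l s0) ?mulr0 //; apply: leq_trans ij _.
Qed.

Lemma cont_fcomp s : nc s -> cont (fun g => fcomp g s).
Proof. by move=> s0 n; exists n => f; apply: fcomp_deg. Qed.

Lemma fcomp_mono k l s : nc s -> fcomp (mono k l) s = s.1 ^+ k * s.2 ^+ l.
Proof.
move=> s0; apply: fpsP => i j.
rewrite (@fcompE (maxn (i + j) (k + l)).+1) ?ltnS ?leq_maxl //.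
have kN : (k < (maxn (i + j) (k + l)).+1)%N by lia.
have lN : (l < (maxn (i + j) (k + l)).+1)%N by lia.
rewrite (bigD1 (Ordinal kN)) //= (bigD1 (Ordinal lN)) //= /mono !eqxx mul1r.
rewrite big1 ?addr0; last first.
  move=> b /eqP bl; rewrite (_ : (b == l :> nat) = false) ?andbF ?mul0r //.
  by apply/eqP => e; apply: bl; apply: val_inj.
rewrite big1 ?addr0 // => a /eqP ak; rewrite big1 // => b _.
rewrite (_ : (a == k :> nat) = false) ?mul0r //.
by apply/eqP => e; apply: ak; apply: val_inj.
Qed.

Lemma fcomp_fx s : nc s -> fcomp (fx K) s = s.1.
Proof. by move=> s0; rewrite fxE fcomp_mono // expr0 mulr1. Qed.
Lemma fcomp_fy s : nc s -> fcomp (fy K) s = s.2.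
Proof. by move=> s0; rewrite fyE fcomp_mono // expr0 mul1r. Qed.
Lemma fcomp1 s : nc s -> fcomp 1 s = 1.
Proof. by move=> s0; rewrite -mono00 fcomp_mono // !expr0 mulr1. Qed.

Lemma fcompD f g s : fcomp (f + g) s = fcomp f s + fcomp g s.
Proof. exact: (lin_fcomp s).1. Qed.
Lemma fcompZ a f s : fcomp (a *: f) s = a *: fcomp f s.
Proof. exact: (lin_fcomp s).2. Qed.
Lemma fcompN f s : fcomp (- f) s = - fcomp f s.
Proof. exact: (linN (lin_fcomp s)). Qed.
Lemma fcompB f g s : fcomp (f - g) s = fcomp f s - fcomp g s.
Proof. exact: (linB (lin_fcomp s)). Qed.
Lemma fcomp0 s : fcomp 0 s = 0.
Proof. exact: (lin0 (lin_fcomp s)). Qed.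

Lemma morph_ext (Phi : fps K -> fps K) : lin Phi -> cont Phi ->
  (forall k l k' l', Phi (mono k l * mono k' l') =
     Phi (mono k l) * Phi (mono k' l')) ->
  forall f g, Phi (f * g) = Phi f * Phi g.
Proof.
move=> Pl Pc h f g; move: f; apply: lin_ext => [||||k l].
- exact: lin_comp Pl (lin_mulr _).
- exact: cont_comp Pc (cont_mulr _).
- exact: lin_comp (lin_mulr _) Pl.
- exact: cont_comp (cont_mulr _) Pc.
move: g; apply: lin_ext => [||||k' l'].
- exact: lin_comp Pl (lin_mul _).
- exact: cont_comp Pc (cont_mul _).
- exact: lin_comp (lin_mul _) Pl.
- exact: cont_comp (cont_mul _) Pc.
exact: h.
Qed.

Lemma fcompM f g s : nc s -> fcomp (f * g) s = fcomp f s * fcomp g s.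
Proof.
move=> s0; move: f g; apply: morph_ext (lin_fcomp s) (cont_fcomp s0) _ => k l k' l'.
by rewrite monoM !fcomp_mono // !exprD mulrACA.
Qed.

Lemma fcompX f s n : nc s -> fcomp (f ^+ n) s = fcomp f s ^+ n.
Proof.
by move=> s0; elim: n => [|n IH]; rewrite ?fcomp1 // !exprS fcompM // IH.
Qed.

Lemma fcomp00 f s : nc s -> fcomp f s 0%N 0%N = f 0%N 0%N.
Proof.
by move=> s0; rewrite (fcompE _ s0 (ltnSn _)) !big_ord1 /= !expr0 mulr1 fps1E mulr1.
Qed.

Lemma nc_comp s t : nc s -> nc t -> nc (fmap_comp s t).
Proof. by move=> [s1 s2] t0; split; rewrite /= fcomp00. Qed.

Lemma fcompA g s t : nc s -> nc t ->
  fcomp (fcomp g s) t = fcomp g (fmap_comp s t).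
Proof.
move=> s0 t0; have st0 := nc_comp s0 t0.
move: g; apply: lin_ext => [||||k l].
- exact: lin_comp (lin_fcomp _) (lin_fcomp _).
- exact: cont_comp (cont_fcomp _) (cont_fcomp _).
- exact: lin_fcomp.
- exact: cont_fcomp.
by rewrite !fcomp_mono // fcompM // !fcompX.
Qed.

Lemma nc_fid : nc (fid K). Proof. by []. Qed.

Lemma fcomp_fid g : fcomp g (fid K) = g.
Proof.
move: g; apply: lin_ext => [||||k l].
- exact: lin_fcomp.
- exact: cont_fcomp nc_fid.
- exact: lin_id.
- exact: cont_id.
by rewrite fcomp_mono // -monoE.
Qed.

Lemma vf_comp X g s : nc s -> vf_apply X (fcomp g s) =
  fcomp (fdx g) s * vf_apply X s.1 + fcomp (fdy g) s * vf_apply X s.2.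
Proof.
move=> s0; move: g; apply: lin_ext => [||||k l].
- exact: lin_comp (lin_vf _) (lin_fcomp _).
- exact: cont_comp (cont_vf _) (cont_fcomp _).
- exact: (lin_add (lin_comp (lin_mulr _) (lin_comp (lin_fcomp s) (@lin_fdx K)))
    (lin_comp (lin_mulr _) (lin_comp (lin_fcomp s) (@lin_fdy K)))).
- exact: (cont_add
    (cont_comp (cont_mulr _) (cont_comp (cont_fcomp s0) (@cont_fdx K)))
    (cont_comp (cont_mulr _) (cont_comp (cont_fcomp s0) (@cont_fdy K)))).
rewrite fcomp_mono // vfM !vfXn fdx_mono fdy_mono !fcompZ !fcomp_mono //.
by rewrite !scaler_nat -!mulrnAr; ring.
Qed.

Lemma fdx_vf f : fdx f = vf_apply (1, 0) f.
Proof. by rewrite vfE mul1r mul0r addr0. Qed.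
Lemma fdy_vf f : fdy f = vf_apply (0, 1) f.
Proof. by rewrite vfE mul1r mul0r add0r. Qed.

Lemma fdx_comp g s : nc s -> fdx (fcomp g s) =
  fcomp (fdx g) s * fdx s.1 + fcomp (fdy g) s * fdx s.2.
Proof. by move=> s0; rewrite !(fdx_vf (fcomp _ _)) !(fdx_vf s.1) !(fdx_vf s.2) vf_comp. Qed.
Lemma pow_lip p q m r f g k : ordw p q m f -> ordw p q m g ->
  ordw p q (m + r) (f - g) -> ordw p q (m * k + r) (f ^+ k - g ^+ k).
Proof.
move=> fm gm fg; elim: k => [|k IH]; first by rewrite subrr.
have -> : f ^+ k.+1 - g ^+ k.+1 = (f - g) * f ^+ k + g * (f ^+ k - g ^+ k).
  by rewrite !exprS; ring.
apply: ordwD.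
  by apply: ordwW (ordwM fg (ordwX k fm)); rewrite mulnS; lia.
by apply: ordwW (ordwM gm IH); rewrite mulnS; lia.
Qed.
Arguments pow_lip {p q m r f g} k _ _ _.

Section Weighted.
Variables p q : nat.
Hypotheses (p0 : (0 < p)%N) (q0 : (0 < q)%N).
Notation weighted s := (ordw p q p s.1 /\ ordw p q q s.2).

Lemma weighted_nc s : weighted s -> nc s.
Proof.
move=> [s1 s2]; split; first exact: ordw_nc p0 s1.
by apply: s2; rewrite !muln0.
Qed.

Lemma fcomp_ordw n g s : weighted s -> ordw p q n g -> ordw p q n (fcomp g s).
Proof.
move=> sw gn; have s0 := weighted_nc sw; rewrite -[n]addn0.
apply: (raise_ext (lin_fcomp s) (cont_fcomp s0)) gn => k l.
by rewrite addn0 fcomp_mono //; apply: ordwM; apply: ordwX; case: sw.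
Qed.


(** Substitution is Lipschitz in the inner map for the weighted order: a relative agreement [r] of
    the maps becomes a relative agreement [r] of the composites. The contractions below that involve
    a substitution rest on this estimate. *)
Lemma fcomp_lip r v g s t : weighted s -> weighted t ->
  ordw p q (p + r) (s.1 - t.1) -> ordw p q (q + r) (s.2 - t.2) ->
  ordw p q v g -> ordw p q (v + r) (fcomp g s - fcomp g t).
Proof.
move=> sw tw d1 d2 gv; have s0 := weighted_nc sw; have t0 := weighted_nc tw.
have ll : lin (fun g => fcomp g s - fcomp g t).
  split=> [f h|a f]; first by rewrite !fcompD opprD addrACA.
  by rewrite !fcompZ scalerBr.
have cc : cont (fun g => fcomp g s - fcomp g t).
  by move=> n; exists n => f fn; apply: ordwB; apply: fcomp_deg.
apply: (raise_ext ll cc) gv => k l; rewrite !fcomp_mono //.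
have -> : s.1 ^+ k * s.2 ^+ l - t.1 ^+ k * t.2 ^+ l =
    (s.1 ^+ k - t.1 ^+ k) * s.2 ^+ l + t.1 ^+ k * (s.2 ^+ l - t.2 ^+ l) by ring.
case: sw => s1 s2; case: tw => t1 t2; apply: ordwD.
  by apply: ordwW (ordwM (pow_lip k s1 t1 d1) (ordwX l s2)); lia.
by apply: ordwW (ordwM (ordwX k t1) (pow_lip l s2 t2 d2)); lia.
Qed.

End Weighted.

End Composition.

Arguments nc_pow {K s} k l _.
Arguments pow_lip {K p q m r f g} k _ _ _.

(** * Contractions for the weighted order *)

Section Contraction.
Variable K : fieldType.
Implicit Types s t : fps K * fps K.

(** Agreement relative to the weights of the two components. [cong 1 s (fid K)] allows y in the
    first component, so it covers the unipotent linear parts met here. *)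
Definition cong (n : nat) s t :=
  ord (2 + n) (s.1 - t.1) /\ ord (3 + n) (s.2 - t.2).

Lemma cong_refl n s : cong n s s.
Proof. by split; rewrite subrr; exact: ordw_0. Qed.
Lemma cong_sym n s t : cong n s t -> cong n t s.
Proof. by move=> [a b]; split; apply: ordwBC. Qed.
Lemma cong_trans n s t u : cong n s t -> cong n t u -> cong n s u.
Proof. by move=> [a b] [c d]; split; apply: ordw_trans; eassumption. Qed.
Lemma congW m n s t : (m <= n)%N -> cong n s t -> cong m s t.
Proof.
by move=> mn [a b]; split; [apply: ordwW a|apply: ordwW b]; rewrite leq_add2l.
Qed.
Lemma cong_eq s t : (forall n, cong n s t) -> s = t.
Proof.
case: s t => [s1 s2] [t1 t2] h; congr pair; apply/eqP; rewrite -subr_eq0;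
  apply/eqP; apply: (@ordw_eq0 _ 2 3) => // n; have [a b] := h n.
- by apply: ordwW a; rewrite leq_addl.
- by apply: ordwW b; rewrite leq_addl.
Qed.

Variables (m : nat) (s0 : fps K * fps K) (T : fps K * fps K -> fps K * fps K).
Hypothesis T_stab : forall s, cong m s s0 -> cong m (T s) s0.
Hypothesis T_contr : forall n s t, (m <= n)%N -> cong m s s0 -> cong m t s0 ->
  cong n s t -> cong n.+1 (T s) (T t).

Lemma contraction_unique s t : cong m s s0 -> cong m t s0 ->
  T s = s -> T t = t -> s = t.
Proof.
move=> ss ts sT tT; apply: cong_eq => n.
suff h : cong (m + n) s t by apply: congW h; rewrite leq_addl.
elim: n => [|n IH]; first by rewrite addn0; apply: cong_trans ss (cong_sym ts).
by rewrite addnS -sT -tT; apply: T_contr => //; rewrite leq_addr.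
Qed.

(** Banach's theorem in the ball of centre [s0]. The rate of convergence of the iterates is kept in
    the conclusion, because norm bounds will be passed from the iterates to the fixed point. *)
Lemma contraction_fixpoint : exists s,
  [/\ cong m s s0, T s = s & forall n, cong n s (iter n T s0)].
Proof.
pose S n := iter n T s0.
have Sok n : cong m (S n) s0.
  by elim: n => [|n IH]; [exact: cong_refl | exact: T_stab].
have Sstep n : cong (m + n) (S n) (S n.+1).
  elim: n => [|n IH]; first by rewrite addn0; apply: cong_sym; exact: (Sok 1%N).
  by rewrite addnS; exact: (T_contr (leq_addr _ _) (Sok n) (Sok n.+1) IH).
have Sle n k : cong (m + n) (S n) (S (n + k)%N).
  elim: k => [|k IH]; first by rewrite addn0; exact: cong_refl.
  apply: cong_trans IH _; rewrite addnS; apply: congW (Sstep _); lia.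
have SS n n' k : (k <= n)%N -> (k <= n')%N -> cong k (S n) (S n').
  move=> kn kn'; apply: (cong_trans (t := S k)).
    by apply: cong_sym; rewrite -(subnKC kn); apply: congW (Sle _ _); lia.
  by rewrite -(subnKC kn'); apply: congW (Sle _ _); lia.
(* Iterates from the index 2 i + 3 j on agree at the coefficient (i, j), so the limit can be read
   there. *)
pose s : fps K * fps K :=
  ((fun i j => (S (2 * i + 3 * j)%N).1 i j), (fun i j => (S (2 * i + 3 * j)%N).2 i j)).
have sS n : cong n s (S n).
  split=> i j ij; rewrite fpsB /=.
    have [k1 k2] := @SS (2 * i + 3 * j)%N n (minn (2 * i + 3 * j) n)
      (geq_minl _ _) (geq_minr _ _).
    by have := k1 i j; rewrite fpsB; apply; lia.
  have [k1 k2] := @SS (2 * i + 3 * j)%N n (minn (2 * i + 3 * j) n)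
    (geq_minl _ _) (geq_minr _ _).
  by have := k2 i j; rewrite fpsB; apply; lia.
have sok : cong m s s0 by apply: cong_trans (sS m) (Sok m).
exists s; split=> //; apply: cong_eq => n.
apply: (cong_trans (t := S (m + n).+1)).
  apply: congW (T_contr (n := (m + n)%N) _ sok (Sok _) (sS _)); rewrite ?leq_addr //.
  by rewrite ltnW // ltnS leq_addl.
by apply: cong_sym; apply: congW (sS _); rewrite ltnW // ltnS leq_addl.
Qed.

End Contraction.

(** * Higher derivations and the substitutions they generate *)

Section HasseSchmidt.
Variable K : fieldType.
Implicit Types f g : fps K.

Lemma tri_sum (V : nmodType) N (F : nat -> nat -> V) :
  \sum_(a < N) \sum_(b < N - a) F a b = \sum_(l < N) \sum_(a < l.+1) F a (l - a)%N.
Proof.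
elim: N => [|N IH]; first by rewrite !big_ord0.
rewrite [RHS]big_ord_recr /= -IH big_ord_recr /= subSnn big_ord1.
rewrite [in RHS]big_ord_recr /= subnn addrA -big_split; congr (_ + _).
apply: eq_bigr => a _ /=; rewrite subSn; last exact: ltnW.
by rewrite big_ord_recr.
Qed.

(** The first sum is the Cauchy product; the second collects the cross terms of a product of
    truncations, which will have order at least [N]. *)
Lemma square_sum (V : nmodType) N (F : nat -> nat -> V) :
  \sum_(a < N) \sum_(b < N) F a b =
  \sum_(l < N) \sum_(a < l.+1) F a (l - a)%N +
  \sum_(a < N) \sum_(b < N | (N <= a + b)%N) F a b.
Proof.
rewrite -tri_sum -big_split; apply: eq_bigr => a _ /=.
rewrite (bigID (fun b : 'I_N => (b < N - a)%N)) /=; congr (_ + _).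
  rewrite -(big_ord_widen _ (fun b => F a b)) //; lia.
by apply: eq_bigl => b; lia.
Qed.

(** A higher derivation: the product rule makes the sum of the c^l [E l] multiplicative, and the
    last clause makes it converge formally. *)
Definition hasse_schmidt (E : nat -> fps K -> fps K) :=
  [/\ forall l, lin (E l), forall g, E 0%N g = g,
      forall l, E l 1 = (l == 0%N)%:R,
      forall l f g, E l (f * g) = \sum_(i < l.+1) E i f * E (l - i)%N g &
      forall l n g, ord n g -> ord (n + l) (E l g)].

(** For a higher derivation the terms with l > 2 i + 3 j do not reach the coefficient (i, j), so
    this finite sum is the whole series. *)
Definition hs_sum (E : nat -> fps K -> fps K) (c : K) g : fps K :=
  fun i j => \sum_(l < (2 * i + 3 * j).+1) c ^+ l * E l g i j.

Lemma cont_raise (Phi : fps K -> fps K) :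
  (forall n g, ord n g -> ord n (Phi g)) -> cont Phi.
Proof.
move=> h n; exists (3 * n)%N => f fn i j ij.
by apply: (h _ _ (ordw_deg (p := 2) (q := 3) isT isT fn)); lia.
Qed.

Variables (E : nat -> fps K -> fps K) (c : K).
Hypothesis E_hs : hasse_schmidt E.
Let Elin l : lin (E l). Proof. by case: E_hs. Qed.
Let E0 g : E 0%N g = g. Proof. by case: E_hs. Qed.
Let E1 l : E l 1 = (l == 0%N)%:R. Proof. by case: E_hs. Qed.
Let EM l f g : E l (f * g) = \sum_(i < l.+1) E i f * E (l - i)%N g.
Proof. by case: E_hs. Qed.
Let Eord l n g : ord n g -> ord (n + l) (E l g).
Proof. by case: E_hs => _ _ _ _; apply. Qed.
Arguments Eord l {n g} _.

Lemma hs_sum_trunc N g : ord N (hs_sum E c g - \sum_(l < N) c ^+ l *: E l g).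
Proof.
move=> i j ij; rewrite fpsB fps_sum /hs_sum.
rewrite (sum_pad (N := N) (F := fun l => c ^+ l * E l g i j)) //.
  by rewrite subrr.
by move=> l ijl; rewrite (Eord l (@ordw0n K 2 3 g)) ?mulr0.
Qed.
Arguments hs_sum_trunc N g : clear implicits.

Lemma lin_hs_sum : lin (hs_sum E c).
Proof.
split=> [f g|a f]; apply: fpsP => i j; rewrite ?fpsD ?fpsZ /hs_sum.
  by rewrite -big_split; apply: eq_bigr => l _; rewrite (Elin l).1 fpsD mulrDr.
by rewrite mulr_sumr; apply: eq_bigr => l _; rewrite (Elin l).2 fpsZ mulrCA.
Qed.

Lemma hs_sum_ord n g : ord n g -> ord n (hs_sum E c g).
Proof.
move=> gn i j ij; rewrite /hs_sum big1 // => l _.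
by rewrite (Eord l gn) ?mulr0 // ltn_addr.
Qed.

Lemma cont_hs_sum : cont (hs_sum E c).
Proof. by apply: cont_raise; exact: hs_sum_ord. Qed.

Lemma hs_sumM f g : hs_sum E c (f * g) = hs_sum E c f * hs_sum E c g.
Proof.
apply/eqP; rewrite -subr_eq0; apply/eqP; apply: (@ordw_eq0 _ 2 3) => // N.
pose t h := \sum_(l < N) c ^+ l *: E l h.
apply: (ordw_trans (g := t (f * g))); first exact: hs_sum_trunc.
apply: ordwBC; apply: (ordw_trans (g := t f * t g)).
  have -> : hs_sum E c f * hs_sum E c g - t f * t g =
    (hs_sum E c f - t f) * hs_sum E c g + t f * (hs_sum E c g - t g) by ring.
  apply: ordwD.
    rewrite -[N]addn0; apply: ordwM (ordw0n _); exact: hs_sum_trunc.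
  by rewrite -[N]add0n; apply: ordwM (ordw0n _) _; exact: hs_sum_trunc.
have -> : t f * t g = \sum_(a < N) \sum_(b < N) c ^+ (a + b) *: (E a f * E b g).
  rewrite /t mulr_suml; apply: eq_bigr => a _; rewrite mulr_sumr.
  by apply: eq_bigr => b _; rewrite -scalerAl -scaleAr scalerA exprD.
rewrite (square_sum N (fun a b => c ^+ (a + b) *: (E a f * E b g))).
have -> : t (f * g) =
    \sum_(l < N) \sum_(a < l.+1) c ^+ (a + (l - a)) *: (E a f * E (l - a)%N g).
  apply: eq_bigr => l _; rewrite EM scaler_sumr; apply: eq_bigr => a _.
  by rewrite subnKC // -ltnS.
rewrite addrC addKr; apply: ordw_sum => a _; apply: ordw_sum => b abN.
apply: ordwZ; apply: ordwW abN _; apply: ordwM.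
  by have := Eord a (@ordw0n K 2 3 f).
by have := Eord b (@ordw0n K 2 3 g).
Qed.

Lemma hs_sum1 : hs_sum E c 1 = 1.
Proof.
apply: fpsP => i j; rewrite /hs_sum big_ord_recl E0 expr0 mul1r big1 ?addr0 //.
by move=> l _; rewrite E1 mulr0.
Qed.

(** A linear, continuous and multiplicative operator is the substitution of the images of x and
    y. *)
Lemma hs_sum_comp g :
  hs_sum E c g = fcomp g (hs_sum E c (fx K), hs_sum E c (fy K)).
Proof.
have nc0 : no_constant_term (hs_sum E c (fx K), hs_sum E c (fy K)).
  by split; rewrite /= /hs_sum big_ord1 E0 expr0 mul1r.
move: g; apply: lin_ext => [||||k l].
- exact: lin_hs_sum.
- exact: cont_hs_sum.
- exact: lin_fcomp.
- exact: cont_fcomp.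
rewrite fcomp_mono // monoE hs_sumM; congr (_ * _).
  by elim: k => [|k IH]; rewrite ?hs_sum1 // !exprS hs_sumM IH.
by elim: l => [|l IH]; rewrite ?hs_sum1 // !exprS hs_sumM IH.
Qed.

End HasseSchmidt.

Arguments hs_sum_trunc {K E} c _ N g.

(** * Flows of a derivation at a variable time *)

Section DividedPowers.
Variable K : numFieldType.
Variables (Z : fps K -> fps K) (e : fps K) (a b : nat).
Hypotheses (Zlin : lin Z) (ZM : forall f g, Z (f * g) = Z f * g + f * Z g).
Hypotheses (e_ord : ord a e)
  (Z_ord : forall n g, ord n g -> ord (n + b - a) (Z g)).

(** Taylor coefficients in c of [g] along the flow of [Z] at the time c [e]. The factor [e] stays
    outside the iterates: the time depends on the point but is frozen while flowing. With [e = 1]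
    this gives the exponential. *)
Definition divpow l g : fps K := (l`!%:R)^-1 *: (e ^+ l * iter l Z g).

Lemma lin_iter l : lin (iter l Z).
Proof.
elim: l => [|l IH]; first exact: lin_id.
by split=> [f g|k f]; rewrite !iterS ?IH.1 ?IH.2 ?Zlin.1 ?Zlin.2.
Qed.

Lemma iter_leibniz l f g : iter l Z (f * g) =
  \sum_(i < l.+1) 'C(l, i)%:R *: (iter i Z f * iter (l - i) Z g).
Proof.
elim: l => [|l IH]; first by rewrite big_ord1 bin0 scale1r.
rewrite iterS IH (lin_sum Zlin).
under eq_bigr => i _ do rewrite Zlin.2 ZM scalerDr.
rewrite big_split /= [RHS]big_ord_recl /= bin0 scale1r ?subn0.
rewrite [X in _ = _ + X](eq_bigr (fun i : 'I_l.+1 =>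
    'C(l, i)%:R *: (Z (iter i Z f) * iter (l - i) Z g) +
    'C(l, i.+1)%:R *: (Z (iter i Z f) * iter (l - i) Z g))); last first.
  by move=> i _; rewrite /bump /= add1n subSS binS addnC natrD scalerDl.
rewrite big_split /= addrCA; congr (_ + _).
rewrite [RHS]addrC big_ord_recl [X in _ = X + _]big_ord_recr /=.
rewrite bin0 scale1r ?subn0 bin_small // scale0r addr0 addrC; congr (_ + _).
apply: eq_bigr => i _; rewrite /bump /= add1n; congr (_ *: (_ * _)).
by rewrite -iterS; congr (iter _ Z g); have := ltn_ord i; lia.
Qed.

Lemma iter_ord l n g : ord n g -> ord (n + b * l - a * l) (iter l Z g).
Proof.
move=> gn; elim: l => [|l IH]; first by rewrite !muln0 addn0 subn0.
by rewrite iterS; apply: ordwW (Z_ord IH); rewrite !mulnS; lia.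
Qed.
Arguments iter_ord l {n g} _.

Lemma divpow_ord l n g : ord n g -> ord (n + b * l) (divpow l g).
Proof.
move=> gn; apply: ordwZ.
by apply: ordwW (ordwM (ordwX l e_ord) (iter_ord l gn)); lia.
Qed.
Arguments divpow_ord l {n g} _.

Lemma divpow0 g : divpow 0 g = g.
Proof. by rewrite /divpow expr0 mul1r fact0 invr1 scale1r. Qed.

Lemma divpow_hs : (0 < b)%N -> hasse_schmidt divpow.
Proof.
move=> b0; split.
- move=> l; split=> [f g|k f]; rewrite /divpow.
    by rewrite (lin_iter l).1 mulrDr scalerDr.
  by rewrite (lin_iter l).2 -scaleAr !scalerA mulrC.
- exact: divpow0.
- have Z1 : Z 1 = 0.
    have := ZM 1 1; rewrite !mulr1 mul1r => /eqP.
    by rewrite -subr_eq0 opprD addNKr oppr_eq0 => /eqP.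
  case=> [|l]; first exact: divpow0.
  rewrite /divpow iterSr Z1.
  by rewrite (lin0 (lin_iter l)) mulr0 scaler0.
- move=> l f g; rewrite /divpow iter_leibniz mulr_sumr scaler_sumr.
  apply: eq_bigr => i _; have il : (i <= l)%N by rewrite -ltnS.
  rewrite -scaleAr -!scalerAl -!scaleAr !scalerA; congr (_ *: _); last first.
    by rewrite -{1}(subnKC il) exprD; ring.
  have h n : (n`!%:R : K) != 0 by rewrite pnatr_eq0 -lt0n fact_gt0.
  have hb : ('C(l, i)%:R : K) != 0 by rewrite pnatr_eq0 -lt0n bin_gt0.
  by rewrite -(bin_fact il) !natrM; field; rewrite hb !h.
- by move=> l n g gn; apply: ordwW (divpow_ord l gn); nia.
Qed.

End DividedPowers.

(** * Exponentials and logarithms *)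

Section Exponential.
Variable K : numFieldType.
Implicit Types (f g h : fps K) (X Y phi : fps K * fps K).

Notation nc := no_constant_term.
Notation x := (fx K).
Notation y := (fy K).

Lemma ord_x : ord 2 x. Proof. exact: (ordw_mono 2 3 1 0). Qed.
Lemma ord_y : ord 3 y. Proof. exact: (ordw_mono 2 3 0 1). Qed.

Definition expvf X g := hs_sum (divpow (vf_apply X) 1) 1 g.

Lemma divpow_vfE X l g : divpow (vf_apply X) 1 l g = (l`!%:R)^-1 *: iter l (vf_apply X) g.
Proof. by rewrite /divpow expr1n mul1r. Qed.

Lemma raisesS X n g : raises X 1 -> ord n g -> ord n.+1 (vf_apply X g).
Proof. by move=> X1 gn; have := raisesP X1 gn; rewrite addn1. Qed.

Lemma iter_vf_ord X l n g : raises X 1 -> ord n g -> ord (n + l) (iter l (vf_apply X) g).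
Proof.
move=> X1 gn; elim: l => [|l IH]; first by rewrite addn0.
by rewrite iterS addnS; apply: raisesS.
Qed.
Arguments iter_vf_ord {X} l {n g} _ _.

Lemma exp_hs X : raises X 1 -> hasse_schmidt (divpow (vf_apply X) 1).
Proof.
move=> X1; apply: (@divpow_hs _ _ _ 0 1) => //.
- exact: lin_vf.
- exact: vfM.
- by move=> n g gn; rewrite subn0; apply: raisesP.
Qed.

Lemma expvf_trunc N X g : raises X 1 ->
  ord N (expvf X g - \sum_(l < N) (l`!%:R)^-1 *: iter l (vf_apply X) g).
Proof.
move=> X1; have := hs_sum_trunc 1 (exp_hs X1) N g.
by under eq_bigr => l _ do rewrite expr1n scale1r divpow_vfE.
Qed.
Arguments expvf_trunc N {X} g _.

Lemma expvf_trunc_lin (Phi : fps K -> fps K) a N X g : lin Phi ->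
  (forall n f, ord n f -> ord (n - a) (Phi f)) -> raises X 1 ->
  ord (N - a) (Phi (expvf X g) - \sum_(l < N) (l`!%:R)^-1 *: Phi (iter l (vf_apply X) g)).
Proof.
move=> Pl Po X1; have := Po _ _ (expvf_trunc N g X1).
rewrite (linB Pl) (lin_sum Pl).
by under eq_bigr => l _ do rewrite Pl.2.
Qed.
Arguments expvf_trunc_lin {Phi a} N {X} g _ _ _.

Lemma expvf_comp X g : raises X 1 ->
  expvf X g = fcomp g (expvf X x, expvf X y).
Proof. by move=> X1; apply: hs_sum_comp; apply: exp_hs. Qed.

Lemma lin_expvf X : raises X 1 -> lin (expvf X).
Proof. by move=> X1; apply: lin_hs_sum; apply: exp_hs. Qed.

Lemma expvf_ord X n g : raises X 1 -> ord n g -> ord n (expvf X g).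
Proof. by move=> X1; apply: hs_sum_ord; apply: exp_hs. Qed.

Lemma expvfM X f g : raises X 1 -> expvf X (f * g) = expvf X f * expvf X g.
Proof. by move=> X1; apply: hs_sumM; apply: exp_hs. Qed.

Lemma expvf_split X N g : raises X 1 -> ord N.+2
  (expvf X g - g - vf_apply X g -
   \sum_(l < N) (l.+2`!%:R)^-1 *: iter l.+2 (vf_apply X) g).
Proof.
move=> X1; have := expvf_trunc N.+2 g X1.
rewrite big_ord_recl big_ord_recl /= /bump /= !fact0 invr1 !scale1r.
by rewrite !opprD !addrA.
Qed.
Arguments expvf_split {X} N g _.

Lemma expvf_tail X n g : raises X 1 -> ord n (vf_apply X g) ->
  ord n.+1 (expvf X g - g - vf_apply X g).
Proof.
move=> X1 gn; rewrite -[expvf X g - _ - _](subrK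
  (\sum_(l < n) (l.+2`!%:R)^-1 *: iter l.+2 (vf_apply X) g)).
apply: ordwD; first by apply: ordwW (expvf_split n g X1).
apply: ordw_sum => l _; apply: ordwZ; rewrite iterSr.
by apply: ordwW (iter_vf_ord l.+1 X1 gn); lia.
Qed.

Lemma expvf_sub_ord X n g : raises X 1 -> ord n g -> ord n.+1 (expvf X g - g).
Proof.
move=> X1 gn; rewrite -[expvf X g - g](subrK (vf_apply X g)).
have h : ord n.+1 (vf_apply X g) by apply: raisesS.
by apply: ordwD => //; apply: ordwW (expvf_tail X1 h).
Qed.

(** If exp X fixes [g], then X g is minus the sum of the terms of degree at least two, which has
    larger order than X g; hence X g has infinite order. *)
Lemma expvf_fix X g : raises X 1 -> expvf X g = g -> vf_apply X g = 0.
Proof.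
move=> X1 e; apply: (@ordw_eq0 _ 2 3) => // n; elim: n => [|n IH].
  exact: ordw0n.
by have := expvf_tail X1 IH; rewrite e subrr sub0r => /ordwN; rewrite opprK.
Qed.

Lemma vf_applyB X Y g :
  vf_apply X g - vf_apply Y g = vf_apply (X.1 - Y.1, X.2 - Y.2) g.
Proof. by rewrite !vfE /= !mulrBl opprD addrACA. Qed.

Lemma iter_vf_diff X Y r l n g : raises X 1 -> raises Y 1 ->
  raises (X.1 - Y.1, X.2 - Y.2) r -> ord n g ->
  ord (n + r + l) (iter l.+1 (vf_apply X) g - iter l.+1 (vf_apply Y) g).
Proof.
move=> X1 Y1 d gn; elim: l => [|l IH].
  by rewrite addn0 /= vf_applyB; apply: raisesP.
rewrite !(iterS l.+1) -(subrKA (vf_apply X (iter l.+1 (vf_apply Y) g))).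
apply: ordwD.
  by rewrite -(linB (lin_vf _)) addnS; apply: raisesS.
rewrite vf_applyB; apply: ordwW (raisesP d (iter_vf_ord l.+1 Y1 gn)); lia.
Qed.
Arguments iter_vf_diff {X Y r} l {n g} _ _ _ _.

(** The part of exp X beyond X is at least quadratic in X and so contracts differences. This is what
    makes the logarithm a fixed point. *)
Lemma expvf_diff X Y r n g : raises X 1 -> raises Y 1 ->
  raises (X.1 - Y.1, X.2 - Y.2) r -> ord n g ->
  ord (n + r).+1 ((expvf X g - vf_apply X g) - (expvf Y g - vf_apply Y g)).
Proof.
move=> X1 Y1 d gn; set N := (n + r)%N.
have hX := expvf_split N g X1; have hY := expvf_split N g Y1.
pose s Z := \sum_(l < N) (l.+2`!%:R)^-1 *: iter l.+2 (vf_apply Z) g.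
have -> : (expvf X g - vf_apply X g) - (expvf Y g - vf_apply Y g) =
   (expvf X g - g - vf_apply X g - s X) - (expvf Y g - g - vf_apply Y g - s Y) +
   (s X - s Y) by ring.
apply: ordwD; first by apply: ordwW (ordwB hX hY).
rewrite /s -sumrB; apply: ordw_sum => l _; rewrite -scalerBr; apply: ordwZ.
by apply: ordwW (iter_vf_diff l.+1 X1 Y1 d gn); lia.
Qed.

Lemma cong_raises n X : cong n X (0, 0) <-> raises X n.
Proof. by rewrite /cong /raises !subr0 ![(n + _)%N]addnC. Qed.

(** The logarithm is the fixed point of X -> X + phi - exp X, a contraction by [expvf_diff]. *)
Lemma log_exists phi : cong 1 phi (fid K) ->
  exists2 X, raises X 1 & phi = (expvf X x, expvf X y).
Proof.
move=> [phi1 phi2].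
pose T X := (X.1 + phi.1 - expvf X x, X.2 + phi.2 - expvf X y).
have [|n X Y n1 /cong_raises X1 /cong_raises Y1 [d1 d2]|] :=
    @contraction_fixpoint K 1 (0, 0) T.
- move=> X /cong_raises X1; apply/cong_raises; split.
    have -> : (T X).1 = X.1 + (phi.1 - x) - (expvf X x - x) by rewrite /T /=; ring.
    by apply: ordwB; [apply: ordwD => //; case: X1|exact: expvf_sub_ord X1 ord_x].
  have -> : (T X).2 = X.2 + (phi.2 - y) - (expvf X y - y) by rewrite /T /=; ring.
  by apply: ordwB; [apply: ordwD => //; case: X1|exact: expvf_sub_ord X1 ord_y].
- have dr : raises (X.1 - Y.1, X.2 - Y.2) n by rewrite /raises ![(n + _)%N]addnC.
  have := expvf_diff X1 Y1 dr ord_x; have := expvf_diff X1 Y1 dr ord_y.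
  rewrite !vfx !vfy => h2 h1; split=> /=.
    have -> : X.1 + phi.1 - expvf X x - (Y.1 + phi.1 - expvf Y x) =
      (expvf Y x - Y.1) - (expvf X x - X.1) by ring.
    by apply: ordwBC; rewrite addnS.
  have -> : X.2 + phi.2 - expvf X y - (Y.2 + phi.2 - expvf Y y) =
    (expvf Y y - Y.2) - (expvf X y - X.2) by ring.
  by apply: ordwBC; rewrite addnS.
move=> X [/cong_raises X1 XT _]; exists X => //.
have [h1 h2] : (T X).1 = X.1 /\ (T X).2 = X.2 by rewrite XT.
move: h1 h2; rewrite /T /= => h1 h2.
rewrite [LHS]surjective_pairing; congr pair; apply/eqP; rewrite -subr_eq0.
  by rewrite -(inj_eq (addrI X.1)) addrA h1 addr0.
by rewrite -(inj_eq (addrI X.2)) addrA h2 addr0.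
Qed.

Lemma expvf_series X g i j n : raises X 1 -> (2 * i + 3 * j < n)%N ->
  \sum_(k < n) iter k (vf_apply X) g i j / k`!%:R = expvf X g i j.
Proof.
move=> X1 ij; rewrite /expvf /hs_sum.
rewrite -(sum_pad (n := (2 * i + 3 * j).+1)
  (F := fun k => iter k (vf_apply X) g i j / k`!%:R)) //; last first.
  move=> k kij; have := iter_vf_ord k X1 (@ordw0n K 2 3 g).
  by move=> ->; rewrite ?mul0r.
apply: eq_bigr => k _.
by rewrite expr1n mul1r divpow_vfE fpsZ mulrC.
Qed.

Lemma raises_is_exp X phi : raises X 1 -> unipotent_diffeo phi ->
  phi = (expvf X x, expvf X y) -> is_exp X phi.
Proof.
move=> X1 phi_u phi_E; split=> // g i j.
exists (2 * i + 3 * j).+1 => //= n ijn.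
by rewrite expvf_series // expvf_comp // -phi_E.
Qed.

Lemma is_exp_raises X phi g : raises X 1 -> is_exp X phi ->
  expvf X g = fcomp g phi.
Proof.
move=> X1 [_ h]; apply: fpsP => i j; have [n _ hn] := h g i j.
have := hn (maxn n (2 * i + 3 * j).+1); rewrite /= leq_maxl => /(_ isT) <-.
by rewrite expvf_series // leq_maxr.
Qed.

Lemma ord2_cases (i : 'I_2) : i = 0 \/ i = 1.
Proof. by case: i => [[|[|//]]] ?; [left|right]; apply: val_inj. Qed.

Lemma det_mx2 (M : 'M[K]_2) : \det M = M 0 0 * M 1 1 - M 0 1 * M 1 0.
Proof.
rewrite (expand_det_row _ 0) !big_ord_recl big_ord0 addr0 /cofactor !det_mx11.
have l0 : lift ord0 ord0 = 1 :> 'I_2 by apply: val_inj.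
have l1 : lift 1 0 = 0 :> 'I_2 by apply: val_inj.
have l2 : lift 0 0 = 1 :> 'I_2 by apply: val_inj.
by rewrite !mxE ?l0 ?l1 ?l2 /= expr0 expr1 mul1r mulN1r mulrN.
Qed.

(** The determinant vanishes, so Cayley-Hamilton reads M^2 = (tr M) M; the powers of M are then
    multiples of M by powers of the trace. *)
Lemma nilpotent_mx2 (M : 'M[K]_2) k : M ^+ k = 0 -> M ^+ 2 = 0.
Proof.
move=> Mk; case: k Mk => [|k].
  by rewrite expr0 => /eqP; rewrite oner_eq0.
move=> Mk; have d0 : \det M = 0.
  have := congr1 (fun A : 'M[K]_2 => \det A) Mk; rewrite det0.
  have -> : \det (M ^+ k.+1) = (\det M) ^+ k.+1.
    by elim: (k.+1) => [|m IH]; rewrite ?det1 // !exprS det_mulmx IH.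
  by move/eqP; rewrite expf_eq0 => /eqP.
have M2 : M ^+ 2 = (M 0 0 + M 1 1) *: M.
  move: d0; rewrite det_mx2 expr2 => d0.
  apply/matrixP => i j; rewrite !mxE !big_ord_recl big_ord0 addr0.
  rewrite (_ : lift ord0 ord0 = 1); last exact: val_inj.
  have d : M 0 0 * M 1 1 = M 0 1 * M 1 0 by apply/eqP; rewrite -subr_eq0 d0.
  by case: (ord2_cases i) => ->; case: (ord2_cases j) => ->; ring: d.
have Mt m : M ^+ m.+1 = (M 0 0 + M 1 1) ^+ m *: M.
  elim: m => [|m IH]; first by rewrite scale1r.
  by rewrite exprS IH -scalerAr -expr2 M2 scalerA -exprSr.
move: Mk; rewrite Mt => /eqP; rewrite scaler_eq0 expf_eq0 => /orP[/andP[_ /eqP t0]|/eqP ->].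
  by rewrite M2 t0 scale0r.
by rewrite expr0n.
Qed.

Lemma mx2_sqr0 (M : 'M[K]_2) : M ^+ 2 = 0 ->
  forall i j, M i 0 * M 0 j + M i 1 * M 1 j = 0.
Proof.
move=> M2 i j; have := congr1 (fun A : 'M[K]_2 => A i j) M2.
rewrite expr2 !mxE !big_ord_recl big_ord0 addr0.
by rewrite (_ : lift ord0 ord0 = 1); last exact: val_inj.
Qed.

Lemma linear_partE X : [/\ linear_part X 0 0 = X.1 1%N 0%N,
  linear_part X 0 1 = X.1 0%N 1%N, linear_part X 1 0 = X.2 1%N 0%N &
  linear_part X 1 1 = X.2 0%N 1%N].
Proof. by split; rewrite mxE. Qed.

Lemma vf_linear X g : nc X ->
  vf_apply X g 1%N 0%N = X.1 1%N 0%N * g 1%N 0%N + X.2 1%N 0%N * g 0%N 1%N /\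
  vf_apply X g 0%N 1%N = X.1 0%N 1%N * g 1%N 0%N + X.2 0%N 1%N * g 0%N 1%N.
Proof.
move=> [X10 X20]; rewrite vfE !fpsD !fpsM !big_ord_recl !big_ord0 /= /bump /=.
by rewrite X10 X20 /fdx /fdy /= !mul0r !add0r !addr0 !mul1r.
Qed.

(** Applies to any nilpotent logarithm, in particular to the one chosen by [flog]. As its linear
    part has square zero, only the first two terms of the exponential reach the linear part of
    [phi], and the linear part of [X] can be read off. *)
Lemma is_exp_raises1 X phi : cong 1 phi (fid K) -> nilpotent_vf X -> is_exp X phi ->
  raises X 1.
Proof.
move=> [phi1 phi2] [Xnc [k Xk]] [_ hexp].
have [e00 e01 e10 e11] := linear_partE X.
have lin0 g l : (iter l.+2 (vf_apply X) g) 1%N 0%N = 0 /\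
    (iter l.+2 (vf_apply X) g) 0%N 1%N = 0.
  have m i j : linear_part X i 0 * linear_part X 0 j +
      linear_part X i 1 * linear_part X 1 j = 0.
    by apply: mx2_sqr0; exact: nilpotent_mx2 Xk.
  rewrite 2!iterS; set h := iter l _ g.
  have [a1 a2] := vf_linear (vf_apply X h) Xnc.
  have [b1 b2] := vf_linear h Xnc.
  rewrite a1 a2 b1 b2 -e00 -e01 -e10 -e11.
  move: (m 0 0) (m 0 1) (m 1 0) (m 1 1).
  set p := linear_part X 0 0; set q := linear_part X 0 1.
  set r := linear_part X 1 0; set t := linear_part X 1 1.
  move: (h 1%N 0%N) (h 0%N 1%N) => u v m1 m2 m3 m4; split.
    by transitivity ((p * p + q * r) * u + (r * p + t * r) * v);
      [ring | rewrite m1 m3; ring].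
  by transitivity ((p * q + q * t) * u + (r * q + t * t) * v);
    [ring | rewrite m2 m4; ring].
have lin1 g i j : (i, j) = (1%N, 0%N) \/ (i, j) = (0%N, 1%N) ->
    g i j + vf_apply X g i j = fcomp g phi i j.
  move=> ij; have [n _ hn] := hexp g i j.
  have := hn n.+2; rewrite /= (leq_trans (leqnSn _) (leqnSn _)) => /(_ isT) <-.
  rewrite big_ord_recl big_ord_recl /= /bump /= !fact0 !divr1 big1 ?addr0 // => l _.
  have [z1 z2] := lin0 g l; rewrite /= in z1 z2.
  by case: ij => -[-> ->]; rewrite ?z1 ?z2 mul0r.
have phi_nc : nc phi.
  by split; [have := phi1 0%N 0%N|have := phi2 0%N 0%N];
    rewrite fpsB /= /fx /fy /= subr0; apply.
have e1 : X.1 1%N 0%N = 0.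
  have := lin1 x 1%N 0%N (or_introl erefl); rewrite vfx fcomp_fx //.
  have := phi1 1%N 0%N isT; rewrite fpsB => /eqP; rewrite subr_eq0 => /eqP -> /eqP.
  by rewrite -subr_eq0 addrC addKr => /eqP.
have e2 : X.2 1%N 0%N = 0.
  have := lin1 y 1%N 0%N (or_introl erefl); rewrite vfy fcomp_fy //.
  have := phi2 1%N 0%N isT; rewrite fpsB => /eqP; rewrite subr_eq0 => /eqP -> /eqP.
  by rewrite -subr_eq0 addrC addKr => /eqP.
have e3 : X.2 0%N 1%N = 0.
  have := lin1 y 0%N 1%N (or_intror erefl); rewrite vfy fcomp_fy //.
  have := phi2 0%N 1%N isT; rewrite fpsB => /eqP; rewrite subr_eq0 => /eqP -> /eqP.
  by rewrite -subr_eq0 addrC addKr => /eqP.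
case: Xnc => X10 X20; split=> i j ij.
  by case: i ij => [|[|i]]; case: j => [|j] ij //; lia.
by case: i ij => [|[|i]]; case: j => [|[|j]] ij //; lia.
Qed.

End Exponential.

Arguments iter_vf_ord {K X} l {n g} _ _.
Arguments expvf_trunc {K} N {X} g _.
Arguments expvf_trunc_lin {K Phi a} N {X} g _ _ _.
Arguments expvf_split {K X} N g _.
Arguments iter_vf_diff {K X Y r} l {n g} _ _ _ _.

(** * Fields vanishing on the axis y = 0 *)

Section FixedCurve.
Variable K : numFieldType.
Implicit Types (f g h : fps K) (X Y phi : fps K * fps K).

Notation nc := no_constant_term.
Notation x := (fx K).
Notation y := (fy K).

(** Restriction to the axis, kept as a series in two variables so that it remains a ring morphism of
    [fps K]. A series is [rho f] plus y times [divy f]. *)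
Definition rho f : fps K := fun i j => if j is 0%N then f i 0%N else 0.
Definition divy f : fps K := fun i j => f i j.+1.
Definition intx f : fps K := fun i j => if i is i'.+1 then f i' j / i'.+1%:R else 0.

Lemma lin_rho : lin rho.
Proof.
split=> [f g|a f]; apply: fpsP => i [|j]; rewrite ?fpsD ?fpsZ //=.
  by rewrite addr0.
by rewrite mulr0.
Qed.
Lemma rho_ord n f : ord n f -> ord n (rho f).
Proof. by move=> fn i [|j] ij //=; apply: fn. Qed.
Lemma cont_rho : cont rho.
Proof. by apply: cont_raise => n f; apply: rho_ord. Qed.
Lemma lin_divy : lin divy.
Proof. by split=> [f g|a f]; apply: fpsP => i j. Qed.
Lemma divy_ord n f : ord n f -> ord (n - 3) (divy f).
Proof. by move=> fn i j ij; apply: fn; lia. Qed.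
Lemma lin_intx : lin intx.
Proof.
split=> [f g|a f]; apply: fpsP => -[|i] j; rewrite ?fpsD ?fpsZ /= ?addr0 ?mulr0 //.
  by rewrite fpsD mulrDl.
by rewrite fpsZ mulrA.
Qed.
Lemma intx_ord n f : ord n f -> ord (n + 2) (intx f).
Proof. by move=> fn [|i] j ij //=; rewrite fn ?mul0r //; lia. Qed.
Lemma fdx_intx f : fdx (intx f) = f.
Proof.
by apply: fpsP => i j; rewrite /fdx /= mulrC mulfVK // pnatr_eq0.
Qed.

Lemma nc_x0 : nc (x, 0 : fps K). Proof. by []. Qed.

Lemma rho_comp f : rho f = fcomp f (x, 0).
Proof.
move: f; apply: lin_ext => [||||k l].
- exact: lin_rho.
- exact: cont_rho.
- exact: lin_fcomp.
- exact: cont_fcomp nc_x0.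
rewrite fcomp_mono //=; case: l => [|l].
  rewrite expr0 mulr1 -[x ^+ k]mulr1 -(expr0 y) -monoE.
  by apply: fpsP => i [|j]; rewrite /rho /mono //= andbF.
by rewrite expr0n /= mulr0; apply: fpsP => i [|j] //=; rewrite /mono /= andbF.
Qed.

Lemma rhoM f g : rho (f * g) = rho f * rho g.
Proof. by rewrite !rho_comp fcompM. Qed.
Lemma rho_y : rho y = 0. Proof. by rewrite rho_comp fcomp_fy. Qed.
Lemma rho_x : rho x = x. Proof. by rewrite rho_comp fcomp_fx. Qed.
Lemma rho_ymul f : rho (y * f) = 0. Proof. by rewrite rhoM rho_y mul0r. Qed.
Lemma rhoD f g : rho (f + g) = rho f + rho g. Proof. exact: lin_rho.1. Qed.
Lemma rhoB f g : rho (f - g) = rho f - rho g. Proof. exact: (linB lin_rho). Qed.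
Lemma divy_ymul f : divy (y * f) = f.
Proof. by apply: fpsP => i j; rewrite /divy mul_fy. Qed.
Lemma rho0_ymul f : rho f = 0 -> f = y * divy f.
Proof.
move=> f0; apply: fpsP => i [|j]; rewrite mul_fy //.
by have := congr1 (fun g : fps K => g i 0%N) f0.
Qed.
Lemma ymul_inj f g : y * f = y * g -> f = g.
Proof. by move=> e; rewrite -(divy_ymul f) e divy_ymul. Qed.

Lemma rho_expvf_series a N X g : lin (rho \o divy) ->
  raises X 1 -> a = 3%N ->
  ord (N - a) (rho (divy (expvf X g)) -
    \sum_(l < N) (l`!%:R)^-1 *: rho (divy (iter l (vf_apply X) g))).
Proof.
move=> ll X1 ->; apply: (@expvf_trunc_lin K (rho \o divy) 3 N X g ll) => // n f fn.
by apply: rho_ord; apply: divy_ord.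
Qed.

Arguments rho_expvf_series {a} N {X} g _ _ _.

(** A diffeomorphism fixing the axis pointwise has a generator vanishing there: if the restriction
    of X to the axis has relative order n, the higher terms of the exponential have relative order n
    + 1 on the axis, and so must X. *)
Lemma log_vanishes X : raises X 1 -> rho (expvf X x) = x -> rho (expvf X y) = 0 ->
  rho X.1 = 0 /\ rho X.2 = 0.
Proof.
move=> X1 h1 h2.
suff h n : ord (n + 2) (rho X.1) /\ ord (n + 3) (rho X.2).
  by split; apply: (@ordw_eq0 _ 2 3) => // n; have [a b] := h n;
    [apply: ordwW a|apply: ordwW b]; lia.
elim: n => [|n [IH1 IH2]].
  by split; apply: rho_ord; [apply: ordwW (proj1 X1)|apply: ordwW (proj2 X1)].
have Xr m g : ord m g -> ord (m + n) (rho (vf_apply X g)).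
  move=> gm; rewrite vfE rhoD !rhoM; apply: ordwD.
    by apply: ordwW (ordwM IH1 (rho_ord (ordw_fdx gm))); lia.
  by apply: ordwW (ordwM IH2 (rho_ord (ordw_fdy gm))); lia.
have tail m g : ord m g -> rho (expvf X g) = rho g -> ord (m + n).+1 (rho (vf_apply X g)).
  move=> gm e; have := rho_ord (expvf_split (m + n)%N g X1).
  rewrite !rhoB e subrr sub0r (lin_sum lin_rho) => /(ordwW (leqnSn _)) h3.
  rewrite -[rho (vf_apply X g)]opprK.
  rewrite -[- rho (vf_apply X g)](subrK
    (\sum_(i < m + n) rho ((i.+2`!%:R)^-1 *: iter i.+2 (vf_apply X) g))).
  apply: ordwN; apply: ordwD => //; apply: ordw_sum => l _; rewrite lin_rho.2.
  apply: ordwZ; rewrite iterS.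
  by apply: ordwW (Xr _ _ (iter_vf_ord l.+1 X1 gm)); lia.
split.
  rewrite -(vfx X) addSn addnC; apply: tail; first exact: (@ord_x K).
  by rewrite h1 rho_x.
rewrite -(vfy X) addSn addnC; apply: tail; first exact: (@ord_y K).
by rewrite h2 rho_y.
Qed.

(** Along an axis of zeros, X acts on the normal derivative by multiplication by its transverse
    eigenvalue [rho (divy X.2)]. *)
Lemma iter_vf_multiplier X l : rho X.1 = 0 -> rho X.2 = 0 ->
  rho (iter l (vf_apply X) y) = 0 /\
  rho (divy (iter l (vf_apply X) y)) = rho (divy X.2) ^+ l.
Proof.
move=> X10 X20; elim: l => [|l [IH1 IH2]].
  split; first exact: rho_y.
  by rewrite /= -[y]mulr1 divy_ymul expr0; apply: fpsP => i [|j]; rewrite /rho ?fps1E ?andbF.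
rewrite iterS; set g := iter l _ y in IH1 IH2 *.
split; first by rewrite vfE rhoD !rhoM X10 X20 !mul0r addr0.
have gx : rho (fdx g) = 0.
  by rewrite (rho0_ymul IH1) fdxM [fdx y]fdx_mono scale0r mul0r add0r rho_ymul.
have gy : rho (fdy g) = rho (divy g).
  rewrite {1}(rho0_ymul IH1) fdyM [fdy y]fdy_mono scale1r mono00 mul1r.
  by rewrite rhoD rho_ymul addr0.
rewrite exprS -IH2 vfE {1}(rho0_ymul X10) {1}(rho0_ymul X20) -!mulrA -mulrDr.
by rewrite divy_ymul rhoD !rhoM gx gy mulr0 add0r.
Qed.

(** The normal derivative of exp X on the axis is the exponential of the eigenvalue, a series of
    positive order, and the exponential is injective on such series. *)
Lemma multiplier_inj X Y : raises X 1 -> raises Y 1 ->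
  rho X.1 = 0 -> rho X.2 = 0 -> rho Y.1 = 0 -> rho Y.2 = 0 ->
  rho (divy (expvf X y)) = rho (divy (expvf Y y)) ->
  rho (divy X.2) = rho (divy Y.2).
Proof.
move=> X1 Y1 X10 X20 Y10 Y20 e; apply/eqP; rewrite -subr_eq0; apply/eqP.
set b := rho (divy X.2); set c := rho (divy Y.2).
have b2 Z : raises Z 1 -> ord 2 (rho (divy Z.2)).
  move=> [_ Z2]; apply: rho_ord => i j ij; apply: Z2.
  by case: i ij => [|i] ij; lia.
suff h r : ord (2 + r) (b - c).
  by apply: (@ordw_eq0 _ 2 3) => // n; apply: ordwW (h n); lia.
elim: r => [|r IH]; first by apply: ordwB; apply: b2.
have hs : lin (rho \o divy) := lin_comp lin_rho lin_divy.
have hX := rho_expvf_series (r + 6).+2 y hs X1 erefl.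
have hY := rho_expvf_series (r + 6).+2 y hs Y1 erefl.
have := ordwB hX hY; rewrite e opprB addrC subrKA -sumrB.
under eq_bigr => l _ do
  rewrite (proj2 (iter_vf_multiplier l X10 X20)) (proj2 (iter_vf_multiplier l Y10 Y20)) -scalerBr.
rewrite !big_ord_recl /= /bump /= !expr0 subrr scaler0 add0r.
rewrite ?fact0 ?addn0 ?factS ?muln1 invr1 scale1r ?expr1 -/b -/c => h.
have h' := ordwW (_ : (2 + r).+1 <= _)%N h; rewrite -[b - c]opprB.
set S := \sum_(i < _) _ in h h'.
have hS : ord (2 + r).+1 S.
  apply: ordw_sum => l _; apply: ordwZ.
  have hp := pow_lip (1 + (1 + l)) (b2 _ Y1) (b2 _ X1) (ordwBC IH).
  by apply: ordwW hp; lia.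
rewrite -[c - b](addrK S) addnS; apply: ordwN; apply: ordwB => //.
by apply: h'; lia.
Qed.

(** * First integrals and the cohomological equation *)

Section Cohomological.
Variable X : fps K * fps K.
Hypotheses (X1 : raises X 1) (X10 : rho X.1 = 0) (X20 : rho X.2 = 0).
Hypothesis X01 : X.1 0%N 1%N = 1.

(** Divided by y, the field has a nonzero d/dx component at the origin; it is transverse to x = 0,
    so a first integral is determined by its restriction to that line. *)
Lemma first_integral_eq0 D : vf_apply X D = 0 -> (forall j, D 0%N j = 0) -> D = 0.
Proof.
move=> XD D0; have : divy X.1 * fdx D + divy X.2 * fdy D = 0.
  apply: ymul_inj; rewrite mulr0 -XD vfE.
  by rewrite {2}(rho0_ymul X10) {2}(rho0_ymul X20) -!mulrA -mulrDr.
set A := divy X.1; set B := divy X.2 => AB.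
apply: (@ordw_eq0 _ 2 3) => // n; elim: n => [|n IH]; first exact: ordw0n.
have A2 : ord 2 (A - 1).
  move=> i j ij; rewrite fpsB fps1E; case: i ij => [|i] ij; last by lia.
  by case: j ij => [|j] ij; [rewrite /A /divy X01 subrr | lia].
have B2 : ord 2 B.
  move=> i j ij; apply: (proj2 X1); lia.
have Dx : ord n.-1 (fdx D).
  have -> : fdx D = - ((A - 1) * fdx D + B * fdy D).
    apply/eqP; rewrite -addr_eq0; apply/eqP.
    by transitivity (A * fdx D + B * fdy D); [ring | exact: AB].
  apply: ordwN; apply: ordwD.
    by apply: ordwW (ordwM A2 (ordw_fdx IH)); lia.
  by apply: ordwW (ordwM B2 (ordw_fdy IH)); lia.
move=> [|i] j ij; first exact: D0.
have ij' : (2 * i + 3 * j < n.-1)%N by lia.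
by have /eqP := Dx i j ij'; rewrite /fdx mulf_eq0 pnatr_eq0 /= => /eqP.
Qed.

(** What remains of exp X - 1 after its leading part y d/dx. The leading part raises the order by 1
    and is inverted on multiples of y; the rest raises it by 2. *)
Definition cohom_rest g := expvf X g - g - y * fdx g.

Lemma lin_cohom_rest : lin cohom_rest.
Proof.
have [a b] := lin_expvf X1; split=> [f g|k f]; rewrite /cohom_rest ?a ?b ?fdxD ?fdxZ.
  by ring.
by rewrite -scaleAr !scalerBr.
Qed.

Lemma cohom_rest_ord n g : ord n g -> ord (n + 2) (cohom_rest g).
Proof.
move=> gn; rewrite /cohom_rest -[expvf X g - g](subrK (vf_apply X g)) -addrA.
apply: ordwD.
  by rewrite addn2; apply: expvf_tail X1 _; apply: raisesS.
have -> : vf_apply X g - y * fdx g = vf_apply (X.1 - y, X.2) g.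
  by rewrite !vfE /=; ring.
apply: raisesP => //; split=> /= i j ij.
  rewrite fpsB /fy; case: i ij => [|i] ij; case: j ij => [|[|j]] ij /=; try lia.
  - by rewrite (proj1 X1) // subr0.
  - by rewrite X01 subrr.
  - by have := congr1 (fun f : fps K => f i.+1 0%N) X10; rewrite /= => ->; rewrite subr0.
case: j ij => [|j] ij; last by apply: (proj2 X1); lia.
exact: (congr1 (fun f : fps K => f i 0%N) X20).
Qed.

Lemma rho_expvf g : rho (expvf X g) = rho g.
Proof.
have nc1 : nc (expvf X x, expvf X y).
  by split; [apply: (expvf_ord X1 (@ord_x K))|apply: (expvf_ord X1 (@ord_y K))].
rewrite expvf_comp // rho_comp fcompA //.
have rX g' : rho (vf_apply X g') = 0 by rewrite vfE rhoD !rhoM X10 X20 !mul0r addr0.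
have r1 h : rho (expvf X h) = rho h.
  apply/eqP; rewrite -subr_eq0; apply/eqP; apply: (@ordw_eq0 _ 2 3) => // N.
  have := rho_ord (expvf_trunc N.+1 h X1).
  rewrite rhoB (lin_sum lin_rho) big_ord_recl fact0 invr1 scale1r big1 ?addr0.
    by apply: ordwW.
  by move=> l _; rewrite lin_rho.2 /= rX scaler0.
by rewrite /fmap_comp /= -!rho_comp !r1 rho_x rho_y -rho_comp.
Qed.

(** G is the fixed point of G -> the primitive in x of (R - [cohom_rest] G) / y. As exp X acts
    trivially on the axis, R has to vanish there, and then the division by y loses nothing.
    Inverting y d/dx costs one unit of order. *)
Lemma cohomological R : rho R = 0 -> exists G,
  [/\ expvf X G - G = R, forall j, G 0%N j = 0 &
      forall n, ord n R -> ord n.-1 G].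
Proof.
move=> R0; pose S g := intx (divy (R - cohom_rest g)).
pose T (s : fps K * fps K) : fps K * fps K := (S s.1, 0).
have Sd f g n : ord (2 + n) (f - g) -> ord (2 + n.+1) (S f - S g).
  move=> fg; rewrite /S -(linB lin_intx) -(linB lin_divy).
  have -> : R - cohom_rest f - (R - cohom_rest g) = cohom_rest (g - f).
    by rewrite (linB lin_cohom_rest); ring.
  apply: ordwW (intx_ord (divy_ord (cohom_rest_ord (ordwBC fg)))); lia.
have [|n s t _ _ _ [st _]|s [sok sT _]] := @contraction_fixpoint K 0 (0, 0) T.
- move=> s _; split; rewrite /= ?subrr ?subr0; last exact: ordw_0.
  by apply: ordwW (intx_ord (ordw0n _)).
- by split; [exact: Sd | rewrite subrr; exact: ordw_0].
have SG : s.1 = S s.1 by rewrite -{1}sT.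
exists s.1; set G := s.1 in SG *; split.
- have h : divy (R - cohom_rest G) = fdx G by rewrite {2}SG /S fdx_intx.
  have r0 : rho (R - cohom_rest G) = 0.
    by rewrite rhoB R0 /cohom_rest !rhoB rho_expvf rho_ymul subrr subr0 subrr.
  have := rho0_ymul r0; rewrite h => e.
  have -> : expvf X G - G = cohom_rest G + y * fdx G by rewrite /cohom_rest; ring.
  by rewrite -e; ring.
- by move=> j; rewrite SG.
move=> n Rn.
suff h m : (m <= n.-1)%N -> ord m G by apply: h.
elim: m => [|m IH] mn; first exact: ordw0n.
have mG : ord m G by apply: IH; lia.
rewrite SG /S (linB lin_divy) (linB lin_intx); apply: ordwB.
  by apply: ordwW (intx_ord (divy_ord Rn)); lia.
by apply: ordwW (intx_ord (divy_ord (cohom_rest_ord mG))); lia.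
Qed.

End Cohomological.

End FixedCurve.

(** * The family of maps and their first integrals *)

Section Perturbation.
Variable K : numFieldType.
Implicit Types (f g h : fps K) (X Y phi : fps K * fps K).

Notation nc := no_constant_term.
Notation x := (fx K).
Notation y := (fy K).

Definition psum (G : nat -> fps K) (c : K) : fps K :=
  fun i j => \sum_(k < (2 * i + 3 * j).+1) c ^+ k * G k i j.

Lemma psum_trunc G c N : (forall k, ord k (G k)) ->
  ord N (psum G c - \sum_(k < N) c ^+ k *: G k).
Proof.
move=> Gk i j ij; rewrite fpsB fps_sum /psum.
rewrite (sum_pad (N := N) (F := fun l => c ^+ l * G l i j)) //.
  by rewrite subrr.
by move=> l ijl; rewrite (Gk l) ?mulr0.
Qed.

Arguments psum_trunc {G} c N _.

Lemma hs_sum_fix (E : nat -> fps K -> fps K) c g : hasse_schmidt E ->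
  (forall l, E l.+1 g = 0) -> hs_sum E c g = g.
Proof.
move=> [_ E0 _ _ _] Eg; apply: fpsP => i j; rewrite /hs_sum big_ord_recl E0.
by rewrite expr0 mul1r big1 ?addr0 // => l _; rewrite Eg mulr0.
Qed.

Lemma hs_sum_sub_ord (E : nat -> fps K -> fps K) c b n g : hasse_schmidt E ->
  (forall l f m, ord m f -> ord (m + b * l) (E l f)) -> ord n g ->
  ord (n + b) (hs_sum E c g - g).
Proof.
move=> [_ E0 _ _ _] Eo gn i j ij; rewrite fpsB /hs_sum big_ord_recl E0.
rewrite expr0 mul1r addrC addKr big1 // => l _.
by rewrite (Eo l.+1 _ _ gn) ?mulr0 //; rewrite mulnS; lia.
Qed.

(** * Perturbation series in a parameter *)

Section Solve.
Variables (X : fps K * fps K) (E : nat -> fps K -> fps K) (G0 : fps K).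
Hypotheses (X1 : raises X 1) (X10 : rho X.1 = 0) (X20 : rho X.2 = 0).
Hypothesis X01 : X.1 0%N 1%N = 1.
Hypothesis E_hs : hasse_schmidt E.
Hypothesis E_ord : forall l f m, ord m f -> ord (m + 3 * l) (E l f).
Hypothesis E_rho : forall l f, rho (E l.+1 f) = 0.
Hypothesis G0_ord : ord 3 G0.
Notation L := (expvf X).

Let E0 g : E 0%N g = g. Proof. by case: E_hs. Qed.
Let Elin l : lin (E l). Proof. by case: E_hs. Qed.

Definition cohom_sol R : fps K := xget 0 [set G | [/\ expvf X G - G = R,
  forall j, G 0%N j = 0 & forall n, ord n R -> ord n.-1 G]]%classic.

(** Course-of-values recursion: [pert_table k] holds the coefficients up to [k], each computed from
    all the previous ones. *)
Fixpoint pert_table k : nat -> fps K :=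
  if k is k'.+1 then fun m => if (m <= k')%N then pert_table k' m else
    cohom_sol (- \sum_(n < k'.+1) E n.+1 (L (pert_table k' (k' - n)%N)))
  else fun=> G0.

Definition pert k := pert_table k k.

Let pert_tableE k m : (m <= k)%N -> pert_table k m = pert m.
Proof.
elim: k => [|k IH]; first by rewrite leqn0 => /eqP ->.
by rewrite leq_eqVlt ltnS => /orP[/eqP ->//|mk]; rewrite /= mk IH.
Qed.

Lemma pert0 : pert 0 = G0. Proof. by []. Qed.

Lemma pertS k : [/\ L (pert k.+1) - pert k.+1 =
    - \sum_(n < k.+1) E n.+1 (L (pert (k - n)%N)),
  forall j, pert k.+1 0%N j = 0 & ord (3 + 2 * k.+1) (pert k.+1)].
Proof.
have [m] := ubnP k; elim: m k => // m IHm k km.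
have ordk i : (i <= k)%N -> ord (3 + 2 * i) (pert i).
  by case: i => [|i] ik; [exact: G0_ord | have [] := IHm i (leq_trans ik km)].
rewrite /pert /= ltnn; set R := - _.
have RE : R = - \sum_(n < k.+1) E n.+1 (L (pert (k - n)%N)).
  by congr (- _); apply: eq_bigr => n _; rewrite pert_tableE // leq_subr.
have R0 : rho R = 0.
  by rewrite RE (linN (lin_rho _)) (lin_sum (lin_rho _)) big1 ?oppr0.
have [G hG] := cohomological X1 X10 X20 X01 R0.
have [h1 h2 h3] : [/\ L (cohom_sol R) - cohom_sol R = R,
    forall j, cohom_sol R 0%N j = 0 & forall n, ord n R -> ord n.-1 (cohom_sol R)].
  by rewrite /cohom_sol; case: xgetP => [g -> //|/(_ G)]; case.
split=> //; first by rewrite h1 RE.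
suff : ord (3 + 2 * k.+1).+1 R by move/h3.
rewrite RE; apply: ordwN; apply: ordw_sum => n _.
have nk : (n <= k)%N by rewrite -ltnS.
have hk := E_ord (l := n.+1) (expvf_ord X1 (ordk _ (leq_subr n k))).
by apply: ordwW hk; lia.
Qed.

Lemma pert_ord k : ord (3 + 2 * k) (pert k).
Proof. by case: k => [|k]; [exact: G0_ord | have [] := pertS k]. Qed.

(** The equations of [pertS] summed with weights c^k. When G0 is invariant under [expvf X] the sum
    is a first integral of the perturbed map; otherwise it solves a cohomological equation whose
    right-hand side is independent of c. *)
Lemma pert_psum c : hs_sum E c (L (psum pert c)) - psum pert c = L G0 - G0.
Proof.
set U := psum pert c.
have po k : ord k (pert k) by apply: ordwW (@pert_ord k); lia.
apply/eqP; rewrite -subr_eq0; apply/eqP; apply: (@ordw_eq0 _ 2 3) => // -[|N].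
  exact: ordw0n.
have UN := psum_trunc c N.+1 po; set T := \sum_(k < _) _ in UN.
have h1 : ord N.+1 (hs_sum E c (L U) - hs_sum E c (L T)).
  rewrite -(linB (lin_hs_sum c E_hs)) -(linB (lin_expvf X1)).
  by apply: hs_sum_ord => //; apply: expvf_ord.
have h2 := hs_sum_trunc c E_hs N.+1 (L T).
have h3 : ord N.+1 (\sum_(l < N.+1) c ^+ l *: E l (L T) -
    \sum_(l < N.+1) \sum_(a < l.+1) c ^+ (a + (l - a)) *: E a (L (pert (l - a)%N))).
  have -> : \sum_(l < N.+1) c ^+ l *: E l (L T) =
      \sum_(a < N.+1) \sum_(b < N.+1) c ^+ (a + b) *: E a (L (pert b)).
    apply: eq_bigr => a _; rewrite (lin_sum (lin_expvf X1)) (lin_sum (Elin a)).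
    rewrite scaler_sumr; apply: eq_bigr => b _.
    by rewrite (lin_expvf X1).2 (Elin a).2 scalerA exprD.
  rewrite (square_sum N.+1 (fun a b => c ^+ (a + b) *: E a (L (pert b)))).
  rewrite addrC addKr; apply: ordw_sum => a _; apply: ordw_sum => b ab.
  apply: ordwZ; apply: ordwW (E_ord (l := a) (expvf_ord X1 (po b))); lia.
have h4 : \sum_(l < N.+1) \sum_(a < l.+1) c ^+ (a + (l - a)) *: E a (L (pert (l - a)%N))
    = T + (L G0 - G0).
  rewrite /T [LHS]big_ord_recl [in RHS]big_ord_recl /= big_ord1 E0 !expr0 !scale1r pert0 addrC [RHS]addrC.
  rewrite addrA subrK addrC; congr (_ + _); apply: eq_bigr => l _.
  rewrite /bump /= add1n; have [e _ _] := pertS l.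
  under eq_bigr => a _ do rewrite subnKC ?leq_ord //.
  rewrite -scaler_sumr; congr (_ *: _); rewrite big_ord_recl /= E0 subn0.
  under eq_bigr => a _ do rewrite /bump /= add1n subSS.
  by apply/eqP; rewrite -subr_eq0 addrAC e addNr.
have -> : hs_sum E c (L U) - U - (L G0 - G0) =
  (hs_sum E c (L U) - hs_sum E c (L T)) +
  (hs_sum E c (L T) - \sum_(l < N.+1) c ^+ l *: E l (L T)) +
  (\sum_(l < N.+1) c ^+ l *: E l (L T) - (T + (L G0 - G0))) - (U - T) by ring.
apply: ordwB => //; apply: ordwD; last by rewrite -h4.
exact: ordwD.
Qed.

End Solve.

(** * The maps and the first orders of their first integrals *)

Definition leaf_field : fps K * fps K := (1, 2 *: x).
Notation V := (vf_apply leaf_field).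
Definition base_field : fps K * fps K := (y, 2 *: (x * y)).
Notation X0 := base_field.
Definition u_leaf : fps K := x ^+ 2 - y.
Notation u := u_leaf.

Lemma base_fieldE g : vf_apply X0 g = y * V g.
Proof.
rewrite !vfE /= mul1r mulrDr; congr (_ + _).
by rewrite -!scalerAl -scaleAr; congr (_ *: _); ring.
Qed.

Lemma base_raises : raises X0 1.
Proof.
split; first exact: (@ord_y K).
by apply: ordwZ; apply: ordwW (ordwM (@ord_x K) (@ord_y K)).
Qed.

Lemma rho_base1 : rho X0.1 = 0. Proof. exact: rho_y. Qed.
Lemma rho_base2 : rho X0.2 = 0.
Proof. by rewrite (lin_rho _).2 mulrC rho_ymul scaler0. Qed.
Lemma base01 : X0.1 0%N 1%N = 1. Proof. by []. Qed.
Lemma base_multiplier : rho (divy X0.2) = 2 *: x.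
Proof. by rewrite (lin_divy _).2 mulrC divy_ymul (lin_rho _).2 rho_x. Qed.

Lemma leaf_u : V u = 0.
Proof.
rewrite (linB (lin_vf _)) vfXn vfx vfy /= expr1 mulr1.
by rewrite scaler_nat subrr.
Qed.

Lemma leaf_ord n g : ord n g -> ord (n + 4 - 6) (V g).
Proof.
move=> gn; rewrite vfE; apply: ordwD; rewrite /=.
  by rewrite mul1r; apply: ordwW (ordw_fdx gn); lia.
by rewrite -scalerAl; apply: ordwZ; apply: ordwW (ordwM (@ord_x K) (ordw_fdy gn)); lia.
Qed.

Lemma fdy_ord63 n g : ord n g -> ord (n + 3 - 6) (fdy g).
Proof. by move=> gn; apply: ordwW (ordw_fdy gn); lia. Qed.

Lemma y2_ord : ord 6 (y ^+ 2). Proof. exact: (ordwX 2 (@ord_y K)). Qed.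

(* [Ed] displaces along the leaves of [u] by [d y^2]; [Ec] moves across them. *)
Definition Ed l := divpow V (y ^+ 2) l.
Definition Ec l := divpow (@fdy K) (- y ^+ 2) l.

Lemma Ed_hs : hasse_schmidt Ed.
Proof.
by apply: (@divpow_hs _ _ _ 6 4); [exact: lin_vf | exact: vfM | exact: y2_ord | exact: leaf_ord | ].
Qed.

Lemma Ec_hs : hasse_schmidt Ec.
Proof.
apply: (@divpow_hs _ _ _ 6 3); [exact: lin_fdy | exact: fdyM | | exact: fdy_ord63 | by []].
by apply: ordwN; exact: y2_ord.
Qed.

Lemma Ed_ord4 l f m : ord m f -> ord (m + 4 * l) (Ed l f).
Proof. exact: (divpow_ord y2_ord leaf_ord). Qed.
Lemma Ed_ord l f m : ord m f -> ord (m + 3 * l) (Ed l f).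
Proof. by move=> fm; apply: ordwW (Ed_ord4 (l := l) fm); lia. Qed.
Lemma Ec_ord l f m : ord m f -> ord (m + 3 * l) (Ec l f).
Proof. exact: (divpow_ord (ordwN y2_ord) fdy_ord63). Qed.

(** Both perturbations are the identity modulo y^2, so they change neither the fixed axis nor the
    multiplier along it. *)
Lemma Ed_y2 l f : exists h, Ed l.+1 f = y * (y * h).
Proof.
exists (l.+1`!%:R^-1 *: ((y ^+ 2) ^+ l * iter l.+1 V f)).
rewrite /Ed /divpow [(y ^+ 2) ^+ l.+1]exprS -mulrA scaleAr.
by set a := _ *: _; rewrite expr2; ring.
Qed.
Lemma Ec_y2 l f : exists h, Ec l.+1 f = y * (y * h).
Proof.
exists (- (l.+1`!%:R^-1 *: ((- y ^+ 2) ^+ l * iter l.+1 (@fdy K) f))).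
rewrite /Ec /divpow [(- y ^+ 2) ^+ l.+1]exprS -mulrA scaleAr.
by set a := _ *: _; rewrite expr2; ring.
Qed.

Lemma hs_rho (E : nat -> fps K -> fps K) c g : hasse_schmidt E ->
  (forall l f, exists h, E l.+1 f = y * (y * h)) ->
  rho (hs_sum E c g) = rho g /\ rho (divy (hs_sum E c g)) = rho (divy g).
Proof.
move=> [_ E0 _ _ _] Ey.
have z l i j : (j < 2)%N -> E l.+1 g i j = 0.
  by have [h ->] := Ey l g; rewrite mul_fy; case: j => [|[|j]] // _; rewrite mul_fy.
have e i j : (j < 2)%N -> hs_sum E c g i j = g i j.
  move=> j2; rewrite /hs_sum big_ord_recl E0 expr0 mul1r big1 ?addr0 // => l _.
  by rewrite z ?mulr0.
by split; apply: fpsP => i [|j] //; rewrite /rho /divy e.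
Qed.

Lemma E_rho0 (E : nat -> fps K -> fps K) :
  (forall l f, exists h, E l.+1 f = y * (y * h)) -> forall l f, rho (E l.+1 f) = 0.
Proof. by move=> Ey l f; have [h ->] := Ey l f; exact: rho_ymul. Qed.

(** Pull-back operators. Pull-back reverses composition: the innermost operator, exp X_0, belongs to
    the map applied last. *)
Definition phi_d d g := hs_sum Ed d (expvf X0 g).
Definition phi_cd c d g := hs_sum Ec c (phi_d d g).
Definition map_d d : fps K * fps K := (phi_d d x, phi_d d y).
Definition map_cd c d : fps K * fps K := (phi_cd c d x, phi_cd c d y).

Lemma nc_hs E c : hasse_schmidt E ->
  nc (hs_sum E c x, hs_sum E c y).
Proof.
by move=> h; split; [have := hs_sum_ord c h (@ord_x K)|have := hs_sum_ord c h (@ord_y K)];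
  apply.
Qed.

Lemma phi_dE d g : phi_d d g = fcomp g (map_d d).
Proof.
rewrite /phi_d expvf_comp ?(hs_sum_comp _ Ed_hs (fcomp _ _)); last exact: base_raises.
rewrite fcompA; last exact: nc_hs Ed_hs.
  by rewrite /fmap_comp /= -!(hs_sum_comp _ Ed_hs).
by apply: (nc_hs 1); apply: exp_hs; exact: base_raises.
Qed.

Lemma nc_map_d d : nc (map_d d).
Proof.
have [a b] := nc_hs d Ed_hs.
split; rewrite /= /phi_d; apply: (hs_sum_ord d Ed_hs (n := 1)) => //.
  by apply: expvf_ord base_raises _; apply: ordwW (@ord_x K).
by apply: expvf_ord base_raises _; apply: ordwW (@ord_y K).
Qed.

Lemma phi_cdE c d g : phi_cd c d g = fcomp g (map_cd c d).
Proof.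
rewrite /phi_cd phi_dE (hs_sum_comp c Ec_hs (fcomp _ _)) fcompA.
- by rewrite /fmap_comp /= -!(hs_sum_comp _ Ec_hs).
- exact: nc_map_d.
- exact: nc_hs Ec_hs.
Qed.

(** The properties of X_0 shared by the generators of all the maps of the family: a curve of zeros
    along y = 0, transversality to x = 0 after division by y, and the transverse eigenvalue 2 x. *)
Definition tame X := [/\ raises X 1, rho X.1 = 0, rho X.2 = 0,
  X.1 0%N 1%N = 1 & rho (divy X.2) = 2 *: x].

Lemma tame_log phi : cong 1 phi (fid K) -> rho phi.1 = x -> rho phi.2 = 0 ->
  phi.1 0%N 1%N = 1 -> rho (divy phi.2) = rho (divy (expvf X0 y)) ->
  forall X, raises X 1 -> phi = (expvf X x, expvf X y) -> tame X.
Proof.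
move=> [c1 c2] r1 r2 p1 m X X1 e; rewrite e /= in c1 c2 r1 r2 p1 m.
have [X10 X20] := log_vanishes X1 r1 r2; split=> //.
  have h : ord 4 (expvf X x - x - vf_apply X x).
    by apply: expvf_tail => //; rewrite vfx; case: X1.
  have := h 0%N 1%N isT; rewrite vfx !fpsB p1 /fx /= subr0.
  by move/eqP; rewrite subr_eq0 => /eqP.
rewrite -base_multiplier; apply: multiplier_inj => //.
- exact: base_raises.
- exact: rho_base1.
- exact: rho_base2.
Qed.

Lemma base_map : [/\ ord 3 (expvf X0 x - x), ord 4 (expvf X0 y - y),
  expvf X0 x 0%N 1%N = 1, rho (expvf X0 x) = x & rho (expvf X0 y) = 0].
Proof.
have h1 := expvf_sub_ord base_raises (@ord_x K).
have h2 := expvf_sub_ord base_raises (@ord_y K).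
split=> //.
- have h : ord 4 (expvf X0 x - x - vf_apply X0 x).
    by apply: expvf_tail base_raises _; rewrite vfx; exact: (@ord_y K).
  have := h 0%N 1%N isT; rewrite vfx !fpsB /fx /= subr0 /fy /=.
  by move/eqP; rewrite subr_eq0 => /eqP.
- by rewrite (rho_expvf base_raises rho_base1 rho_base2) rho_x.
- by rewrite (rho_expvf base_raises rho_base1 rho_base2) rho_y.
Qed.

Lemma map_d_props d : [/\ cong 1 (map_d d) (fid K), rho (map_d d).1 = x,
  rho (map_d d).2 = 0, (map_d d).1 0%N 1%N = 1 &
  rho (divy (map_d d).2) = rho (divy (expvf X0 y))].
Proof.
have [b1 b2 b3 b4 b5] := base_map.
have ox := expvf_ord base_raises (@ord_x K); have oy := expvf_ord base_raises (@ord_y K).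
have d1 := hs_sum_sub_ord d Ed_hs Ed_ord4 ox.
have d2 := hs_sum_sub_ord d Ed_hs Ed_ord4 oy.
have [r1 _] := hs_rho d (expvf X0 x) Ed_hs Ed_y2.
have [r2 m2] := hs_rho d (expvf X0 y) Ed_hs Ed_y2.
split; rewrite /= /phi_d ?r1 ?r2 //.
- by split=> /=; apply: ordw_trans; [apply: ordwW d1| |apply: ordwW d2|].
- by have /eqP := d1 0%N 1%N isT; rewrite fpsB b3 subr_eq0 => /eqP.
Qed.

Lemma map_cd_props c d : [/\ cong 1 (map_cd c d) (fid K), rho (map_cd c d).1 = x,
  rho (map_cd c d).2 = 0, (map_cd c d).1 0%N 1%N = 1 &
  rho (divy (map_cd c d).2) = rho (divy (expvf X0 y))].
Proof.
have [[b1 b2] b3 b4 b5 b6] := map_d_props d.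
have ox : ord 2 (phi_d d x).
  by apply: hs_sum_ord Ed_hs _ _ _; apply: expvf_ord base_raises _; exact: (@ord_x K).
have oy : ord 3 (phi_d d y).
  by apply: hs_sum_ord Ed_hs _ _ _; apply: expvf_ord base_raises _; exact: (@ord_y K).
have d1 := hs_sum_sub_ord c Ec_hs Ec_ord ox.
have d2 := hs_sum_sub_ord c Ec_hs Ec_ord oy.
have [r1 _] := hs_rho c (phi_d d x) Ec_hs Ec_y2.
have [r2 m2] := hs_rho c (phi_d d y) Ec_hs Ec_y2.
split; rewrite /= /phi_cd ?r1 ?r2 ?m2 //.
- by split=> /=; apply: ordw_trans; [apply: ordwW d1|exact: b1|apply: ordwW d2|exact: b2].
- by have /eqP := d1 0%N 1%N isT; rewrite fpsB [phi_d d x _ _]b5 subr_eq0 => /eqP.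
Qed.

Lemma expvf_u : expvf X0 u = u.
Proof.
apply: hs_sum_fix (exp_hs base_raises) _ => l.
have e : vf_apply X0 u = 0 by rewrite base_fieldE leaf_u mulr0.
have zz k : iter k (vf_apply X0) 0 = 0.
  by elim: k => // k IH; rewrite iterS IH (lin0 (lin_vf _)).
by rewrite divpow_vfE iterSr e zz scaler0.
Qed.

Lemma phi_d_u d : phi_d d u = u.
Proof.
rewrite /phi_d expvf_u; apply: hs_sum_fix Ed_hs _ => l.
have zz k : iter k V 0 = 0 by elim: k => // k IH; rewrite iterS IH (lin0 (lin_vf _)).
by rewrite /Ed /divpow iterSr leaf_u zz mulr0 scaler0.
Qed.

Lemma u_ord : ord 3 u.
Proof.
by apply: ordwB; [apply: ordwW (ordwX 2 (@ord_x K))|exact: (@ord_y K)].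
Qed.

Lemma Ec1_u : Ec 1 u = y ^+ 2.
Proof.
rewrite /Ec /divpow (_ : 1`! = 1%N) // invr1 scale1r expr1 /=.
rewrite (linB (lin_fdy _)) fdy_vf vfXn vfx mulr0 mul0rn sub0r.
by rewrite [fdy y]fdy_mono scale1r mono00 mulrNN mulr1.
Qed.

(** Coefficients in d of the coefficient of c in the first integral. That coefficient solves a
    cohomological equation with right-hand side -y^2 for every d, hence the initial value at d =
    0. *)
Definition G_d : nat -> fps K := pert base_field Ed (cohom_sol base_field (- y ^+ 2)).

Lemma cohom_sol0 : [/\ expvf X0 (cohom_sol X0 (- y ^+ 2)) - cohom_sol X0 (- y ^+ 2) = - y ^+ 2,
  forall j, cohom_sol X0 (- y ^+ 2) 0%N j = 0 & ord 3 (cohom_sol X0 (- y ^+ 2))].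
Proof.
have r0 : rho (- y ^+ 2) = 0 by rewrite (linN (lin_rho _)) expr2 rho_ymul oppr0.
have [G hG] := cohomological base_raises rho_base1 rho_base2 base01 r0.
rewrite /cohom_sol; case: xgetP => [g -> [h1 h2 h3]|/(_ G)]; last by case.
split=> //; apply: ordwW (h3 6%N _) => //; apply: ordwN; exact: y2_ord.
Qed.

Lemma G_d_eqs : [/\ expvf X0 (G_d 0) - G_d 0 = - y ^+ 2,
  expvf X0 (G_d 1) - G_d 1 = - (y ^+ 2 * V (expvf X0 (G_d 0))),
  forall k j, G_d k 0%N j = 0 & forall k, ord (3 + 2 * k) (G_d k)].
Proof.
have [h1 h2 h3] := cohom_sol0.
have pS := pertS base_raises rho_base1 rho_base2 base01 Ed_ord (E_rho0 Ed_y2) h3.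
split.
- exact: h1.
- have [-> _ _] := pS 0%N; rewrite big_ord1 /= {1}/Ed /divpow /= expr1.
  by rewrite invr1 scale1r.
- by case=> [|k] j; [exact: h2 | have [_ + _] := pS k; apply].
- exact: (pert_ord base_raises rho_base1 rho_base2 base01 Ed_ord (E_rho0 Ed_y2) h3).
Qed.

(** Perturbation in c of the first integral u, with d fixed and X the generator of [map_d d]. For
    the last clause, both sides solve the same cohomological equation and vanish on x = 0; their
    difference is a first integral vanishing there. *)
Lemma first_integral_family d : exists G : nat -> fps K,
  [/\ G 0%N = u, forall k, ord (3 + 2 * k) (G k),
      forall c, fcomp (psum G c) (map_cd c d) = psum G c,
      forall c j, psum G c 0%N j = u 0%N j & G 1%N = psum G_d d].
Proof.
have [c1 r1 r2 p1 m] := map_d_props d.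
have [X X1 mE] := log_exists c1.
have [_ X10 X20 X01 _] := tame_log c1 r1 r2 p1 m X1 mE.
have LE g : expvf X g = phi_d d g by rewrite phi_dE mE expvf_comp.
pose G := pert X Ec u.
have pS := pertS X1 X10 X20 X01 Ec_ord (E_rho0 Ec_y2) u_ord.
have pO := pert_ord X1 X10 X20 X01 Ec_ord (E_rho0 Ec_y2) u_ord.
exists G; split.
- by [].
- exact: pO.
- move=> c; rewrite -phi_cdE /phi_cd -LE.
  have := pert_psum X1 X10 X20 X01 Ec_hs Ec_ord (E_rho0 Ec_y2) u_ord c.
  rewrite [expvf X u]LE phi_d_u subrr => /eqP.
  by rewrite subr_eq0 => /eqP.
- move=> c j; rewrite /psum big_ord_recl big1 ?addr0; first by rewrite expr0 mul1r.
  by move=> l _; have [_ h _] := pS l; rewrite [G _ _ _]h mulr0.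
have [h1 h2 h3 h4] := G_d_eqs.
apply/eqP; rewrite -subr_eq0; apply/eqP.
apply: (first_integral_eq0 X1 X10 X20 X01); last first.
  move=> j; have [_ h _] := pS 0%N; rewrite fpsB [G _ _ _]h sub0r /psum.
  by rewrite big1 ?oppr0 // => l _; rewrite h3 mulr0.
apply: expvf_fix => //; rewrite (linB (lin_expvf X1)).
have e1 : expvf X (G 1%N) - G 1%N = - y ^+ 2.
  have [-> _ _] := pS 0%N; rewrite big_ord1 /= [expvf X u]LE phi_d_u.
  by rewrite Ec1_u.
have [g1 g2 g3] := cohom_sol0.
have e2 : expvf X (psum G_d d) - psum G_d d = - y ^+ 2.
  rewrite LE /phi_d.
  have := pert_psum base_raises rho_base1 rho_base2 base01 Ed_hs Ed_ord (E_rho0 Ed_y2) g3 d.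
  by rewrite g1.
have -> : expvf X (G 1%N) = G 1%N - y ^+ 2 by rewrite -e1; ring.
have -> : expvf X (psum G_d d) = psum G_d d - y ^+ 2 by rewrite -e2; ring.
by ring.
Qed.

End Perturbation.

(** * Hyperbolic series *)

Section Units.
Variable K : fieldType.
Implicit Types f g u : fps K.

Lemma fps_inv u : u 0%N 0%N = 1 -> exists v, u * v = 1.
Proof.
move=> u0; pose w := u - 1.
have w2 : ord 2 w.
  move=> i j ij; rewrite /w fpsB fps1E; case: i ij => [|i] ij; last by lia.
  by case: j ij => [|j] ij; [rewrite u0 subrr | lia].
pose T (s : fps K * fps K) : fps K * fps K := (1 - w * s.1, 0).
have [|n s t _ _ _ [st _]|s [_ sT _]] := @contraction_fixpoint K 0 (1, 0) T.
- move=> s _; split; rewrite /= ?subrr; last exact: ordw_0.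
  rewrite addrAC subrr sub0r; apply: ordwN.
  exact: (ordwM w2 (ordw0n _)).
- split; rewrite /= ?subrr; last exact: ordw_0.
  have -> : 1 - w * s.1 - (1 - w * t.1) = w * (t.1 - s.1) by ring.
  by apply: ordwW (ordwM w2 (ordwBC st)); lia.
have e : s.1 = 1 - w * s.1 by rewrite -{1}sT.
exists s.1; have -> : u * s.1 = s.1 + w * s.1 by rewrite /w; ring.
by rewrite {1}e subrK.
Qed.

Lemma fps_cancel u f : u 0%N 0%N != 0 -> u * f = 0 -> f = 0.
Proof.
move=> u0 uf; have [|v uv] := @fps_inv ((u 0%N 0%N)^-1 *: u).
  by rewrite fpsZ mulVf.
rewrite -[f]mul1r -uv mulrAC -scalerAl uf.
by rewrite -scalerAl mul0r scaler0.
Qed.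

Lemma xmul_inj f g : fx K * f = fx K * g -> f = g.
Proof.
move=> e; apply: fpsP => i j; have := congr1 (fun h : fps K => h i.+1 j) e.
by rewrite !mul_fx.
Qed.

End Units.

Section Numbers.
Variable K : numFieldType.
Implicit Types (f g h : fps K) (p q : {poly K}).
Notation x := (fx K).
Notation y := (fy K).

Definition ex (c : K) : fps K := fun i j => if j is 0%N then c ^+ i / i`!%:R else 0.

Lemma exM a b : ex a * ex b = ex (a + b).
Proof.
have z i k : ('I_k.+1 : Type) = 'I_k.+1 -> True by [].
apply: fpsP => i [|j]; last first.
  rewrite fpsM big1 // => k _; rewrite big1 // => -[[|l] lj] _ /=.
    by rewrite mulr0.
  by rewrite mul0r.
rewrite fpsM; under eq_bigr => k _ do rewrite big_ord1.
rewrite /= exprDn mulr_suml; rewrite (reindex_inj rev_ord_inj) /=.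
apply: eq_bigr => k _; have ki : (k <= i)%N by rewrite -ltnS.
rewrite !subSS subKn //.
have h n : (n`!%:R : K) != 0 by rewrite pnatr_eq0 -lt0n fact_gt0.
have hb : ('C(i, k)%:R : K) != 0 by rewrite pnatr_eq0 -lt0n bin_gt0.
rewrite -mulr_natr -(bin_fact ki) !natrM.
by field; rewrite hb !h.
Qed.

Lemma ex0 : ex 0 = 1.
Proof.
apply: fpsP => -[|i] [|j]; rewrite ?fps1E //=; first by rewrite expr0 fact0 divr1.
by rewrite expr0n mul0r.
Qed.

Lemma fdx_ex c : fdx (ex c) = c *: ex c.
Proof.
apply: fpsP => i [|j]; rewrite fpsZ /fdx /= ?mulr0 // exprS factS natrM.
have h n : (n`!%:R : K) != 0 by rewrite pnatr_eq0 -lt0n fact_gt0.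
by field; rewrite h nat1r pnatr_eq0.
Qed.

Definition sinhx : fps K := 2^-1 *: (ex 1 - ex (-1)).
Definition coshx : fps K := 2^-1 *: (ex 1 + ex (-1)).

Let two0 : (2 : K) != 0. Proof. by rewrite (pnatr_eq0 K 2). Qed.

Lemma cosh_sq : coshx ^+ 2 = 1 + sinhx ^+ 2.
Proof.
have e : ex 1 * ex (-1) = 1 by rewrite exM subrr ex0.
apply/eqP; rewrite -subr_eq; apply/eqP; rewrite -e /coshx /sinhx !exprZn -scalerBr.
have -> : (ex 1 + ex (-1)) ^+ 2 - (ex 1 - ex (-1)) ^+ 2 = (ex 1 * ex (-1)) *+ 4.
  by ring.
have c4 : 2^-1 ^+ 2 * 4%:R = 1 :> K by field.
by rewrite -scaler_nat scalerA c4 scale1r.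
Qed.

Lemma fdx_sinh : fdx sinhx = coshx.
Proof. by rewrite fdxZ (linB (lin_fdx _)) !fdx_ex scale1r scaleN1r opprK. Qed.
Lemma fdx_cosh : fdx coshx = sinhx.
Proof. by rewrite fdxZ fdxD !fdx_ex scale1r scaleN1r. Qed.

(** The quotient sinh x / x, a unit by which one may divide. *)
Definition sinhc : fps K := fun i j => sinhx i.+1 j.

Lemma sinhcE : x * sinhc = sinhx.
Proof.
apply: fpsP => -[|i] j; rewrite mul_fx // /sinhx fpsZ fpsB /ex.
by case: j => [|j]; rewrite ?expr0 subrr mulr0.
Qed.

Lemma sinhc0 : sinhc 0%N 0%N = 1.
Proof.
by rewrite /sinhc /sinhx fpsZ fpsB /ex !expr1 !divr1 opprK mulVf.
Qed.

(* [A = x coth x] *)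
Lemma xcoth_exists : exists A : fps K, [/\ A * sinhx = x * coshx,
  x * fdx A = A - A ^+ 2 + x ^+ 2 & A 0%N 0%N = 1].
Proof.
have [v sv] := fps_inv sinhc0; exists (v * coshx).
have AS : v * coshx * sinhc = coshx by rewrite mulrAC [v * _]mulrC sv mul1r.
set A := v * coshx in AS *; have A0 : A 0%N 0%N = 1.
  have := congr1 (fun f : fps K => f 0%N 0%N) AS; rewrite fps_mul0 sinhc0 mulr1 => ->.
  rewrite /coshx fpsZ fpsD /ex !expr0 !divr1.
  by field.
split=> //; first by rewrite -sinhcE mulrCA AS.
have xS : x * fdx sinhc = coshx - sinhc.
  have := fdx_sinh; rewrite -sinhcE fdxM [fdx x]fdx_mono scale1r mono00 mul1r => <-.
  by rewrite addrC addKr.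
have AS' : fdx A * sinhc + A * fdx sinhc = x * sinhc.
  by rewrite -fdxM AS fdx_cosh sinhcE.
apply/eqP; rewrite -subr_eq0; apply/eqP; apply: (fps_cancel (u := sinhc)).
  by rewrite sinhc0 oner_neq0.
have -> : sinhc * (x * fdx A - (A - A ^+ 2 + x ^+ 2)) =
  x * (fdx A * sinhc + A * fdx sinhc) - A * (x * fdx sinhc) - A * sinhc
  + A * (A * sinhc) - x ^+ 2 * sinhc by ring.
rewrite AS' xS AS; ring: AS.
Qed.

Lemma sum_even_odd (V : nmodType) n (F : nat -> V) :
  \sum_(k < (2 * n).+1) F k = \sum_(i < n.+1) F (2 * i)%N + \sum_(i < n) F (2 * i).+1.
Proof.
elim: n => [|n IH]; first by rewrite muln0 !big_ord1 big_ord0 addr0 muln0.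
have e : (2 * n.+1)%N = (2 * n).+2 by lia.
rewrite [in LHS]e 2!big_ord_recr /= IH [X in _ = X + _]big_ord_recr.
by rewrite [X in _ = _ + X]big_ord_recr /= e addrACA -addrA [F _ + F _]addrC.
Qed.

Section Xcoth.
Variable A : fps K.
Hypotheses (A_sinh : A * sinhx = x * coshx)
  (A_ode : x * fdx A = A - A ^+ 2 + x ^+ 2) (A0 : A 0%N 0%N = 1).
Let a n := A n 0%N.

Let x2E n : (x ^+ 2) n 0%N = (n == 2%N)%:R.
Proof. by rewrite expr2 mul_fx; case: n => [|[|[|n]]]. Qed.

(** The Riccati equation x A' = A - A^2 + x^2 read on coefficients. *)
Let a_rec n : n%:R * a n = a n - \sum_(k < n.+1) a k * a (n - k)%N + (n == 2%N)%:R.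
Proof.
have := congr1 (fun f : fps K => f n 0%N) A_ode; rewrite fpsD fpsB x2E.
rewrite [(A ^+ 2) n _]fpsM; under eq_bigr => k _ do rewrite big_ord1.
by move=> <-; rewrite mul_fx; case: n => [|n]; rewrite ?mul0r.
Qed.

Let a_odd n : a (2 * n).+1 = 0.
Proof.
have [m] := ubnP n; elim: m n => // m IH n nm.
have := a_rec (2 * n).+1; rewrite big_ord_recl big_ord_recr /= subn0 subnn.
rewrite big1 => [|k _]; last first.
  rewrite /bump /= add1n subSS; have [ko|ke] := boolP (odd k).
    have -> : (2 * n - k)%N = (2 * ((2 * n - k).-1)./2).+1.
      by have := ltn_ord k; lia.
    by rewrite IH ?mulr0 //; have := ltn_ord k; lia.
  have -> : k.+1 = (2 * k./2).+1 by lia.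
  by rewrite IH ?mul0r //; have := ltn_ord k; lia.
rewrite (_ : ((2 * n).+1 == 2%N) = false) ?addr0 ?add0r; last by lia.
have a0 : a 0 = 1 by exact: A0.
rewrite a0 mul1r mulr1; set v := a _ => e.
have /eqP : (2 * n).+2%:R * v = 0 by rewrite -natr1 mulrDl mul1r e; ring.
by rewrite mulf_eq0 pnatr_eq0 /= => /eqP.
Qed.

Let a_even n : (2 * n).+3%:R * a (2 * n).+2 =
  - \sum_(i < n) a (2 * i).+2 * a (2 * (n - i.+1)).+2 + (n == 0%N)%:R.
Proof.
have e : (2 * n).+2 = (2 * n.+1)%N by lia.
have a0 : a 0 = 1 by exact: A0.
have := a_rec (2 * n.+1).
rewrite (sum_even_odd _ (fun k => a k * a (2 * n.+1 - k)%N)) [X in _ - (_ + X)]big1 ?addr0; last first.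
  by move=> i _; rewrite a_odd mul0r.
rewrite big_ord_recl big_ord_recr /= muln0 subn0.
rewrite (_ : 2 * n.+1 - 2 * bump 0 n = 0)%N; last by rewrite /bump; lia.
rewrite (_ : (2 * bump 0 n)%N = (2 * n).+2); last by rewrite /bump; lia.
rewrite -?e a0 mul1r mulr1 eqSS eqSS (_ : (2 * n == 0)%N = (n == 0%N)); last by lia.
rewrite (eq_bigr (fun i : 'I_n => a (2 * i).+2 * a (2 * (n - i.+1)).+2)); last first.
  move=> i _; rewrite /bump; congr (a _ * a _); have := ltn_ord i; lia.
set v := a _; set s := \sum_(i < n) _ => h.
by rewrite -natr1 mulrDl mul1r h; ring.
Qed.

(** The signs alternate, so after multiplication by (-1)^m every product in the quadratic recurrence
    is positive and nothing cancels. The value 1/3 = 5/15 starts the induction, and 25 (m + 1) >= 5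
    (2 m + 5) closes it. *)
Lemma xcoth_bound m : 5 / 15 ^+ m.+1 <= (-1) ^+ m * A (2 * m).+2 0%N.
Proof.
have [k] := ubnP m; elim: k m => // k IH [|m] mk.
  have := a_even 0; rewrite big_ord0 oppr0 add0r /= muln0 => e.
  have -> : A 2%N 0%N = 3^-1 by apply: (mulfI (x := 3)); rewrite ?pnatr_eq0 // e divff ?pnatr_eq0.
  rewrite expr0 mul1r expr1.
  have -> : 5 / 15 = 3^-1 :> K by field.
  exact: lexx.
have pos : (0 : K) < (2 * m.+1).+3%:R by rewrite ltr0n.
rewrite -[A _ 0%N]/(a (2 * m.+1).+2) -(ler_pM2l pos) [X in _ <= X]mulrCA a_even /= addr0 mulrN [(-1) ^+ m.+1]exprS mulN1r mulNr opprK.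
have -> : (-1) ^+ m * \sum_(i < m.+1) a (2 * i).+2 * a (2 * (m.+1 - i.+1)).+2 =
   \sum_(i < m.+1) ((-1) ^+ i * a (2 * i).+2) * ((-1) ^+ (m - i) * a (2 * (m - i)).+2).
  rewrite mulr_sumr; apply: eq_bigr => i _; rewrite subSS mulrACA -exprD subnKC //.
  by rewrite -ltnS.
have -> : (2 * m.+1).+3%:R * (5 / 15 ^+ m.+2) = ((2 * m.+1).+3 * 5)%N%:R / 15 ^+ m.+2 :> K.
  by rewrite natrM mulrA.
apply: (@le_trans _ _ (\sum_(i < m.+1) 25 / 15 ^+ m.+2)).
  rewrite sumr_const card_ord -mulrnAl ler_pM2r ?invr_gt0 ?exprn_gt0 ?ltr0n //.
  by rewrite -[leRHS]mulr_natr -natrM ler_nat; lia.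
apply: ler_sum => i _; have im : (i <= m)%N by rewrite -ltnS.
have -> : 25 / 15 ^+ m.+2 = (5 / 15 ^+ i.+1) * (5 / 15 ^+ (m - i).+1) :> K.
  rewrite mulf_div -exprD -natrM; congr (_ / _ ^+ _); lia.
apply: ler_pM.
- by rewrite divr_ge0 ?exprn_ge0 ?ler0n.
- by rewrite divr_ge0 ?exprn_ge0 ?ler0n.
- by apply: IH; lia.
- by apply: IH; lia.
Qed.

(** The coefficients of z / (exp z - 1), which is A - x at z = 2 x. At even indices they agree with
    those of z / (1 - exp(-z)). *)
Definition bern k : K := (A k 0%N - (k == 1%N)%:R) / 2 ^+ k.

Lemma bern_conv n : \sum_(k < n.+1) bern k / (n.+1 - k)`!%:R = (n == 0%N)%:R.
Proof.
have e : (A - x) * (ex 2 - 1) = 2 *: x.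
  have h : A * (ex 1 - ex (-1)) = x * (ex 1 + ex (-1)).
    have := A_sinh; rewrite /sinhx /coshx -!scaleAr => h.
    by apply: (scalerI (a := 2^-1)); rewrite ?invr_eq0.
  have e1 : ex 1 * ex (-1) = 1 by rewrite exM subrr ex0.
  have -> : ex 2 = ex 1 * ex 1 by rewrite exM.
  have -> : (A - x) * (ex 1 * ex 1 - 1) =
     A * (ex 1 - ex (-1)) * ex 1 + A * (ex 1 * ex (-1) - 1) - x * (ex 1 * ex 1 - 1) by ring.
  rewrite h e1 subrr mulr0 addr0 scaler_nat.
  have -> : x * (ex 1 + ex (-1)) * ex 1 - x * (ex 1 * ex 1 - 1) = x * (ex 1 * ex (-1)) + x by ring.
  by rewrite e1; ring.
have := congr1 (fun f : fps K => f n.+1 0%N) e; rewrite fpsZ {2}/fx /= eqSS andbT.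
have z : (ex 2 - 1) 0%N 0%N = 0 by rewrite fpsB fps1E /ex expr0 fact0 divr1 subrr.
rewrite fpsM big_ord_recr /= [X in _ + X = _ -> _]big_ord1 /= subnn z mulr0 addr0.
move=> h; apply: (mulIf (x := 2 ^+ n.+1)); first by rewrite expf_neq0.
transitivity (2 * (n == 0%N)%:R : K); last first.
  by case: n {h} => [|n] /=; rewrite ?mulr0 ?mul0r // mulrC.
rewrite -h mulr_suml; apply: eq_bigr => k _; rewrite big_ord1.
have kn : (k <= n)%N by rewrite -ltnS.
rewrite subn0 !fpsB fps1E subSn //= subr0 /bern {1}/fx andbT.
have e2 : 2 ^+ n.+1 = 2 ^+ k * 2 ^+ (n - k).+1 :> K.
  by rewrite -exprD; congr (_ ^+ _); lia.
rewrite e2.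
have hf : ((n - k).+1`!%:R : K) != 0 by rewrite pnatr_eq0 -lt0n fact_gt0.
by field; rewrite hf expf_neq0.
Qed.

End Xcoth.

End Numbers.

(** * Moments on a leaf *)

Section LeafIntegral.
Variable K : numFieldType.
Implicit Types (f g h : fps K) (p q : {poly K}).
Notation x := (fx K).
Notation y := (fy K).
Notation sinhx := (sinhx K).
Notation coshx := (coshx K).

Definition prim p : {poly K} :=
  \poly_(i < (size p).+1) (if i is i'.+1 then p`_i' / i'.+1%:R else 0).

Lemma coef_prim p i : (prim p)`_i = if i is i'.+1 then p`_i' / i'.+1%:R else 0.
Proof.
rewrite coef_poly; case: ltnP => //; case: i => // i ip.
by rewrite nth_default ?mul0r.
Qed.

Definition int11 p := (prim p).[1] - (prim p).[-1].

Lemma int11D p q : int11 (p + q) = int11 p + int11 q.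
Proof.
have e : prim (p + q) = prim p + prim q.
  by apply/polyP => -[|i]; rewrite coefD !coef_prim ?addr0 // coefD mulrDl.
by rewrite /int11 e !hornerD opprD addrACA.
Qed.

Lemma int11Z c p : int11 (c *: p) = c * int11 p.
Proof.
have e : prim (c *: p) = c *: prim p.
  by apply/polyP => -[|i]; rewrite coefZ !coef_prim ?mulr0 // coefZ mulrA.
by rewrite /int11 e !hornerZ mulrBr.
Qed.

Lemma int11_0 : int11 0 = 0.
Proof. by rewrite -(scale0r 0) int11Z mul0r. Qed.
Lemma int11_sum I (r : seq I) (P : pred I) (F : I -> {poly K}) :
  int11 (\sum_(i <- r | P i) F i) = \sum_(i <- r | P i) int11 (F i).
Proof. by elim/big_rec2: _ => [|i a b _ <-]; rewrite ?int11_0 ?int11D. Qed.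

Lemma prim_deriv p : prim p^`() + (p`_0)%:P = p.
Proof.
apply/polyP => -[|i]; rewrite coefD coef_prim coefC ?add0r ?addr0 //=.
by rewrite coef_deriv -(mulr_natr p`_i.+1) mulfK // pnatr_eq0.
Qed.

Lemma int11_deriv p : int11 p^`() = p.[1] - p.[-1].
Proof.
rewrite -[in RHS](prim_deriv p) !hornerD !hornerC opprD addrACA subrr addr0.
by [].
Qed.

(** The field X_0 on the leaf u = 1: there y = x^2 - 1 and V is d/dx. *)
Definition leafD p : {poly K} := ('X^2 - 1) * p^`().
Notation Dp := leafD.

Lemma leafD_add p q : Dp (p + q) = Dp p + Dp q.
Proof. by rewrite /Dp derivD mulrDr. Qed.
Lemma leafDZ c p : Dp (c *: p) = c *: Dp p.
Proof. by rewrite /Dp derivZ scalerAr. Qed.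
Lemma leafD0 : Dp 0 = 0.
Proof. by rewrite /Dp raddf0 mulr0. Qed.
Lemma iter_leafD_add l p q : iter l Dp (p + q) = iter l Dp p + iter l Dp q.
Proof. by elim: l => // l IH; rewrite !iterS IH leafD_add. Qed.
Lemma iter_leafDZ l c p : iter l Dp (c *: p) = c *: iter l Dp p.
Proof. by elim: l => // l IH; rewrite !iterS IH leafDZ. Qed.
Lemma iter_leafD0 l : iter l Dp 0 = 0.
Proof. by elim: l => // l IH; rewrite iterS IH leafD0. Qed.

Lemma leafD_end p : (Dp p).[1] = 0 /\ (Dp p).[-1] = 0.
Proof.
by split; rewrite /Dp hornerM !hornerE /= ?expr1n ?sqrrN ?expr1n subrr mul0r.
Qed.

Definition tanhp i := iter i Dp 'X.

Lemma tanhp_end i : (tanhp i).[1] - (tanhp i).[-1] = (i == 0%N)%:R * 2.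
Proof.
case: i => [|i]; first by rewrite !hornerX opprK mul1r.
by have [-> ->] := leafD_end (tanhp i); rewrite subrr mul0r.
Qed.

(** From here to the end of the section x is the time of a flow and y a point of the leaf u = 1. A
    series is seen as a power series in time with polynomial coefficients, which [jser] integrates
    over the arc from -1 to 1. *)
Definition row f (q : nat -> {poly K}) := forall i j, f i j = (q i)`_j.
Definition jser (q : nat -> {poly K}) : fps K :=
  fun i j => if j is 0%N then int11 (q i) else 0.
Definition xonly f := forall i j, f i j.+1 = 0.
Definition xmul (c : fps K) (q : nat -> {poly K}) n : {poly K} :=
  \sum_(k < n.+1) c k 0%N *: q (n - k)%N.

Lemma mul_xonly c f n j : xonly c -> (c * f) n j = \sum_(k < n.+1) c k 0%N * f (n - k)%N j.
Proof.
move=> cx; rewrite fpsM; apply: eq_bigr => k _.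
by rewrite big_ord_recl subn0 big1 ?addr0 // => l _; rewrite cx mul0r.
Qed.

Lemma xonlyM c d : xonly c -> xonly d -> xonly (c * d).
Proof. by move=> cx dx i j; rewrite mul_xonly // big1 // => k _; rewrite dx mulr0. Qed.
Lemma xonlyD c d : xonly c -> xonly d -> xonly (c + d).
Proof. by move=> cx dx i j; rewrite fpsD cx dx addr0. Qed.

Lemma xonly_sinh : xonly sinhx.
Proof. by move=> i j; rewrite /sinhx fpsZ fpsB /ex subrr mulr0. Qed.
Lemma xonly_cosh : xonly coshx.
Proof. by move=> i j; rewrite /coshx fpsZ fpsD /ex addr0 mulr0. Qed.

Lemma row_xmul c f (q : nat -> {poly K}) : xonly c -> row f q -> row (c * f) (xmul c q).
Proof.
move=> cx fq i j; rewrite mul_xonly // coef_sum; apply: eq_bigr => k _.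
by rewrite coefZ fq.
Qed.
Lemma jser_xmul c (q : nat -> {poly K}) : xonly c -> jser (xmul c q) = c * jser q.
Proof.
move=> cx; apply: fpsP => i [|j]; rewrite mul_xonly //= ?int11_sum.
  by apply: eq_bigr => k _; rewrite int11Z.
by rewrite big1 // => k _; rewrite mulr0.
Qed.
Lemma jserD (q r : nat -> {poly K}) : jser (fun i => q i + r i) = jser q + jser r.
Proof. by apply: fpsP => i [|j]; rewrite fpsD /= ?int11D ?addr0. Qed.
Lemma row_unique f (q r : nat -> {poly K}) : row f q -> row f r -> forall i, q i = r i.
Proof. by move=> fq fr i; apply/polyP => j; rewrite -fq fr. Qed.

Definition tanhq i := (i`!%:R)^-1 *: tanhp i.
(** The flow of (y^2 - 1) d/dy at time x, that is (y cosh x - sinh x) / (cosh x - y sinh x). *)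
Definition tanhs : fps K := fun i j => (tanhq i)`_j.
Notation E := tanhs.

Lemma ode_unique (C Xi : fps K) : fdx Xi = C * Xi -> (forall j, Xi 0%N j = 0) -> Xi = 0.
Proof.
move=> ode Xi0; apply: fpsP => i; have [n] := ubnP i.
elim: n i => // n IH [|i] ni j; first exact: Xi0.
have := congr1 (fun f : fps K => f i j) ode; rewrite fpsM big1 => [|k _].
  by move/eqP; rewrite mulf_eq0 pnatr_eq0 /= => /eqP.
by rewrite big1 // => l _; rewrite [X in _ * X]IH ?mulr0 //; lia.
Qed.

Lemma ysqE f i j : ((y ^+ 2 - 1) * f) i j =
  (if j is j'.+2 then f i j' else 0) - f i j.
Proof.
rewrite mulrBl mul1r fpsB expr2 -mulrA mul_fy; case: j => [|[|j]] //=; rewrite mul_fy //.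
Qed.

Lemma pde_unique (Phi : fps K) : fdx Phi = (y ^+ 2 - 1) * fdy Phi ->
  (forall j, Phi 0%N j = 0) -> Phi = 0.
Proof.
move=> pde Phi0; apply: fpsP => i; elim: i => [|i IH] j; first exact: Phi0.
have := congr1 (fun f : fps K => f i j) pde; rewrite ysqE /fdy.
rewrite IH mulr0 subr0 (_ : (if _ is _.+2 then _ else _) = 0); last first.
  by case: j => [|[|j]] //; rewrite IH mulr0.
by move/eqP; rewrite mulf_eq0 pnatr_eq0 /= => /eqP.
Qed.

Lemma tanhq_deriv i : i.+1%:R *: tanhq i.+1 = Dp (tanhq i).
Proof.
rewrite /tanhq leafDZ scalerA; congr (_ *: _); rewrite factS natrM.
have h n : (n`!%:R : K) != 0 by rewrite pnatr_eq0 -lt0n fact_gt0.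
by field; rewrite h nat1r pnatr_eq0.
Qed.

Lemma tanhs_pde : fdx E = (y ^+ 2 - 1) * fdy E.
Proof.
apply: fpsP => i j; rewrite ysqE /fdx /tanhs -coefZ tanhq_deriv /Dp.
rewrite mulrBl mul1r coefB coefXnM !coef_deriv /fdy; congr (_ - _).
  by case: j => [|[|j]] //=; rewrite subn2 /= mulr_natl.
by rewrite mulr_natl.
Qed.

Lemma tanhs0 j : E 0%N j = (j == 1%N)%:R.
Proof. by rewrite /tanhs /tanhq fact0 invr1 scale1r coefX. Qed.

Lemma tanhs_split : exists F, E = y + x * F.
Proof.
exists (fun i j => E i.+1 j); apply: fpsP => -[|i] j; rewrite fpsD mul_fx.
  by rewrite addr0 tanhs0.
by rewrite /fy /= add0r.
Qed.

Lemma fdxy : fdx y = 0. Proof. by rewrite [fdx y]fdx_mono scale0r. Qed.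
Lemma fdyy : fdy y = 1. Proof. by rewrite [fdy y]fdy_mono scale1r. Qed.
Lemma fdyx : fdy x = 0. Proof. by rewrite [fdy x]fdy_mono scale0r. Qed.
Lemma fdxx : fdx x = 1. Proof. by rewrite [fdx x]fdx_mono scale1r. Qed.
Lemma fdx1 : fdx 1 = 0 :> fps K. Proof. by rewrite fdx_vf vf1. Qed.
Lemma fdy1 : fdy 1 = 0 :> fps K. Proof. by rewrite fdy_vf vf1. Qed.
Lemma fdx_sq f : fdx (f ^+ 2) = 2 * f * fdx f.
Proof. by rewrite expr2 fdxM; ring. Qed.
Lemma fdy_sq f : fdy (f ^+ 2) = 2 * f * fdy f.
Proof. by rewrite expr2 fdyM; ring. Qed.

(** By construction the flow satisfies the transport equation in the initial point. The difference
    of the two sides satisfies the same transport equation and vanishes at time 0, whence the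
    equation in the moving point. *)
Lemma tanhs_riccati : fdx E = E ^+ 2 - 1.
Proof.
apply/eqP; rewrite -subr_eq0; apply/eqP; apply: pde_unique; last first.
  move=> j; have [F EF] := tanhs_split.
  have -> : fdx E - (E ^+ 2 - 1) =
      x * ((y ^+ 2 - 1) * fdy F - F * (2 * y + x * F)).
    rewrite tanhs_pde EF fdyD fdyM fdyy fdyx; ring.
  by rewrite mul_fx.
rewrite !(linB (lin_fdx _)) !(linB (lin_fdy _)) fdx1 fdy1 fdx_sq fdy_sq !subr0.
have c1 : fdy (fdx E) = fdx (fdy E).
  by apply: fpsP => i j; rewrite /fdy /fdx mulrCA.
have c2 : fdx (fdx E) = (y ^+ 2 - 1) * fdy (fdx E).
  rewrite {1}tanhs_pde fdxM (linB (lin_fdx _)) fdx_sq fdx1 fdxy c1; ring.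
rewrite mulrBr -c2; congr (_ - _).
by rewrite {1}tanhs_pde; ring.
Qed.

(* [sinh E + cosh] and the square root of [dE/ds] solve the same linear equation. *)
Lemma tanhs_deriv : fdy E = (sinhx * E + coshx) ^+ 2.
Proof.
apply/esym/eqP; rewrite -subr_eq0; apply/eqP; apply: (ode_unique (C := 2 * E)).
  have c1 : fdx (fdy E) = fdy (fdx E).
    by apply: fpsP => i j; rewrite /fdy /fdx mulrCA.
  rewrite (linB (lin_fdx _)) c1 fdx_sq fdxD fdxM fdx_sinh fdx_cosh.
  by rewrite tanhs_riccati (linB (lin_fdy _)) fdy1 fdy_sq; ring.
move=> j; have [F EF] := tanhs_split; have ch := cosh_sq K.
have -> : (sinhx * E + coshx) ^+ 2 - fdy E =
    x * (x * sinhc K ^+ 2 * (E ^+ 2 + 1) + 2 * sinhc K * coshx * E - fdy F).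
  have -> : fdy E = 1 + x * fdy F by rewrite EF fdyD fdyM fdyy fdyx; ring.
  transitivity (sinhx ^+ 2 * E ^+ 2 + 2 * sinhx * E * coshx + coshx ^+ 2 - 1 - x * fdy F).
    by ring.
  by rewrite ch -(sinhcE K); ring.
by rewrite mul_fx.
Qed.

Definition tanh_moments : fps K := jser tanhq.
Notation N := tanh_moments.

Lemma xonlyZ a c : xonly c -> xonly (a *: c).
Proof. by move=> cx i j; rewrite fpsZ cx mulr0. Qed.

(** Integral over y from -1 to 1 of [tanhs_deriv], where the square of the flow is first replaced by
    its time derivative plus 1 so that everything is linear. The endpoints are fixed by the flow, so
    the left-hand side integrates to 2. *)
Lemma moments_ode : sinhx ^+ 2 * fdx N + 2 *: (sinhx * coshx) * N
   + (sinhx ^+ 2 + coshx ^+ 2) * 2%:R = 2%:R.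
Proof.
have xs := xonly_sinh; have xc := xonly_cosh.
have x2 : xonly (sinhx ^+ 2) by rewrite expr2; apply: xonlyM.
have x3 : xonly (2 *: (sinhx * coshx)) by apply: xonlyZ; apply: xonlyM.
have x4 : xonly (sinhx ^+ 2 + coshx ^+ 2).
  by apply: xonlyD => //; rewrite expr2; apply: xonlyM.
pose q1 i : {poly K} := i.+1%:R *: tanhq i.+1.
pose one i : {poly K} := (i == 0%N)%:R%:P.
have rE : row E tanhq by [].
have r1 : row (fdx E) q1 by move=> i j; rewrite /q1 coefZ.
have rone : row 1 one by move=> i j; rewrite fps1E coefC; case: j => [|j]; rewrite ?andbT ?andbF.
have ry : row (fdy E) (fun i => (tanhq i)^`()).
  by move=> i j; rewrite /fdy coef_deriv mulr_natl.
have eq : fdy E = sinhx ^+ 2 * fdx E + 2 *: (sinhx * coshx) * E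
    + (sinhx ^+ 2 + coshx ^+ 2) * 1.
  by rewrite tanhs_deriv tanhs_riccati scaler_nat; ring.
pose r i := xmul (sinhx ^+ 2) q1 i + xmul (2 *: (sinhx * coshx)) tanhq i +
  xmul (sinhx ^+ 2 + coshx ^+ 2) one i.
have rr : row (fdy E) r.
  move=> i j; rewrite eq !fpsD !coefD.
  by rewrite (row_xmul x2 r1) (row_xmul x3 rE) (row_xmul x4 rone).
have jN : jser q1 = fdx N.
  by apply: fpsP => i [|j]; rewrite /fdx /= ?int11Z ?mulr0.
have j1 : jser one = 2%:R.
  apply: fpsP => i j; rewrite -scaler_nat fpsZ fps1E /jser.
  case: j => [|j]; last by rewrite andbF mulr0.
  rewrite andbT /one; have -> : (i == 0%N)%:R%:P = (i == 0%N)%:R *: ('X : {poly K})^`().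
    by rewrite derivX alg_polyC.
  by rewrite int11Z int11_deriv !hornerX opprK mulrC.
rewrite -jN -[X in _ + _ * X = _]j1 -(jser_xmul q1 x2) -(jser_xmul tanhq x3) -(jser_xmul one x4) -!jserD.
apply: fpsP => i j; rewrite -scaler_nat fpsZ fps1E /jser.
case: j => [|j]; last by rewrite andbF mulr0.
rewrite -/(r i) -(row_unique ry rr) int11_deriv /tanhq !hornerZ -mulrBr tanhp_end andbT.
by case: i => [|i] /=; rewrite ?mul0r ?mulr0 // fact0 invr1 !mul1r mulr1.
Qed.

(** The equation says that sinh^2 N has derivative -4 sinh^2, and sinh^2 A' = sinh cosh - x has
    derivative 2 sinh^2; both vanish at 0. *)
Lemma moments_xcoth (A : fps K) : A * sinhx = x * coshx -> N = - (2%:R * fdx A).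
Proof.
move=> AS; apply/eqP; rewrite -addr_eq0; apply/eqP.
have ch := cosh_sq K; have m := moments_ode; have Ss := sinhcE K.
have dA : sinhx * fdx A = coshx + x * sinhx - A * coshx.
  have := congr1 (@fdx K) AS; rewrite !fdxM fdx_sinh fdx_cosh fdxx mul1r => h.
  by rewrite -h; ring.
have dA2 : sinhx ^+ 2 * fdx A = sinhx * coshx - x.
  have -> : sinhx ^+ 2 * fdx A = sinhx * (sinhx * fdx A) by ring.
  rewrite dA; have -> : sinhx * (coshx + x * sinhx - A * coshx) =
    sinhx * coshx + x * sinhx ^+ 2 - (A * sinhx) * coshx by ring.
  rewrite AS; have -> : x * coshx * coshx = x * coshx ^+ 2 by ring.
  by rewrite ch; ring.
have T0 : sinhx ^+ 2 * (N + 2%:R * fdx A) = 0.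
  apply: (ode_unique (C := 0)); last by move=> j; rewrite -Ss exprMn expr2 -!mulrA mul_fx.
  rewrite mul0r mulrDr fdxD fdxM fdx_sq fdx_sinh.
  have -> : sinhx ^+ 2 * (2%:R * fdx A) =
      (sinhx * coshx - x) + (sinhx * coshx - x) by rewrite -dA2; ring.
  rewrite fdxD (linB (@lin_fdx K)) fdxM fdx_sinh fdx_cosh fdxx.
  transitivity (sinhx ^+ 2 * fdx N + 2 *: (sinhx * coshx) * N
    + (sinhx ^+ 2 + coshx ^+ 2) * 2%:R - 2%:R); last by rewrite m subrr.
  by rewrite scaler_nat; ring.
rewrite -Ss exprMn expr2 -!mulrA in T0.
have {}T0 := xmul_inj (etrans T0 (esym (mulr0 _))).
have {}T0 := xmul_inj (etrans T0 (esym (mulr0 _))).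
have u0 : sinhc K 0%N 0%N != 0 by rewrite sinhc0 oner_neq0.
exact: (fps_cancel u0 (fps_cancel u0 T0)).
Qed.

(** The source of the factorials: time derivatives of the flow are i! times Taylor coefficients, and
    those of the integral decay only geometrically. *)
Lemma moment_val (A : fps K) i : A * sinhx = x * coshx ->
  int11 (tanhp i) = - (2 * (i.+1`!%:R * A i.+1 0%N)).
Proof.
move=> AS; have := congr1 (fun f : fps K => f i 0%N) (moments_xcoth AS).
rewrite /tanh_moments /= /tanhq int11Z fpsN mulr_natl -scaler_nat fpsZ /fdx => h.
have hf : (i`!%:R : K) != 0 by rewrite pnatr_eq0 -lt0n fact_gt0.
apply: (mulfI (x := (i`!%:R)^-1)); first by rewrite invr_eq0.
by rewrite h mulrN factS natrM; congr (- _); field.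
Qed.

Definition quartic : {poly K} := ('X^2 - 1) ^+ 2.

(** [quartic] is y^2 on the leaf u = 1. With D = [leafD], D^3 x = 6 (x^2 - 1)^2 + 4 (x^2 - 1). *)
Lemma quarticE : quartic = 6^-1 *: (tanhp 3 - 4 *: tanhp 1).
Proof.
have d1 : Dp 'X = 'X^2 - 1 by rewrite /leafD derivX mulr1.
have d2 : ('X^2 - 1 : {poly K})^`() = 'X *+ 2.
  by rewrite derivB derivXn derivC subr0 expr1.
have -> : tanhp 3 - 4 *: tanhp 1 = 6%:R *: quartic.
  rewrite /tanhp /= d1 /leafD d2 derivM d2 derivMn derivX /quartic.
  by rewrite !scaler_nat; ring.
by rewrite scalerA mulVf ?scale1r // (pnatr_eq0 K 6).
Qed.

End LeafIntegral.

(** * Factorial growth *)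

Section LeafEvaluation.
Variable K : numFieldType.
Implicit Types (f g h : fps K) (p q : {poly K}).
Notation x := (fx K).
Notation y := (fy K).
Notation V := (vf_apply (leaf_field K)).
Notation X0 := (base_field K).
Notation Dp := (@leafD K).

Definition evp k l : {poly K} := 'X^k * ('X^2 - 1) ^+ l.

(* The restriction to the leaf [u = 1] of the part of weight [n] of [g], for the
   weights 1 and 2 of [x] and [y]; the leaf is parametrised by [x]. *)
Definition ev n g : {poly K} := \sum_(k < n.+1) \sum_(l < n.+1)
  ((k + 2 * l == n)%N%:R * g k l) *: evp k l.

Lemma evD n f g : ev n (f + g) = ev n f + ev n g.
Proof.
rewrite /ev -big_split; apply: eq_bigr => k _; rewrite -big_split.
by apply: eq_bigr => l _; rewrite fpsD mulrDr scalerDl.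
Qed.
Lemma evZ n c f : ev n (c *: f) = c *: ev n f.
Proof.
rewrite /ev scaler_sumr; apply: eq_bigr => k _; rewrite scaler_sumr.
by apply: eq_bigr => l _; rewrite fpsZ scalerA mulrCA.
Qed.
Lemma ev0 n : ev n 0 = 0. Proof. by rewrite -(scale0r 0) evZ scale0r. Qed.
Lemma evN n f : ev n (- f) = - ev n f.
Proof. by rewrite -scaleN1r evZ scaleN1r. Qed.
Lemma evB n f g : ev n (f - g) = ev n f - ev n g.
Proof. by rewrite evD evN. Qed.
Lemma ev_sum n I (r : seq I) (P : pred I) (F : I -> fps K) :
  ev n (\sum_(i <- r | P i) F i) = \sum_(i <- r | P i) ev n (F i).
Proof. by elim/big_rec2: _ => [|i a b _ <-]; rewrite ?ev0 ?evD. Qed.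

Lemma ev_small n f : (forall k l, (k + 2 * l = n)%N -> f k l = 0) -> ev n f = 0.
Proof.
move=> h; rewrite /ev big1 // => k _; rewrite big1 // => l _.
by case: eqP => [/h ->|_]; rewrite ?mulr0 ?mul0r scale0r.
Qed.

Lemma ev_mono n k l : ev n (mono k l) = (k + 2 * l == n)%N%:R *: evp k l.
Proof.
case: eqP => [e|ne]; last first.
  rewrite scale0r; apply: ev_small => k' l' e; rewrite /mono.
  by case: eqP => [ek|//]; case: eqP => [el|//]; case: ne; rewrite -ek -el.
have kn : (k < n.+1)%N by lia. have ln : (l < n.+1)%N by lia.
rewrite /ev (bigD1 (Ordinal kn)) //= (bigD1 (Ordinal ln)) //= /mono !eqxx e eqxx mulr1.
rewrite big1 ?addr0; last first.
  move=> j /eqP jl; rewrite (_ : (j == l :> nat) = false) ?andbF ?mulr0 ?scale0r //.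
  by apply/eqP => ej; apply: jl; apply: val_inj.
rewrite big1 ?addr0 // => i /eqP ik; rewrite big1 // => j _.
rewrite (_ : (i == k :> nat) = false) ?mulr0 ?scale0r //.
by apply/eqP => ei; apply: ik; apply: val_inj.
Qed.

Lemma ev_deg n N f : (n < N)%N -> ordw 1 1 N f -> ev n f = 0.
Proof. by move=> nN fN; apply: ev_small => k l e; apply: fN; lia. Qed.

Lemma ev_ord n f : ord (2 * n).+1 f -> ev n f = 0.
Proof. by move=> fn; apply: ev_small => k l e; apply: fn; lia. Qed.

Lemma ev_ext (Phi Psi : fps K -> {poly K}) N :
  (forall f g, Phi (f + g) = Phi f + Phi g) -> (forall c f, Phi (c *: f) = c *: Phi f) ->
  (forall f g, Psi (f + g) = Psi f + Psi g) -> (forall c f, Psi (c *: f) = c *: Psi f) ->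
  (forall f, ordw 1 1 N f -> Phi f = 0) -> (forall f, ordw 1 1 N f -> Psi f = 0) ->
  (forall k l, Phi (mono k l) = Psi (mono k l)) -> forall f, Phi f = Psi f.
Proof.
move=> PD PZ QD QZ P0 Q0 PQ f.
have dN := trunc_deg N f.
have -> : Phi f = Phi (trunc N f) by rewrite -{1}(subrK (trunc N f) f) PD P0 ?add0r.
have -> : Psi f = Psi (trunc N f) by rewrite -{1}(subrK (trunc N f) f) QD Q0 ?add0r.
rewrite /trunc.
have h (F : nat -> nat -> K) M M' :
   Phi (\sum_(k < M) \sum_(l < M') F k l *: mono k l) =
   Psi (\sum_(k < M) \sum_(l < M') F k l *: mono k l).
  have z1 : Phi 0 = 0 by rewrite -(scale0r 0) PZ scale0r.
  have z2 : Psi 0 = 0 by rewrite -(scale0r 0) QZ scale0r.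
  elim: M => [|M IH]; first by rewrite big_ord0 z1 z2.
  rewrite big_ord_recr /= PD QD IH; congr (_ + _).
  elim: M' {IH} => [|M' IH]; first by rewrite big_ord0 z1 z2.
  by rewrite big_ord_recr /= PD QD IH PZ QZ PQ.
exact: (h f N N).
Qed.

Lemma evp_deriv k l : (evp k l)^`() =
  k%:R *: evp k.-1 l + (2 * l)%:R *: evp k.+1 l.-1.
Proof.
rewrite /evp derivM derivXn deriv_exp derivB derivXn derivC subr0 expr1.
rewrite mulrnAl scaler_nat; congr (_ + _); rewrite scaler_nat mulrnA [in RHS]exprS.
by move: ('X^k) (_ ^+ l.-1) => P Q; ring.
Qed.

(** V lowers the weight by one and is tangent to the leaf, where it is d/dx. *)
Lemma ev_leaf n g : (ev n.+1 g)^`() = ev n (V g).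
Proof.
have [vD vZ] := lin_vf (leaf_field K).
apply: (@ev_ext (fun g => (ev n.+1 g)^`()) (fun g => ev n (V g)) n.+3).
- by move=> f h; rewrite evD derivD.
- by move=> c f; rewrite evZ derivZ.
- by move=> f h; rewrite vD evD.
- by move=> c f; rewrite vZ evZ.
- by move=> f fN; rewrite (@ev_deg _ n.+3) ?raddf0.
- move=> f fN; apply: (@ev_deg _ n.+2) => //; rewrite vfE; apply: ordwD.
    rewrite mul1r; apply: ordwW (ordw_fdx fN); lia.
  rewrite -scalerAl; apply: ordwZ.
  by apply: ordwW (ordwM (ordw0n (p := 1) (q := 1) x) (ordw_fdy fN)); lia.
move=> k l; rewrite ev_mono derivZ vfE /= mul1r fdx_mono fdy_mono evD -!scalerAl -!scaleAr.
rewrite !evZ fxE monoM !ev_mono evp_deriv scalerDr !scalerA add1n add0n; congr (_ + _).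
  case: k => [|k]; first by rewrite mulr0 mul0r.
  by rewrite mulrC addSn eqSS.
case: l => [|l]; first by rewrite muln0 !mulr0 mul0r.
rewrite natrM mulrC (_ : (k.+1 + 2 * l.+1.-1 == n)%N = (k + 2 * l.+1 == n.+1)%N) //.
by lia.
Qed.

Lemma ev_ymul n h : ev n.+2 (y * h) = ('X^2 - 1) * ev n h.
Proof.
apply: (@ev_ext (fun h => ev n.+2 (y * h)) (fun h => ('X^2 - 1) * ev n h) n.+3).
- by move=> f g; rewrite mulrDr evD.
- by move=> c f; rewrite -scaleAr evZ.
- by move=> f g; rewrite evD mulrDr.
- by move=> c f; rewrite evZ scalerAr.
- move=> f fN; apply: (@ev_deg _ n.+3) => //.
  exact: (ordwM (ordw0n (p := 1) (q := 1) y) fN).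
- by move=> f fN; rewrite (@ev_deg _ n.+3) ?mulr0 //; lia.
move=> k l; rewrite fyE monoM !ev_mono -scalerAr /evp add0n add1n exprS.
rewrite (_ : (k + 2 * l.+1 == n.+2)%N = (k + 2 * l == n)%N); last by lia.
by congr (_ *: _); ring.
Qed.

Lemma ev0_base g : ev 0 (vf_apply X0 g) = 0.
Proof.
by rewrite base_fieldE; apply: ev_small => k l kl; rewrite mul_fy; case: l kl => // l; lia.
Qed.

(** X_0 = y V raises the weight by one, as y has weight 2; this grading cuts the exponential into
    finite sums. *)
Lemma evS_base n g : ev n.+1 (vf_apply X0 g) = Dp (ev n g).
Proof.
rewrite base_fieldE; case: n => [|n]; last by rewrite ev_ymul /leafD ev_leaf.
have -> : ev 0 g = (g 0%N 0%N)%:P.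
  by rewrite /ev !big_ord1 eqxx mul1r /evp !expr0 mul1r alg_polyC.
rewrite /leafD derivC mulr0; apply: ev_small => k l kl.
by rewrite mul_fy; case: l kl => // l; lia.
Qed.

Lemma ev_iter_base n l g : ev n (iter l (vf_apply X0) g) =
  if (l <= n)%N then iter l Dp (ev (n - l) g) else 0.
Proof.
elim: l n => [|l IH] n; first by rewrite subn0.
rewrite iterS; case: n => [|n]; first exact: ev0_base.
by rewrite evS_base IH ltnS subSS; case: ifP => // _; rewrite leafD0.
Qed.

Lemma ev_expvf n h : ev n (expvf X0 h) =
  \sum_(l < n.+1) (l`!%:R)^-1 *: iter l Dp (ev (n - l) h).
Proof.
have hN := expvf_trunc (2 * n).+1 h (base_raises K).
rewrite -(subrK (\sum_(l < (2 * n).+1) (l`!%:R)^-1 *: iter l (vf_apply X0) h) (expvf X0 h)).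
rewrite evD ev_ord // add0r ev_sum.
rewrite -(sum_pad (n := n.+1) (F := fun l => ev n ((l`!%:R)^-1 *: iter l (vf_apply X0) h))).
- by apply: eq_bigr => l _; rewrite evZ ev_iter_base -ltnS ltn_ord.
- by lia.
by move=> k nk; rewrite evZ ev_iter_base leqNgt nk scaler0.
Qed.

(** The leaf u = 1 meets the axis y = 0 at x = 1 and x = -1, where only pure powers of x survive. *)
Lemma ev_end n g : (ev n g).[1] = g n 0%N /\ (ev n g).[-1] = (-1) ^+ n * g n 0%N.
Proof.
have e (s : K) : s ^+ 2 = 1 -> (ev n g).[s] = s ^+ n * g n 0%N.
  move=> s2; rewrite /ev horner_sum big_ord_recr /= horner_sum big_ord_recl /=.
  rewrite muln0 addn0 eqxx mul1r /evp expr0 mulr1 hornerZ hornerXn mulrC.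
  have z k l : (((k + 2 * l.+1 == n)%N%:R * g k l.+1) *: evp k l.+1).[s] = 0.
    rewrite /evp hornerZ hornerM [X in _ * (_ * X)]horner_exp.
    have -> : ('X^2 - 1 : {poly K}).[s] = 0 by rewrite hornerD hornerN hornerXn hornerC s2 subrr.
    by rewrite exprS mul0r !mulr0.
  rewrite [X in _ + (_ + X)]big1 ?addr0; last by move=> l _; exact: z.
  rewrite big1 ?add0r // => k _; rewrite horner_sum big_ord_recl big1 ?addr0.
    rewrite muln0 addn0 (_ : (k == n :> nat) = false) ?mul0r ?scale0r ?horner0 //.
    by have := ltn_ord k; lia.
  by move=> l _; exact: z.
by split; rewrite e ?expr1n ?mul1r ?sqrrN ?expr1n.
Qed.

Section Coefficients.
Variables (a g : fps K).
Hypothesis a_eq : expvf X0 a - a = - y ^+ 2.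
Hypothesis g_eq : expvf X0 g - g = - (y ^+ 2 * V (expvf X0 a)).
Variable A : fps K.
Hypotheses (A_sinh : A * sinhx K = x * coshx K)
  (A_ode : x * fdx A = A - A ^+ 2 + x ^+ 2) (A0 : A 0%N 0%N = 1).
Notation bern := (bern A).
Notation quartic := (quartic K).

Let e n : {poly K} := (n == 4%N)%:R *: quartic.
Let q n := Dp (ev n a).
(** The expected value of [q n]. The equation for [a] says that (exp D - 1) / D sends q to -y^2; its
    inverse D / (exp D - 1) has coefficients [bern]. Since y^2 has weight 4 and applying D shifts
    the weight by one, the index is n - 3. *)
Let t n : {poly K} := if (n < 3)%N then 0 else - (bern (n - 3) *: iter (n - 3) Dp quartic).

Lemma ev_y2 n : ev n (y ^+ 2) = e n.
Proof.
have -> : y ^+ 2 = mono 0 2 by rewrite monoE expr0 mul1r.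
by rewrite ev_mono /e /evp expr0 mul1r eq_sym.
Qed.

Lemma triangle_q m : \sum_(l < m.+1) (l.+1`!%:R)^-1 *: iter l Dp (q (m - l)) = - e m.+1.
Proof.
have := congr1 (ev m.+1) a_eq; rewrite evB evN ev_y2 ev_expvf big_ord_recl /=.
rewrite subn0 fact0 invr1 scale1r addrC addKr => <-.
by apply: eq_bigr => l _; rewrite /bump /= add1n subSS /q -iterSr.
Qed.

Lemma triangle_t m : \sum_(l < m.+1) (l.+1`!%:R)^-1 *: iter l Dp (t (m - l)) = - e m.+1.
Proof.
have [m3|m3] := ltnP m 3.
  rewrite big1 => [|l _]; last by rewrite /t ifT ?iter_leafD0 ?scaler0 //; lia.
  by rewrite /e (_ : (m.+1 == 4)%N = false) ?scale0r ?oppr0 //; lia.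
have [r ->] : exists r, m = (r + 3)%N by exists (m - 3)%N; lia.
rewrite -(sum_pad (n := r.+1) (F := fun l => (l.+1`!%:R)^-1 *: iter l Dp (t (r + 3 - l)%N))).
- rewrite (eq_bigr (fun l : 'I_r.+1 => - (bern (r - l) / (l.+1)`!%:R) *: iter r Dp quartic)).
    rewrite -scaler_suml sumrN (reindex_inj rev_ord_inj) /=.
    rewrite (eq_bigr (fun k : 'I_r.+1 => bern k / (r.+1 - k)`!%:R)).
      rewrite (bern_conv A_sinh) /e scaleNr; congr (- _); case: (r) => [|s] //.
      by rewrite (_ : ((s.+1 + 3).+1 == 4)%N = false) ?scale0r //; lia.
    move=> k _; have := ltn_ord k => kr; congr (bern _ / _%:R); first by lia.
    by congr (factorial _); lia.
  move=> l _; have lr : (l <= r)%N by rewrite -ltnS.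
  rewrite /t ifF; last by lia.
  rewrite -scaleNr iter_leafDZ -iterD scalerA mulrN mulrC; congr (_ *: iter _ Dp quartic); last by lia.
  by congr (- (bern _ / _)); lia.
- by lia.
by move=> k rk; rewrite /t ifT ?iter_leafD0 ?scaler0 //; lia.
Qed.

Lemma q_val m : q m = t m.
Proof.
have [n] := ubnP m; elim: n m => // n IH m mn.
have := triangle_q m; rewrite -triangle_t !big_ord_recl /= subn0 (_ : 1`! = 1%N) // invr1 !scale1r.
rewrite (eq_bigr (fun i : 'I_m => ((bump 0 i).+1`!%:R)^-1 *: iter (bump 0 i) Dp (t (m - bump 0 i)))).
  by move/addIr.
by move=> i _; rewrite IH // /bump; have := ltn_ord i; lia.
Qed.

(** Integral of the equation for [g] along the leaf between its two points on the axis. In (exp D -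
    1) / D every term but the first is the derivative of a polynomial vanishing at both ends, so the
    left-hand side is the difference of the end values of [g], and these are opposite because the
    weight k + 5 is odd. *)
Lemma leading_coef k : (k != 1)%N -> ~~ odd k ->
  2 * g (k + 5)%N 0%N = bern k * int11 (iter k Dp quartic).
Proof.
move=> k1 ko; pose n := (k + 3)%N.
have h_eq : expvf X0 a = a - y ^+ 2 by rewrite -a_eq; ring.
have e1 := congr1 (ev n.+3) g_eq.
have {}e1 : \sum_(l < n.+3) (l.+1`!%:R)^-1 *: iter l.+1 Dp (ev (n.+2 - l) g) =
   - (('X^2 - 1) * Dp (ev n (expvf X0 a))).
  have -> : - (('X^2 - 1) * Dp (ev n (expvf X0 a))) = ev n.+3 (- (y ^+ 2 * V (expvf X0 a))).
    by rewrite evN -evS_base -ev_ymul base_fieldE expr2 mulrA.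
  rewrite -e1 evB ev_expvf [in RHS]big_ord_recl /= subn0 fact0 invr1 scale1r addrC addKr.
  by apply: eq_bigr => l _; rewrite /bump /= add1n subSS.
(* Each side has the factor x^2 - 1, from D on the left and from one factor y of y^2 on the right;
   cancelling it leaves derivatives to be integrated. *)
have {}e1 : \sum_(l < n.+3) (l.+1`!%:R)^-1 *: (iter l Dp (ev (n.+2 - l) g))^`() =
   - Dp (ev n (expvf X0 a)).
  have nz : ('X^2 - 1 : {poly K}) != 0.
    by rewrite -size_poly_eq0 size_XnsubC.
  apply: (mulfI nz); rewrite mulrN -e1 mulr_sumr; apply: eq_bigr => l _.
  by rewrite -scalerAr iterS.
have := congr1 (@int11 K) e1; rewrite int11_sum big_ord_recl big1 ?addr0; last first.
  move=> l _; rewrite int11Z int11_deriv lift0 iterS.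
  by have [-> ->] := leafD_end (iter l Dp (ev (n.+2 - l.+1) g)); rewrite subrr mulr0.
rewrite int11Z int11_deriv /= subn0 (_ : 1`! = 1%N) // invr1 mul1r.
have [-> ->] := ev_end n.+2 g.
have -> : (-1) ^+ n.+2 = -1 :> K by rewrite /n -signr_odd !oddS oddD (negbTE ko).
rewrite mulN1r opprK h_eq evB ev_y2 leafD_add -[Dp (ev n a)]/(q n) q_val.
have -> : e n = 0 by rewrite /e /n (_ : (k + 3 == 4)%N = false) ?scale0r //; lia.
rewrite oppr0 leafD0 addr0 /t ifF; last by rewrite /n; lia.
rewrite /n addnK opprK int11Z => <-.
by rewrite -[in RHS](addnS k) -[in RHS](addnS k); ring.
Qed.

(** With k = 2 n, the two moments behind [quarticE] carry A at k + 4 and at k + 2, of opposite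
    signs, and are subtracted, so they add up in absolute value. The constants are 900 = 15 * 15 *
    4, from [xcoth_bound] twice and from 2^k, and 54 = 2 * 27, the 27 collecting the factors 5, 3
    and 15^2. *)
Lemma leading_bound n : (0 < n)%N ->
  ((2 * n + 4)`!)%:R / 54 / 900 ^+ n <= `|g (2 * n + 5)%N 0%N|.
Proof.
case: n => // n _; set k := (2 * n.+1)%N.
have k1 : (k != 1)%N by rewrite /k; lia.
have ko : ~~ odd k by rewrite /k; lia.
have lc := leading_coef k1 ko.
have tanhp_iter l m : iter l Dp (tanhp K m) = tanhp K (l + m) by rewrite /tanhp iterD.
have mom : int11 (iter k Dp quartic) =
    - (3^-1 * ((k + 4)`!%:R * A (k + 4)%N 0%N - 4 * ((k + 2)`!%:R * A (k + 2)%N 0%N))).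
  rewrite quarticE iter_leafDZ iter_leafD_add -scaleN1r !iter_leafDZ !tanhp_iter.
  rewrite int11Z int11D !int11Z !(moment_val _ A_sinh).
  rewrite -addnS -addnS.
  by set F1 := _`!%:R; set F2 := _`!%:R; field.
have kE : k = (2 * n).+2 by rewrite /k; lia.
have k2 : (k + 2)%N = (2 * n.+1).+2 by rewrite /k; lia.
have k4 : (k + 4)%N = (2 * n.+2).+2 by rewrite /k; lia.
have := xcoth_bound A_ode A0 n; rewrite -kE; set w := (-1) ^+ _ * A _ _ => hw.
have := xcoth_bound A_ode A0 n.+1; rewrite -k2; set u := (-1) ^+ _ * A _ _ => hu.
have := xcoth_bound A_ode A0 n.+2; rewrite -k4; set v := (-1) ^+ _ * A _ _ => hv.
have sg : (-1) ^+ n * (-1) ^+ n = 1 :> K by rewrite -expr2 sqrr_sign.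
have Aw : A k 0%N = (-1) ^+ n * w by rewrite /w mulrA sg mul1r.
have Au : A (k + 2)%N 0%N = - ((-1) ^+ n * u).
  by rewrite /u exprS mulN1r mulNr mulrN opprK mulrA sg mul1r.
have Av : A (k + 4)%N 0%N = (-1) ^+ n * v.
  by rewrite /v 2!exprS !mulN1r opprK mulrA sg mul1r.
have p15 m : (0 : K) < 5 / 15 ^+ m by rewrite divr_gt0 ?exprn_gt0 ?ltr0n.
have v0 : 0 <= v by apply: le_trans hv; apply: ltW.
have u0 : 0 <= u by apply: le_trans hu; apply: ltW.
have w0 : 0 <= w by apply: le_trans hw; apply: ltW.
set F := (k + 4)`!%:R in mom *; set F2 := (k + 2)`!%:R in mom.
have F0 : 0 <= F by rewrite ler0n.
have F20 : 0 <= F2 by rewrite ler0n.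
have nm : 2 * `|g (k + 5)%N 0%N| = w / 2 ^+ k * (3^-1 * (F * v + 4 * (F2 * u))).
  have -> : 2 * `|g (k + 5)%N 0%N| = `|2 * g (k + 5)%N 0%N| by rewrite normrM gtr0_norm ?ltr0n.
  rewrite lc mom /bern (negbTE k1) subr0 Aw Au Av.
  have -> : (-1) ^+ n * w / 2 ^+ k * - (3^-1 * (F * ((-1) ^+ n * v) - 4 * (F2 * - ((-1) ^+ n * u)))) =
     - (((-1) ^+ n * (-1) ^+ n) * (w / 2 ^+ k * (3^-1 * (F * v + 4 * (F2 * u))))) by ring.
  rewrite sg mul1r normrN ger0_norm //; apply: mulr_ge0.
    by rewrite divr_ge0 ?exprn_ge0 ?ler0n.
  apply: mulr_ge0; first by rewrite invr_ge0 ler0n.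
  by apply: addr_ge0; apply: mulr_ge0; rewrite ?ler0n //; apply: mulr_ge0.
have hk : 2 ^+ k = 4 ^+ n.+1 :> K by rewrite /k exprM; congr (_ ^+ _); ring.
rewrite -(ler_pM2l (_ : 0 < 2 :> K)) ?ltr0n // nm hk.
apply: (@le_trans _ _ (5 / 15 ^+ n.+1 / 4 ^+ n.+1 * (3^-1 * (F * (5 / 15 ^+ n.+3))))).
  have e9 : 900 ^+ n.+1 = 15 ^+ n.+1 * 15 ^+ n.+1 * 4 ^+ n.+1 :> K.
    by rewrite -!exprMn; congr (_ ^+ _); ring.
  rewrite e9 !(exprS 15 n.+2) (exprS 15 n.+1).
  have z15 : (15 ^+ n.+1 : K) != 0 by rewrite expf_neq0 // (pnatr_eq0 K 15).
  have z4 : (4 ^+ n.+1 : K) != 0 by rewrite expf_neq0 // (pnatr_eq0 K 4).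
  rewrite le_eqVlt; apply/orP; left; apply/eqP.
  by field; rewrite z15 z4.
apply: ler_pM.
- by rewrite divr_ge0 ?exprn_ge0 ?ler0n // ltW.
- by rewrite mulr_ge0 ?invr_ge0 ?ler0n // mulr_ge0 // ltW.
- by rewrite ler_pM2r // invr_gt0 exprn_gt0 ?ltr0n.
rewrite ler_pM2l ?invr_gt0 ?ltr0n //.
apply: (@le_trans _ _ (F * v)); first by rewrite ler_wpM2l.
by rewrite lerDl; apply: mulr_ge0; rewrite ?ler0n //; apply: mulr_ge0.
Qed.

End Coefficients.

Lemma G_d_bound n : (0 < n)%N ->
  ((2 * n + 4)`!)%:R / 54 / 900 ^+ n <= `|G_d K 1 (2 * n + 5)%N 0%N|.
Proof.
have [A [h1 h2 h3]] := xcoth_exists K; have [e1 e2 _ _] := G_d_eqs K.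
exact: (leading_bound e1 e2 h1 h2 h3).
Qed.

End LeafEvaluation.

(** * Baire and interpolation *)

Import numFieldNormedType.Exports.

Section Interpolation.
Variable R : realType.
Implicit Types (p : {poly R}).
Local Open Scope classical_set_scope.
Local Open Scope ring_scope.

Lemma bin_le_exp2 n k : ('C(n, k) <= 2 ^ n)%N.
Proof.
elim: n k => [|n IH] [|k]; rewrite ?bin0 ?expn_gt0 //.
by rewrite binS expnS mul2n -addnn leq_add.
Qed.

(** Compare n^n n! <= (2 n)! with (2 n)! = C(2 n, n) n!^2 <= 4^n n!^2. *)
Lemma exp_le_fact4 n : (n ^ n <= 4 ^ n * n`!)%N.
Proof.
have h k : (n ^ k * n`! <= (n + k)`!)%N.
  elim: k => [|k IH]; first by rewrite addn0 mul1n.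
  by rewrite expnS -mulnA addnS factS leq_mul //; lia.
have := h n; rewrite -(@bin_fact (n + n) n) ?leq_addr // addnK mulnA.
rewrite leq_pmul2r ?fact_gt0 // => /leq_trans; apply.
rewrite leq_pmul2r ?fact_gt0 //; apply: leq_trans (bin_le_exp2 _ _) _.
by rewrite addnn -mul2n expnM.
Qed.

Lemma coef_prod_bound n (P : pred nat) (c : nat -> R) (C : R) k : 1 <= C ->
  (forall j, (j < n)%N -> 1 + `|c j| <= C) ->
  `|(\prod_(j < n | P j) ('X - (c j)%:P))`_k| <= C ^+ n.
Proof.
move=> C1; elim: n k => [|n IH] k hc.
  by rewrite big_ord0 coef1; case: (k == 0%N); rewrite ?normr1 ?normr0 ?ler01.
rewrite big_mkcond big_ord_recr /= -big_mkcond /=.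
have hc' j : (j < n)%N -> 1 + `|c j| <= C by move=> jn; apply: hc; rewrite ltnW.
set p := \prod_(_ < _ | _) _ in IH *.
have C0 : 0 <= C by apply: le_trans C1.
have IH' l : `|p`_l| <= C ^+ n by apply: IH.
have IHS l : `|p`_l| <= C ^+ n.+1.
  by apply: le_trans (IH' l) _; rewrite exprS ler_peMl // exprn_ge0.
case: (P n); last by rewrite mulr1.
rewrite mulrBr coefB coefMX mulrC mul_polyC coefZ.
apply: le_trans (ler_normB _ _) _.
apply: (@le_trans _ _ (C ^+ n + `|c n| * C ^+ n)).
  rewrite lerD //; last by rewrite normrM ler_wpM2l.
  by case: k => [|k] //=; rewrite normr0 exprn_ge0.
by rewrite -{1}[C ^+ n]mul1r -mulrDl exprS ler_wpM2r ?exprn_ge0 // hc.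
Qed.

Lemma prod_dist i r :
  \prod_(j < i.+1 + r | (j != i :> nat)) `|(i%:R - j%:R : R)| = (i`! * r`!)%N%:R.
Proof.
elim: r => [|r IH].
  rewrite addn0 muln1 big_mkcond big_ord_recr /= eqxx mulr1 -big_mkcond /=.
  rewrite (eq_bigl xpredT) => [|j]; last by have := ltn_ord j; lia.
  rewrite (reindex_inj rev_ord_inj) /=.
  rewrite (eq_bigr (fun j : 'I_i => j.+1%:R)) => [|j _]; last first.
    have ji := ltn_ord j; rewrite -natrB ?normr_nat; last by lia.
    by congr (_%:R); lia.
  by rewrite -natr_prod; congr (_%:R); rewrite fact_prod big_add1 big_mkord.
rewrite addnS big_mkcond big_ord_recr /= -big_mkcond /= IH ifT; last by lia.
rewrite distrC -natrB; last by lia.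
rewrite normr_nat -natrM (_ : (i.+1 + r - i)%N = r.+1); last by lia.
by rewrite factS [(r.+1 * _)%N]mulnC mulnA.
Qed.

(** Lagrange interpolation at n + 1 equidistant nodes of step d = L / (n + 1). The denominators d^n
    i! (n - i)! sum to a factor 2^n / (d^n n!), and [exp_le_fact4] bounds (n + 1)^n / n! by 4^(n +
    1); hence 8 = 2 * 4. *)
Lemma poly_coef_bound p n (al L C B : R) k : (size p <= n.+1)%N -> 0 < L ->
  1 + `|al| + L <= C -> (forall t, al <= t <= al + L -> `|p.[t]| <= B) ->
  `|p`_k| <= B * (8 * C * (1 + L^-1)) ^+ n.+1.
Proof.
move=> sp L0 hC hB; pose d := L / n.+1%:R.
have d0 : 0 < d by rewrite divr_gt0 ?ltr0n.
pose xs (i : nat) := al + d * i%:R.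
have xs_inj : injective xs.
  move=> i j /addrI /(mulfI (lt0r_neq0 d0)) /eqP; rewrite eqr_nat => /eqP //.
have C1 : 1 <= C by apply: le_trans hC; rewrite -addrA lerDl addr_ge0 // ltW.
have dn (j : nat) : (j <= n)%N -> 0 <= d * j%:R <= L.
  move=> jn; rewrite mulr_ge0 ?ler0n ?(ltW d0) //= /d mulrAC ler_pdivrMr ?ltr0n //.
  by rewrite ler_pM2l // ler_nat ltnW.
have B0 : 0 <= B by apply: le_trans (normr_ge0 _) (hB al _); rewrite lexx lerDl ltW.
have hc j : (j < n.+1)%N -> 1 + `|xs j| <= C.
  move=> jn; have /andP[a b] := dn j jn; apply: le_trans hC; rewrite -addrA lerD2l.
  by apply: le_trans (ler_normD _ _) _; rewrite lerD2l ger0_norm.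
have gen := @lagrange_gen R n.+1 xs isT xs_inj p sp.
have C0 : 0 < C by apply: lt_le_trans C1.
have lag (i : 'I_n.+1) : `|(tnth (lagrange n.+1 xs) i)`_k| <=
    C ^+ n.+1 / (d ^+ n * (i`! * (n - i)`!)%N%:R).
  rewrite lagrangeE // coefCM normrM mulrC ler_pM //.
    exact: (@coef_prod_bound n.+1 (fun j => j != i) xs).
  rewrite normfV horner_prod normr_prod.
  rewrite (eq_bigr (fun j : 'I_n.+1 => d * `|(i%:R - j%:R : R)|)); last first.
    move=> j _; rewrite hornerXsubC /xs opprD addrACA subrr add0r -mulrBr normrM.
    by rewrite (gtr0_norm d0).
  rewrite big_split /= prodr_const cardC1 card_ord /=.
  have hi : (i <= n)%N by rewrite -ltnS.
  have := prod_dist i (n - i); rewrite (_ : (i.+1 + (n - i))%N = n.+1) => [<-|]; last by lia.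
  by [].
have pk : `|p`_k| <= \sum_(i < n.+1) B * (C ^+ n.+1 / (d ^+ n * (i`! * (n - i)`!)%N%:R)).
  rewrite gen coef_sum; apply: le_trans (ler_norm_sum _ _ _) _.
  apply: ler_sum => i _; rewrite coefCM normrM ler_pM //.
  have /andP[a b] := dn i (ltn_ord i); apply: hB; rewrite /xs lerDl a /=.
  by rewrite lerD2l.
apply: le_trans pk _.
have f0 m : (0 : R) < m`!%:R by rewrite ltr0n fact_gt0.
have e (i : 'I_n.+1) : B * (C ^+ n.+1 / (d ^+ n * (i`! * (n - i)`!)%N%:R)) =
   B * C ^+ n.+1 / (d ^+ n * n`!%:R) * 'C(n, i)%:R.
  have hi : (i <= n)%N by rewrite -ltnS.
  have -> : n`!%:R = 'C(n, i)%:R * (i`! * (n - i)`!)%N%:R :> R by rewrite -natrM bin_fact.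
  have F0 : (i`! * (n - i)`!)%N%:R != 0 :> R by rewrite pnatr_eq0 muln_eq0 negb_or -!lt0n !fact_gt0.
  have b0 : ('C(n, i)%:R : R) != 0 by rewrite pnatr_eq0 -lt0n bin_gt0.
  have D0 : d ^+ n != 0 by rewrite expf_neq0 ?lt0r_neq0.
  move: (_%N%:R) F0 ('C(n, i)%:R) b0 (d ^+ n) D0 (C ^+ n.+1) => F F0 b b0 D D0 E.
  by field; rewrite b0 F0 D0.
rewrite (eq_bigr _ (fun i _ => e i)) -mulr_sumr -natr_sum.
have -> : (\sum_(i < n.+1) 'C(n, i) = 2 ^ n)%N.
  by rewrite (Pascal 1 1) ; apply: eq_bigr => i _; rewrite !exp1n !muln1.
have -> : B * C ^+ n.+1 / (d ^+ n * n`!%:R) * (2 ^ n)%:R =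
    B * (C ^+ n.+1 * ((2 ^ n)%:R * (L^-1 ^+ n * (n.+1%:R ^+ n / n`!%:R)))).
  rewrite /d expr_div_n exprVn.
  have L0' : L ^+ n != 0 by rewrite expf_neq0 // lt0r_neq0.
  have n0 : n.+1%:R ^+ n != 0 :> R by rewrite expf_neq0 // pnatr_eq0.
  by field; rewrite L0' n0 lt0r_neq0.
rewrite ler_wpM2l // [8 * C]mulrC -mulrA exprMn ler_wpM2l ?exprn_ge0 ?(ltW C0) //.
have Li0 : 0 <= L^-1 by rewrite invr_ge0 ltW.
set Q := _ / _; have Q0 : 0 <= Q by rewrite divr_ge0 ?exprn_ge0 ?ler0n.
have Q4 : Q <= 4 ^+ n.+1.
  rewrite ler_pdivrMr // -!natrX -natrM ler_nat.
  rewrite -(leq_pmul2r (ltn0Sn n)) -expnSr; apply: leq_trans (exp_le_fact4 _) _.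
  by rewrite factS mulnCA mulnC -mulnA.
have l1 : L^-1 ^+ n <= (1 + L^-1) ^+ n.+1.
  apply: (@le_trans _ _ ((1 + L^-1) ^+ n)).
    by rewrite lerXn2r ?nnegrE ?addr_ge0 // lerDr.
  by rewrite exprS ler_peMl ?exprn_ge0 ?addr_ge0 // lerDl.
have t2 : (2 ^ n)%:R <= 2 ^+ n.+1 :> R.
  by rewrite natrX exprS ler_peMl ?exprn_ge0 ?ler0n // ler1n.
have -> : (8 * (1 + L^-1)) ^+ n.+1 = 2 ^+ n.+1 * ((1 + L^-1) ^+ n.+1 * 4 ^+ n.+1) :> R.
  by rewrite -!exprMn; congr (_ ^+ _); ring.
apply: ler_pM => //.
- by apply: mulr_ge0 => //; apply: exprn_ge0.
- by apply: ler_pM => //; apply: exprn_ge0.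
Qed.

(* Baire's theorem turns the pointwise bounds into a uniform one on some
   interval, and interpolation there bounds the coefficients. *)
Lemma pointwise_poly_bound (a : nat -> nat -> R) :
  (forall c : R, exists M, forall N, `|\sum_(k < N.+1) a N k * c ^+ k| <= M ^+ N.+1) ->
  exists M, forall N k, (k <= N)%N -> `|a N k| <= M ^+ N.+1.
Proof.
move=> ha; pose P N : {poly R} := \poly_(k < N.+1) a N k.
have PE N c : (P N).[c] = \sum_(k < N.+1) a N k * c ^+ k by rewrite horner_poly.
pose F (m : nat) : set R := [set c | exists N, m.+1%:R ^+ N.+1 < `|(P N).[c]|].
have Fo m : open (F m).
  have -> : F m = \bigcup_N [set c | m.+1%:R ^+ N.+1 < `|(P N).[c]|].
    by apply/seteqP; split=> c; [move=> [N h]; exists N | move=> [N _ h]; exists N].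
  apply: bigcup_open => N _.
  apply: (@open_comp _ _ (fun c => `|(P N).[c]|) [set t | m.+1%:R ^+ N.+1 < t]).
    move=> c _; apply: (@continuous_comp _ _ _ (horner (P N)) (fun t => `|t|)).
      exact: continuous_horner.
    exact: norm_continuous.
  exact: open_gt.
(* Were all the open sets [F m] dense, Baire's theorem would give a point in each of them, where no
   geometric bound could hold. *)
have [m nd] : exists m, ~ dense (F m).
  apply/not_existsP => nd.
  have dn : dense (\bigcap_i F i) by apply: Baire => i; split=> //; apply: contrapT; exact: nd.
  have [c [_ hc]] := dn setT (ex_intro _ 0 I) openT.
  have [M hM] := ha c.
  have [m hm] : exists m : nat, `|M| <= m.+1%:R.
    exists (Num.bound `|M|); apply: ltW.
    by apply: lt_trans (archi_boundP (normr_ge0 M)) _; rewrite ltr_nat.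
  have [N hN] := hc m I; have := hM N; rewrite -PE leNgt => /negP; apply.
  apply: le_lt_trans hN; apply: le_trans (ler_norm _) _.
  by rewrite normrX lerXn2r ?nnegrE.
have [D [[c [Do Dc]] D0]] := denseNE nd.
have [r /= r0 hr] := (open_nbhs_nbhs (conj Do Dc)).
have hB t : c <= t <= c + r / 2 -> forall N, `|(P N).[t]| <= m.+1%:R ^+ N.+1.
  move=> ht N; rewrite leNgt; apply/negP => h.
  have : (D `&` F m) t.
    split; last by exists N.
    apply: hr; rewrite /ball /= /ball_ /=; case/andP: ht => h1 h2.
    by rewrite distrC ger0_norm ?subr_ge0 //; lra.
  by rewrite D0.
exists (m.+1%:R * (8 * (1 + `|c| + r / 2) * (1 + (r / 2)^-1))) => N k kN.
rewrite [leRHS]exprMn.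
have <- : (P N)`_k = a N k by rewrite coef_poly ltnS kN.
apply: (@poly_coef_bound (P N) N c (r / 2)) => //.
- exact: size_poly.
- by rewrite divr_gt0.
- by move=> t /hB.
Qed.

End Interpolation.

(** * Norms of convergent series *)

Lemma nc_ord2 (K : fieldType) (f : fps K) : f 0%N 0%N = 0 -> ord 2 f.
Proof. by move=> f0 [|i] [|j] // ; lia. Qed.

Section Norms.
Variable R : realType.
Local Notation C := R[i]%C.
Implicit Types (f g : fps C) (p q M A B : R).
Notation normc := ComplexField.Normc.normc.
Notation nc := no_constant_term.
Notation x := (fx C).
Notation y := (fy C).

Lemma normc_ge0 (z : C) : 0 <= normc z.
Proof. by case: z => a b; rewrite sqrtr_ge0. Qed.

Lemma normc_sum I (s : seq I) (P : pred I) (F : I -> C) :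
  normc (\sum_(i <- s | P i) F i) <= \sum_(i <- s | P i) normc (F i).
Proof.
elim/big_rec2: _ => [|i a b _ h]; first by rewrite ComplexField.Normc.normc0.
by apply: le_trans (le_normcD _ _) _; rewrite lerD2l.
Qed.

Lemma normc_nat n : normc (n%:R : C) = n%:R.
Proof. by rewrite normcMn ComplexField.Normc.normc1. Qed.

(** Partial sums over squares of the l^1 norm with radii p and q. This norm is submultiplicative and
    is compatible with substitution. *)
Definition psn p q n f : R :=
  \sum_(i < n) \sum_(j < n) normc (f i j) * (p ^+ i * q ^+ j).

Definition bnd p q M f := forall n, psn p q n f <= M.

Section Radii.
Variables p q : R.
Hypotheses (p0 : 0 < p) (q0 : 0 < q).
Notation bnd := (bnd p q).

Let w_ge0 i j : 0 <= p ^+ i * q ^+ j.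
Proof. by rewrite mulr_ge0 // exprn_ge0 // ltW. Qed.

Let t_ge0 f i j : 0 <= normc (f i j) * (p ^+ i * q ^+ j).
Proof. by rewrite mulr_ge0 ?normc_ge0. Qed.

Lemma psn_ge0 n f : 0 <= psn p q n f.
Proof. by apply: sumr_ge0 => i _; apply: sumr_ge0. Qed.

Lemma bnd_ge0 M f : bnd M f -> 0 <= M.
Proof. by move=> h; apply: le_trans (h 0%N); apply: psn_ge0. Qed.

Lemma bndW M A f : M <= A -> bnd M f -> bnd A f.
Proof. by move=> h b n; apply: le_trans (b n) h. Qed.

Lemma bnd_coef M f i j : bnd M f -> normc (f i j) * (p ^+ i * q ^+ j) <= M.
Proof.
move=> h; apply: le_trans (h (maxn i j).+1).
have hi : (i < (maxn i j).+1)%N by lia.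
have hj : (j < (maxn i j).+1)%N by lia.
rewrite /psn (bigD1 (Ordinal hi)) //= (bigD1 (Ordinal hj)) //= -addrA lerDl.
by rewrite addr_ge0 // sumr_ge0 // => k _; rewrite sumr_ge0.
Qed.

Lemma bnd_dom M f g : (forall i j, normc (g i j) <= normc (f i j)) ->
  bnd M f -> bnd M g.
Proof.
move=> h b n; apply: le_trans (b n); apply: ler_sum => i _; apply: ler_sum => j _.
by rewrite ler_wpM2r.
Qed.

Lemma bnd0 : bnd 0 0.
Proof.
move=> n; rewrite /psn big1 // => i _; rewrite big1 // => j _.
by rewrite fps0E ComplexField.Normc.normc0 mul0r.
Qed.

Lemma bndD M A f g : bnd M f -> bnd A g -> bnd (M + A) (f + g).
Proof.
move=> hf hg n; apply: le_trans (lerD (hf n) (hg n)).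
rewrite /psn -big_split; apply: ler_sum => i _; rewrite -big_split.
apply: ler_sum => j _ /=; rewrite -mulrDl ler_wpM2r // fpsD.
exact: le_normcD.
Qed.

Lemma bndN M f : bnd M f -> bnd M (- f).
Proof. by apply: bnd_dom => i j; rewrite fpsN normcN. Qed.

Lemma bndB M A f g : bnd M f -> bnd A g -> bnd (M + A) (f - g).
Proof. by move=> hf hg; apply: bndD => //; apply: bndN. Qed.

Lemma bndZ M (a : C) f : bnd M f -> bnd (normc a * M) (a *: f).
Proof.
move=> hf n; have h := ler_wpM2l (normc_ge0 a) (hf n); apply: le_trans h.
rewrite /psn mulr_sumr; apply: ler_sum => i _; rewrite mulr_sumr.
by apply: ler_sum => j _; rewrite fpsZ ComplexField.Normc.normcM -mulrA.
Qed.

Lemma bnd_sum I (s : seq I) (P : pred I) (F : I -> fps C) (M : I -> R) :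
  (forall i, P i -> bnd (M i) (F i)) ->
  bnd (\sum_(i <- s | P i) M i) (\sum_(i <- s | P i) F i).
Proof.
by move=> h; elim/big_rec2: _ => [|i a b Pi hh]; [exact: bnd0 | exact: bndD (h i Pi) hh].
Qed.

Lemma tri_sum_le n (F : nat -> nat -> R) : (forall a b, 0 <= F a b) ->
  \sum_(k < n) \sum_(a < k.+1) F a (k - a)%N <= \sum_(a < n) \sum_(b < n) F a b.
Proof.
by move=> F0; rewrite square_sum lerDl sumr_ge0 // => a _; rewrite sumr_ge0.
Qed.

Lemma psnM n f g : psn p q n (f * g) <= psn p q n f * psn p q n g.
Proof.
pose F k l := normc (f k l) * (p ^+ k * q ^+ l).
pose G k l := normc (g k l) * (p ^+ k * q ^+ l).
have F0 k l : 0 <= F k l by apply: t_ge0.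
have G0 k l : 0 <= G k l by apply: t_ge0.
apply: (@le_trans _ _ (\sum_(i < n) \sum_(k < i.+1) \sum_(j < n) \sum_(l < j.+1)
   F k l * G (i - k)%N (j - l)%N)).
  apply: ler_sum => i _; rewrite exchange_big; apply: ler_sum => j _ /=.
  rewrite fpsM; apply: le_trans (ler_wpM2r (w_ge0 _ _) (normc_sum _ _ _)) _.
  rewrite mulr_suml; apply: ler_sum => k _.
  apply: le_trans (ler_wpM2r (w_ge0 _ _) (normc_sum _ _ _)) _.
  rewrite mulr_suml; apply: ler_sum => l _.
  rewrite ComplexField.Normc.normcM /F /G.
  have ki : (k <= i)%N by rewrite -ltnS.
  have lj : (l <= j)%N by rewrite -ltnS.
  have -> : p ^+ i = p ^+ k * p ^+ (i - k) by rewrite -exprD subnKC.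
  have -> : q ^+ j = q ^+ l * q ^+ (j - l) by rewrite -exprD subnKC.
  by rewrite le_eqVlt; apply/orP; left; apply/eqP; ring.
apply: (@le_trans _ _ (\sum_(k < n) \sum_(m < n) \sum_(j < n) \sum_(l < j.+1)
   F k l * G m (j - l)%N)).
  apply: (@tri_sum_le n (fun k m => \sum_(j < n) \sum_(l < j.+1) F k l * G m (j - l)%N)).
  by move=> k m; do 2!(apply: sumr_ge0 => ? _); rewrite mulr_ge0.
rewrite /psn mulr_suml; apply: ler_sum => k _; rewrite mulr_sumr.
apply: ler_sum => m _; rewrite mulr_suml.
rewrite [leRHS](eq_bigr (fun l : 'I_n => \sum_(r < n) F k l * G m r)).
  apply: (@tri_sum_le n (fun l r => F k l * G m r)) => l r.
  by rewrite mulr_ge0.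
by move=> l _; rewrite mulr_sumr.
Qed.

Lemma bndM M A f g : bnd M f -> bnd A g -> bnd (M * A) (f * g).
Proof.
move=> hf hg n; apply: le_trans (psnM _ _ _) _.
by apply: ler_pM => //; apply: psn_ge0.
Qed.

Lemma bnd_mono i j : bnd (p ^+ i * q ^+ j) (mono i j).
Proof.
move=> n; rewrite /psn.
have e (k l : nat) : normc (mono i j k l : C) * (p ^+ k * q ^+ l) =
    (k == i)%:R * p ^+ k * ((l == j)%:R * q ^+ l).
  by rewrite /mono normc_nat -mulnb natrM; ring.
under eq_bigr => k _ do under eq_bigr => l _ do rewrite e.
under eq_bigr => k _ do rewrite -mulr_sumr.
rewrite -mulr_suml.
have h (t : R) m a : 0 < t -> 0 <= \sum_(k < m) ((k == a :> nat)%:R * t ^+ k) <= t ^+ a.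
  move=> t0; apply/andP; split.
    by apply: sumr_ge0 => k _; rewrite mulr_ge0 ?ler0n // exprn_ge0 // ltW.
  case: (ltnP a m) => am.
    rewrite (bigD1 (Ordinal am)) //= eqxx mul1r big1 ?addr0 // => k ka.
    by rewrite (_ : (k == a :> nat) = false) ?mul0r //; apply: negbTE.
  rewrite big1 ?exprn_ge0 ?(ltW t0) // => k _.
  by rewrite (_ : (k == a :> nat) = false) ?mul0r //; have := ltn_ord k; lia.
have /andP[a1 a2] := h p n i p0; have /andP[b1 b2] := h q n j q0.
exact: ler_pM.
Qed.

Lemma bnd1 : bnd 1 1.
Proof. by have := bnd_mono 0 0; rewrite !expr0 mulr1 mono00. Qed.

Lemma bnd_x : bnd p x.
Proof. by have := bnd_mono 1 0; rewrite expr0 mulr1 expr1 fxE. Qed.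

Lemma bnd_y : bnd q y.
Proof. by have := bnd_mono 0 1; rewrite expr0 mul1r expr1 fyE. Qed.

Lemma bndX M f n : bnd M f -> bnd (M ^+ n) (f ^+ n).
Proof.
move=> h; elim: n => [|n IH]; first by rewrite !expr0; exact: bnd1.
by rewrite !exprS; apply: bndM.
Qed.

(** A uniform norm bound survives formal limits, since each partial sum involves finitely many
    coefficients. Indices below n have weight below 5 n. *)
Lemma bnd_lim M f : (forall m, exists2 g, bnd M g & ord m (f - g)) -> bnd M f.
Proof.
move=> h n; have [g hg o] := h (5 * n)%N; apply: le_trans (hg n).
rewrite le_eqVlt; apply/orP; left; apply/eqP.
apply: eq_bigr => i _; apply: eq_bigr => j _; congr (normc _ * _).
apply/eqP; rewrite -subr_eq0 -fpsB o //.
by have := ltn_ord i; have := ltn_ord j; lia.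
Qed.

End Radii.

Lemma bnd_comp p q A B M g s : 0 < p -> 0 < q -> nc s ->
  bnd p q A s.1 -> bnd p q B s.2 -> bnd A B M g -> bnd p q M (fcomp g s).
Proof.
move=> p0 q0 s0 h1 h2 hg; apply: (bnd_lim p0 q0) => m.
have e : fcomp (trunc m g) s = \sum_(k < m) \sum_(l < m) g k l *: (s.1 ^+ k * s.2 ^+ l).
  rewrite /trunc (lin_sum (lin_fcomp s)); apply: eq_bigr => k _.
  rewrite (lin_sum (lin_fcomp s)); apply: eq_bigr => l _.
  by rewrite fcompZ fcomp_mono.
exists (fcomp (trunc m g) s); last first.
  by rewrite -fcompB; apply: ordw_deg => //; apply: fcomp_deg => //; apply: trunc_deg.
rewrite e; apply: bndW (hg m) _; apply: bnd_sum => // k _; apply: bnd_sum => // l _.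
by apply: bndZ => //; apply: bndM => //; apply: bndX.
Qed.

Lemma bnd_radii p q A B M f : 0 < p -> 0 < q -> p <= A -> q <= B ->
  bnd A B M f -> bnd p q M f.
Proof.
move=> p0 q0 pA qB h n; apply: le_trans (h n); apply: ler_sum => i _.
apply: ler_sum => j _; rewrite ler_wpM2l ?normc_ge0 //.
by apply: ler_pM; rewrite ?exprn_ge0 ?(ltW p0) ?(ltW q0) // lerXn2r ?nnegrE // ltW //;
   [apply: lt_le_trans pA | apply: lt_le_trans qB].
Qed.

(** A weighted Schwarz lemma: on radii shrunk by t^2 and t^3, order v gains t^v. *)
Lemma bnd_scale p q M (t : R) v f : 0 < p -> 0 < q -> 0 < t -> t <= 1 ->
  ord v f -> bnd p q M f -> bnd (t ^+ 2 * p) (t ^+ 3 * q) (t ^+ v * M) f.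
Proof.
move=> p0 q0 t0 t1 fv hf n; have tv : 0 <= t ^+ v by rewrite exprn_ge0 // ltW.
apply: le_trans (ler_wpM2l tv (hf n)); rewrite /psn mulr_sumr; apply: ler_sum => i _.
rewrite mulr_sumr; apply: ler_sum => j _.
have [h|h] := ltnP (2 * i + 3 * j) v.
  by rewrite fv // ComplexField.Normc.normc0 !mul0r mulr0.
have -> : (t ^+ 2 * p) ^+ i * (t ^+ 3 * q) ^+ j = t ^+ (2 * i + 3 * j) * (p ^+ i * q ^+ j).
  by rewrite (exprMn i (t ^+ 2)) (exprMn j (t ^+ 3)) exprD !exprM; ring.
rewrite mulrCA ler_wpM2r ?mulr_ge0 ?normc_ge0 ?exprn_ge0 ?(ltW p0) ?(ltW q0) //.
by rewrite -(subnKC h) exprD ler_piMr // exprn_ile1 // ltW.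
Qed.

Lemma bnd_fdx p q M f : 0 < p -> 0 < q -> bnd p q M f ->
  bnd (p / 2) q (M / p) (fdx f).
Proof.
move=> p0 q0 hf n; rewrite ler_pdivlMr //; apply: le_trans (hf n.+1).
rewrite /psn mulr_suml big_ord_recl ler_wpDl ?sumr_ge0 // => [j _|].
  by rewrite !mulr_ge0 ?normc_ge0 ?exprn_ge0 // ltW.
apply: ler_sum => i _; rewrite lift0 mulr_suml big_ord_recr ler_wpDr /= ?mulr_ge0 ?normc_ge0 ?exprn_ge0 ?(ltW p0) ?(ltW q0) //.
apply: ler_sum => j _; rewrite /fdx ComplexField.Normc.normcM normc_nat.
have h : i.+1%:R <= 2 ^+ i :> R.
  by rewrite -natrX ler_nat; elim: (val i) => // k IH; rewrite expnS mul2n -addnn; lia.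
have -> : i.+1%:R * normc (f i.+1 j) * ((p / 2) ^+ i * q ^+ j) * p =
   (i.+1%:R / 2 ^+ i) * (normc (f i.+1 j) * (p ^+ i.+1 * q ^+ j)).
  by rewrite exprS expr_div_n; field; rewrite expf_neq0 // (pnatr_eq0 R 2).
rewrite ler_piMl ?mulr_ge0 ?normc_ge0 ?exprn_ge0 ?(ltW p0) ?(ltW q0) //.
by rewrite ler_pdivrMr ?mul1r // exprn_gt0.
Qed.

Lemma bnd_intx p q M f : 0 < p -> 0 < q -> bnd p q M f -> bnd p q (p * M) (intx f).
Proof.
move=> p0 q0 hf [|n].
  by rewrite /psn big_ord0 mulr_ge0 ?(ltW p0) //; apply: bnd_ge0 hf.
apply: le_trans (ler_wpM2l (ltW p0) (hf n.+1)).
rewrite /psn big_ord_recl big1 => [|j _]; last by rewrite ComplexField.Normc.normc0 mul0r.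
rewrite add0r mulr_sumr big_ord_recr ler_wpDr //.
  by rewrite mulr_ge0 ?(ltW p0) // sumr_ge0 // => j _; rewrite !mulr_ge0 ?normc_ge0 ?exprn_ge0 // ltW.
apply: ler_sum => i _; rewrite mulr_sumr; apply: ler_sum => j _; rewrite lift0 /=.
rewrite ComplexField.Normc.normcM ComplexField.Normc.normcV normc_nat.
rewrite exprS -!mulrA [leRHS]mulrCA ler_wpM2l ?normc_ge0 //.
by rewrite ler_piMl ?mulr_ge0 ?exprn_ge0 ?(ltW p0) ?(ltW q0) // invf_le1 ?ler1n ?ltr0n.
Qed.

Lemma bnd_divy p q M f : 0 < p -> 0 < q -> bnd p q M f -> bnd p q (M / q) (divy f).
Proof.
move=> p0 q0 hf n; rewrite ler_pdivlMr //; apply: le_trans (hf n.+1).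
rewrite /psn mulr_suml big_ord_recr ler_wpDr //=.
  by rewrite sumr_ge0 // => j _; rewrite !mulr_ge0 ?normc_ge0 ?exprn_ge0 // ltW.
apply: ler_sum => i _; rewrite mulr_suml big_ord_recl ler_wpDl //.
  by rewrite !mulr_ge0 ?normc_ge0 ?exprn_ge0 // ltW.
apply: ler_sum => j _; rewrite lift0 /divy exprSr.
by rewrite le_eqVlt; apply/orP; left; apply/eqP; ring.
Qed.

(** A formal contraction preserving a norm ball has its fixed point in that ball, by uniqueness and
    [bnd_lim]. The convergence proofs below need no metric contraction. *)
Lemma fixpoint_bnd p q A B m s0 T s : 0 < p -> 0 < q ->
  (forall t, cong m t s0 -> cong m (T t) s0) ->
  (forall n t u, (m <= n)%N -> cong m t s0 -> cong m u s0 ->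
     cong n t u -> cong n.+1 (T t) (T u)) ->
  cong m s s0 -> T s = s -> bnd p q A s0.1 -> bnd p q B s0.2 ->
  (forall t, cong m t s0 -> bnd p q A t.1 -> bnd p q B t.2 ->
     bnd p q A (T t).1 /\ bnd p q B (T t).2) ->
  bnd p q A s.1 /\ bnd p q B s.2.
Proof.
move=> p0 q0 stab contr ss0 Ts hA hB hT.
have [s' [c' T' lim]] := contraction_fixpoint stab contr.
have e : s = s' by exact: (contraction_unique contr ss0 c' Ts T').
have it n : cong m (iter n T s0) s0 /\ bnd p q A (iter n T s0).1 /\ bnd p q B (iter n T s0).2.
  elim: n => [|n [c [a b]]]; first by split=> //; apply: cong_refl.
  by split; [apply: stab | apply: hT].
split; apply: (bnd_lim p0 q0) => n; have [_ [a b]] := it n; have [l1 l2] := lim n; rewrite e.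
- by exists (iter n T s0).1 => //; apply: ordwW l1; lia.
- by exists (iter n T s0).2 => //; apply: ordwW l2; lia.
Qed.

Definition conv f := exists2 r : R, 0 < r & exists M, bnd r r M f.

Lemma bnd_conv p q M f : 0 < p -> 0 < q -> bnd p q M f -> conv f.
Proof.
move=> p0 q0 hf; have m0 : 0 < Num.min p q by rewrite lt_min p0.
exists (Num.min p q) => //; exists M; apply: bnd_radii hf => //.
- by rewrite ge_min lexx.
- by rewrite ge_min lexx orbT.
Qed.

(* One constant controls both the size and the range of validity. *)
Lemma conv_small v f : conv f -> ord v f -> exists2 C : R, 1 <= C &
  forall t : R, 0 < t -> C * t <= 1 -> bnd (t ^+ 2) (t ^+ 3) (C * t ^+ v) f.
Proof.
move=> [r r0 [M hM]] fv; pose r1 := Num.min r 1.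
have r10 : 0 < r1 by rewrite lt_min r0 ltr01.
have r11 : r1 <= 1 by rewrite ge_min lexx orbT.
have hr : bnd r1 r1 M f by apply: bnd_radii hM => //; rewrite ge_min lexx.
have M0 : 0 <= M by apply: bnd_ge0 hM.
pose C := r1^-1 + M / r1 ^+ v.
have D0 : 0 <= M / r1 ^+ v by rewrite divr_ge0 // exprn_ge0 // ltW.
have i1 : 1 <= r1^-1 by rewrite invf_ge1.
exists C => [|t t0 Ct]; first by apply: le_trans i1 _; rewrite lerDl.
have tr : t / r1 <= 1.
  by apply: le_trans Ct; rewrite mulrC ler_wpM2r ?(ltW t0) // lerDl.
have u0 : 0 < t / r1 by rewrite divr_gt0.
have h := bnd_scale r10 r10 u0 tr fv hr.
apply: (@bndW _ _ ((t / r1) ^+ v * M)).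
  rewrite expr_div_n mulrC mulrA mulrAC.
  by rewrite ler_wpM2r ?exprn_ge0 ?(ltW t0) // lerDr; lra.
have e2 : (t / r1) ^+ 2 * r1 = t ^+ 2 / r1 by field; rewrite lt0r_neq0.
have e3 : (t / r1) ^+ 3 * r1 = t ^+ 3 / r1 ^+ 2 by field; rewrite lt0r_neq0.
apply: bnd_radii h; rewrite ?exprn_gt0 //.
- by rewrite e2 ler_peMr ?exprn_ge0 ?(ltW t0).
- by rewrite e3 ler_peMr ?exprn_ge0 ?(ltW t0) // invf_ge1 ?exprn_gt0 // exprn_ile1 ?(ltW r10).
Qed.

Lemma conv2 f g : conv f -> conv g -> exists2 r, 0 < r & exists M A,
  bnd r r M f /\ bnd r r A g.
Proof.
move=> [r r0 [M hM]] [t t0 [A hA]]; have m0 : 0 < Num.min r t by rewrite lt_min r0.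
exists (Num.min r t) => //; exists M, A; split.
- by apply: bnd_radii hM; rewrite // ge_min lexx.
- by apply: bnd_radii hA; rewrite // ge_min lexx orbT.
Qed.

Lemma convD f g : conv f -> conv g -> conv (f + g).
Proof.
by move=> /conv2 h /h[r r0 [M [A [hM hA]]]]; exists r => //; exists (M + A); apply: bndD.
Qed.

Lemma convM f g : conv f -> conv g -> conv (f * g).
Proof.
by move=> /conv2 h /h[r r0 [M [A [hM hA]]]]; exists r => //; exists (M * A); apply: bndM.
Qed.

Lemma convZ a f : conv f -> conv (a *: f).
Proof. by move=> [r r0 [M hM]]; exists r => //; exists (normc a * M); apply: bndZ. Qed.

Lemma convN f : conv f -> conv (- f).
Proof. by move=> [r r0 [M hM]]; exists r => //; exists M; apply: bndN. Qed.

Lemma convB f g : conv f -> conv g -> conv (f - g).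
Proof. by move=> hf hg; apply: convD => //; apply: convN. Qed.

Lemma conv_x : conv x.
Proof. by exists 1 => //; exists 1; apply: bnd_x. Qed.

Lemma conv_y : conv y.
Proof. by exists 1 => //; exists 1; apply: bnd_y. Qed.

Lemma conv1 : conv 1.
Proof. by exists 1 => //; exists 1; apply: bnd1. Qed.

Lemma convX f n : conv f -> conv (f ^+ n).
Proof.
by move=> hf; elim: n => [|n IH]; rewrite ?expr0 ?exprS; [exact: conv1 | exact: convM].
Qed.

Lemma conv_fdx f : conv f -> conv (fdx f).
Proof.
move=> [r r0 [M hM]]; apply: (@bnd_conv (r / 2) r (M / r)) => //.
  by rewrite divr_gt0.
exact: bnd_fdx.
Qed.

Lemma conv_divy f : conv f -> conv (divy f).
Proof. by move=> [r r0 [M hM]]; exists r => //; exists (M / r); apply: bnd_divy. Qed.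

Lemma conv_comp g s : nc s -> conv g -> conv s.1 -> conv s.2 -> conv (fcomp g s).
Proof.
move=> s0 [r r0 [M hM]] c1 c2.
have [C1 C11 h1] := conv_small c1 (nc_ord2 s0.1).
have [C2 C21 h2] := conv_small c2 (nc_ord2 s0.2).
pose t := Num.min r 1 / (C1 + C2).
have rm0 : 0 < Num.min r 1 by rewrite lt_min r0 ltr01.
have C0 : 0 < C1 + C2 by apply: addr_gt0; apply: lt_le_trans ltr01 _.
have t0 : 0 < t by rewrite divr_gt0.
have Ct : (C1 + C2) * t = Num.min r 1 by rewrite /t mulrC divfK // lt0r_neq0.
have hm1 : Num.min r 1 <= 1 by rewrite ge_min lexx orbT.
have hmr : Num.min r 1 <= r by rewrite ge_min lexx.
have a1 : C1 * t <= Num.min r 1 by rewrite -Ct ler_wpM2r ?(ltW t0) // lerDl; lra.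
have a2 : C2 * t <= Num.min r 1 by rewrite -Ct ler_wpM2r ?(ltW t0) // lerDr; lra.
have t1 : t <= 1 by apply: le_trans (le_trans a1 hm1); rewrite ler_peMl // ltW.
apply: (@bnd_conv (t ^+ 2) (t ^+ 3) M); rewrite ?exprn_gt0 //.
have b1 : C1 * t ^+ 2 <= r.
  apply: le_trans hmr; apply: le_trans a1; rewrite expr2 mulrA ler_piMr // mulr_ge0 ?(ltW t0) //; lra.
have b2 : C2 * t ^+ 2 <= r.
  apply: le_trans hmr; apply: le_trans a2; rewrite expr2 mulrA ler_piMr // mulr_ge0 ?(ltW t0) //; lra.
apply: bnd_comp hM; rewrite ?exprn_gt0 //.
- by apply: bndW b1 _; apply: h1 => //; apply: le_trans hm1.
- by apply: bndW b2 _; apply: h2 => //; apply: le_trans hm1.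
Qed.

End Norms.

(** * Convergence of the maps of the family *)

Section Convergence.
Variable R : realType.
Local Notation C := R[i]%C.
Implicit Types (f g : fps C) (p q M A B : R).
Notation normc := ComplexField.Normc.normc.
Notation nc := no_constant_term.
Notation x := (fx C).
Notation y := (fy C).
Local Open Scope classical_set_scope.
Local Open Scope ring_scope.

Lemma psn_fsum (r : R) n f : (psn r r n f)%:E =
  (\sum_(p \in `I_n `*` `I_n) (normc (f p.1 p.2) * r ^+ (p.1 + p.2))%:E)%E.
Proof.
rewrite -(@pair_fsbig _ _ _ _ _ _ _ (fun i j => (normc (f i j) * r ^+ (i + j))%:E)) //.
rewrite -fsbig_ord /psn -sumEFin; apply: eq_bigr => i _.
by rewrite -fsbig_ord -sumEFin; apply: eq_bigr => j _; rewrite exprD.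
Qed.

Lemma finite_square (X : set (nat * nat)) : finite_set X ->
  exists n, X `<=` `I_n `*` `I_n.
Proof.
move=> /finite_fsetP[F ->]; exists (\max_(p <- finmap.enum_fset F) (p.1 + p.2).+1)%N => p /= pF.
have h := @leq_bigmax_seq _ (finmap.enum_fset F) xpredT (fun p : nat * nat => (p.1 + p.2).+1) p pF isT.
by split=> /=; move: h => /=; lia.
Qed.

(** The terms are nonnegative and every finite set of indices lies in a square. *)
Lemma convergent_conv f : convergent f <-> conv f.
Proof.
have t0 (r : R) : 0 < r -> forall p : nat * nat,
    (0 <= (normc (f p.1 p.2) * r ^+ (p.1 + p.2))%:E)%E.
  by move=> r0 p; rewrite lee_fin mulr_ge0 ?normc_ge0 ?exprn_ge0 // ltW.
split=> -[r r0].
  rewrite summableE; set S := esum _ _ => Sfin; exists r => //; exists (fine S) => n.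
  rewrite -lee_fin fineK // psn_fsum; apply: esum_ge.
  exists (`I_n `*` `I_n); first by split=> //; apply: finite_setX.
  by apply: lee_fsum => // [|p _]; [apply: finite_setX | rewrite gee0_abs // t0].
move=> [M hM]; exists r => //; rewrite /summable.
apply: (@le_lt_trans _ _ M%:E); last exact: ltry.
apply: ge_ereal_sup => _ [X [finX _] <-].
have [n Xn] := finite_square finX.
apply: (@le_trans _ _ (\sum_(p \in `I_n `*` `I_n) (normc (f p.1 p.2) * r ^+ (p.1 + p.2))%:E)%E).
  have -> : (\sum_(p \in X) `|(normc (f p.1 p.2) * r ^+ (p.1 + p.2))%:E| =
    \sum_(p \in X) (normc (f p.1 p.2) * r ^+ (p.1 + p.2))%:E)%E.
    by apply: eq_fsbigr => p _; rewrite gee0_abs // t0.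
  apply: lee_fsum_nneg_subset => //; first exact: finite_setX.
    by move=> p; rewrite !inE; apply: Xn.
  by move=> p _; apply: t0.
by rewrite -psn_fsum lee_fin.
Qed.

Lemma hs_sum_affine (E : nat -> fps C -> fps C) c g : hasse_schmidt E ->
  (forall l, E l.+2 g = 0) -> hs_sum E c g = g + c *: E 1%N g.
Proof.
move=> hE h; apply/eqP; rewrite -subr_eq0; apply/eqP.
apply: (@ordw_eq0 _ 2 3) => // n.
have := hs_sum_trunc c hE n.+2 g; rewrite 2!big_ord_recl big1 => [|i _]; last first.
  by rewrite !lift0 h scaler0.
have [_ -> _ _ _] := hE.
rewrite expr0 scale1r addr0 => hh; have -> : c = c ^+ 1 by [].
by apply: ordwW hh; lia.
Qed.

(** Along the flow x' = y = x^2 - u with u constant, so the Taylor coefficients in time obey the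
    quadratic recurrence of a Riccati equation. Radii 1/2 and 1/4 make the bound exact for x and y
    and stable under the recurrence. *)
Lemma base_exp_bound l :
  bnd (1/2) (1/4) ((1/2) ^+ l.+1) (divpow (vf_apply (base_field C)) 1 l x).
Proof.
set E := divpow _ _; have hE : hasse_schmidt E by apply: exp_hs; apply: base_raises.
have [_ E0 _ EM _] := hE.
have p0 : 0 < 1/2 :> R by lra.
have q0 : 0 < 1/4 :> R by lra.
have X0u : vf_apply (base_field C) (u_leaf C) = 0.
  by rewrite base_fieldE leaf_u mulr0.
have Es k : E k.+2 x = (k.+2%:R)^-1 *: \sum_(i < k.+2) E i x * E (k.+1 - i)%N x.
  rewrite -EM.
  have -> : x * x = vf_apply (base_field C) x + u_leaf C.
    by rewrite vfx /u_leaf addrC subrK expr2.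
  have [Elin _ _ _ _] := hE; rewrite (Elin _).1.
  rewrite /E !divpow_vfE.
  have -> : iter k.+1 (vf_apply (base_field C)) (u_leaf C) = 0.
    by rewrite iterSr X0u lin0 //; apply: lin_iter; apply: lin_vf.
  rewrite scaler0 addr0 scalerA -invfM -natrM -factS -iterSr //.
elim/ltn_ind: l => -[|[|k]] IH.
- by rewrite E0 expr1; apply: bnd_x.
- rewrite /E divpow_vfE /= vfx invr1 scale1r.
  by rewrite (_ : (1/2) ^+ 2 = 1/4); [apply: bnd_y | lra].
rewrite Es; apply: (@bndW _ _ _ (normc (k.+2%:R^-1 : C) * \sum_(i < k.+2) (1/2) ^+ k.+3)).
  rewrite ComplexField.Normc.normcV normc_nat sumr_const card_ord -(mulr_natl (_ ^+ _)) mulrA.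
  by rewrite mulVf ?mul1r // pnatr_eq0.
apply: bndZ => //; apply: bnd_sum => // i _.
have -> : (1/2) ^+ k.+3 = (1/2) ^+ i.+1 * (1/2) ^+ (k.+1 - i).+1 :> R.
  by rewrite -exprD; congr (_ ^+ _); have := ltn_ord i; lia.
by apply: bndM => //; apply: IH; have := ltn_ord i; lia.
Qed.

Lemma base_exp_conv :
  conv (expvf (base_field C) x) /\ conv (expvf (base_field C) y).
Proof.
have X1 := base_raises C.
have p0 : 0 < 1/2 :> R by lra.
have q0 : 0 < 1/4 :> R by lra.
have c1 : conv (expvf (base_field C) x).
  apply: (@bnd_conv _ (1/2) (1/4) 1) => //; apply: (bnd_lim p0 q0) => m.
  exists (\sum_(l < m) (l`!%:R)^-1 *: iter l (vf_apply (base_field C)) x); last first.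
    exact: expvf_trunc.
  apply: (@bndW _ _ _ (\sum_(l < m) (1/2) ^+ l.+1)); last first.
    apply: bnd_sum => // l _; rewrite -divpow_vfE; exact: base_exp_bound.
  have -> : \sum_(l < m) (1/2) ^+ l.+1 = 1 - (1/2) ^+ m :> R.
    elim: m => [|m IH]; first by rewrite big_ord0 expr0 subrr.
    by rewrite big_ord_recr /= IH !exprS; lra.
  by rewrite gerBl exprn_ge0 // ltW.
split; first exact: c1.
(* By invariance of u = x^2 - y, the second component is the square of the first minus u. *)
have := expvf_u C; rewrite {1}/u_leaf (linB (lin_expvf X1)) expr2 (expvfM _ _ X1) => h.
have -> : expvf (base_field C) y = expvf (base_field C) x * expvf (base_field C) x - u_leaf C.
  by rewrite -h opprB addrC subrK.
by apply: convB; [apply: convM | apply: convB; [apply: convX; exact: conv_x | exact: conv_y]].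
Qed.

Lemma conv_u : conv (u_leaf C).
Proof. by apply: convB; [apply: convX; exact: conv_x | exact: conv_y]. Qed.

Lemma Ed_conv d : conv (hs_sum (@Ed C) d x) /\ conv (hs_sum (@Ed C) d y).
Proof.
have c1 : conv (hs_sum (@Ed C) d x).
  rewrite hs_sum_affine; [|exact: Ed_hs|].
    apply: convD; first exact: conv_x.
    apply: convZ; rewrite /Ed /divpow /= vfx expr1 mulr1.
    by apply: convZ; apply: convX; apply: conv_y.
  move=> l; rewrite /Ed /divpow !iterSr vfx vf1 lin0 ?mulr0 ?scaler0 //.
  by apply: lin_iter; apply: lin_vf.
split; first exact: c1.
have hu : hs_sum (@Ed C) d (u_leaf C) = u_leaf C.
  apply: hs_sum_fix; first exact: Ed_hs.
  move=> l; rewrite /Ed /divpow iterSr leaf_u lin0 ?mulr0 ?scaler0 //.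
  by apply: lin_iter; apply: lin_vf.
move: hu; rewrite {1}/u_leaf (linB (lin_hs_sum _ (Ed_hs C))) expr2 hs_sumM; last exact: Ed_hs.
move=> h.
have -> : hs_sum (@Ed C) d y = hs_sum (@Ed C) d x * hs_sum (@Ed C) d x - u_leaf C.
  by rewrite -h opprB addrC subrK.
by apply: convB; [apply: convM | exact: conv_u].
Qed.

Lemma Ec_conv c : conv (hs_sum (@Ec C) c x) /\ conv (hs_sum (@Ec C) c y).
Proof.
have fdyx : fdy x = 0 by rewrite fdy_vf vfx.
have fdyy : fdy y = 1 by rewrite fdy_vf vfy.
have fdy1 : fdy (1 : fps C) = 0 by rewrite fdy_vf vf1.
split.
  rewrite hs_sum_fix; [exact: conv_x | exact: Ec_hs |] => l.
  rewrite /Ec /divpow iterSr fdyx lin0 ?mulr0 ?scaler0 //.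
  by apply: lin_iter; apply: lin_fdy.
rewrite hs_sum_affine; [|exact: Ec_hs|] => [|l].
  apply: convD; first exact: conv_y.
  apply: convZ; rewrite /Ec /divpow /= fdyy expr1 mulr1.
  by apply: convZ; apply: convN; apply: convX; apply: conv_y.
rewrite /Ec /divpow !iterSr fdyy fdy1 lin0 ?mulr0 ?scaler0 //.
by apply: lin_iter; apply: lin_fdy.
Qed.

Lemma conv_hs_sum (E : nat -> fps C -> fps C) c g : hasse_schmidt E ->
  conv (hs_sum E c x) -> conv (hs_sum E c y) -> conv g -> conv (hs_sum E c g).
Proof.
move=> hE hx hy hg; rewrite (hs_sum_comp _ hE).
by apply: conv_comp; [exact: nc_hs | exact: hg | exact: hx | exact: hy].
Qed.

Lemma map_cd_convergent c d : convergent_pair (map_cd c d : fps C * fps C).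
Proof.
have [e1 e2] := base_exp_conv; have [d1 d2] := Ed_conv d; have [c1 c2] := Ec_conv c.
have h g : conv (expvf (base_field C) g) -> conv (phi_cd c d g).
  move=> hg; apply: (conv_hs_sum (Ec_hs C) c1 c2).
  exact: (conv_hs_sum (Ed_hs C) d1 d2).
by split; apply/convergent_conv; apply: h; [exact: e1 | exact: e2].
Qed.

End Convergence.

Section ComplexInterpolation.
Variable R : realType.
Local Notation C := R[i]%C.
Notation normc := ComplexField.Normc.normc.

Lemma pointwise_poly_boundC (a : nat -> nat -> C) :
  (forall c : R, exists M, forall N,
     normc (\sum_(k < N.+1) (real_complex R c) ^+ k * a N k) <= M ^+ N.+1) ->
  exists M, forall N k, (k <= N)%N -> normc (a N k) <= M ^+ N.+1.
Proof.
move=> ha.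
have hn (z : C) : [/\ `|complex.Re z| <= normc z, `|complex.Im z| <= normc z &
    normc z <= `|complex.Re z| + `|complex.Im z|].
  case: z => s t /=; rewrite /normc; split.
  - by rewrite -sqrtr_sqr ler_wsqrtr // lerDl sqr_ge0.
  - by rewrite -sqrtr_sqr ler_wsqrtr // lerDr sqr_ge0.
  - rewrite -(ler_pXn2r (_ : (0 < 2)%N)) ?nnegrE ?sqrtr_ge0 ?addr_ge0 //.
    rewrite sqr_sqrtr ?addr_ge0 ?sqr_ge0 // sqrrD !real_normK ?num_real //.
    by rewrite addrAC lerDl mulrn_wge0 // mulr_ge0.
have hre (c : R) N : complex.Re (\sum_(k < N.+1) (real_complex R c) ^+ k * a N k) =
    \sum_(k < N.+1) complex.Re (a N k) * c ^+ k.
  rewrite raddf_sum; apply: eq_bigr => k _ /=; rewrite -rmorphXn.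
  by case: (a N k) => s t /=; rewrite mul0r subr0 mulrC.
have him (c : R) N : complex.Im (\sum_(k < N.+1) (real_complex R c) ^+ k * a N k) =
    \sum_(k < N.+1) complex.Im (a N k) * c ^+ k.
  rewrite raddf_sum; apply: eq_bigr => k _ /=; rewrite -rmorphXn.
  by case: (a N k) => s t /=; rewrite mul0r addr0 mulrC.
have [A hA] : exists M, forall N k, (k <= N)%N -> `|complex.Re (a N k)| <= M ^+ N.+1.
  apply: pointwise_poly_bound => c; have [M hM] := ha c; exists M => N.
  by rewrite -hre; apply: le_trans (hM N); have [] := hn (\sum_(k < N.+1) (real_complex R c) ^+ k * a N k).
have [B hB] : exists M, forall N k, (k <= N)%N -> `|complex.Im (a N k)| <= M ^+ N.+1.
  apply: pointwise_poly_bound => c; have [M hM] := ha c; exists M => N.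
  by rewrite -him; apply: le_trans (hM N); have [] := hn (\sum_(k < N.+1) (real_complex R c) ^+ k * a N k).
exists (`|A| + `|B|) => N k kN; have [_ _ h] := hn (a N k); apply: le_trans h _.
apply: (@le_trans _ _ (`|A| ^+ N.+1 + `|B| ^+ N.+1)).
  by apply: lerD; [apply: le_trans (hA N k kN) _ | apply: le_trans (hB N k kN) _];
     rewrite -normrX ler_norm.
elim: N {k kN} => [|N IH]; first by rewrite !expr1.
rewrite !(exprS _ N.+1) mulrDl; apply: lerD; rewrite ler_wpM2l //.
- by rewrite lerXn2r ?nnegrE ?addr_ge0 // lerDl.
- by rewrite lerXn2r ?nnegrE ?addr_ge0 // lerDr.
Qed.

End ComplexInterpolation.

(** * The formal involution *)

Section Involution.
Variable K : numFieldType.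
Implicit Types (f g h F H I J : fps K).
Notation nc := no_constant_term.
Notation x := (fx K).
Notation y := (fy K).

Let two0 : (2 : K) != 0. Proof. by rewrite (pnatr_eq0 K 2). Qed.

(** The involution is x -> -x I. Both variables are scaled because they will be specialised to c x
    and x, multiples of the coordinate of the axis. *)
Definition flip I : fps K * fps K := (- (x * I), - (y * I)).

Lemma flip_ord I : ord 2 (flip I).1 /\ ord 3 (flip I).2.
Proof.
by split; apply: ordwN; rewrite -[n in ordw _ _ n](addn0); apply: ordwM (ordw0n _);
  [exact: ord_x | exact: ord_y].
Qed.

Lemma nc_flip I : nc (flip I).
Proof. exact: (@weighted_nc K 2 3 isT isT _ (flip_ord I)). Qed.

(* [1 + J] is a root [I] of [I ^+ 2 * h (- x I, - y I) = h] exactly when the first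
   component of [flip_step h] fixes [J]. *)
Definition flip_step h (s : fps K * fps K) : fps K * fps K :=
  (2^-1 *: (h - 1 - (fcomp h (flip (1 + s.1)) - 1) * (1 + s.1) ^+ 2 - s.1 ^+ 2), 0).

Lemma flip_step_fix h J :
  (1 + J) ^+ 2 * fcomp h (flip (1 + J)) = h <-> flip_step h (J, 0) = (J, 0).
Proof.
rewrite /flip_step /=; set F := fcomp _ _; split=> [e|[e]].
  congr pair; rewrite -{1}e.
  have -> : (1 + J) ^+ 2 * F - 1 - (F - 1) * (1 + J) ^+ 2 - J ^+ 2 = 2%:R *: J.
    by rewrite scaler_nat; ring.
  by rewrite scalerA mulVf // scale1r.
have {}e : h - 1 - (F - 1) * (1 + J) ^+ 2 - J ^+ 2 = J *+ 2.
  by rewrite -[in RHS]e -scaler_nat scalerA divff // scale1r.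
have -> : (1 + J) ^+ 2 * F = h - (h - 1 - (F - 1) * (1 + J) ^+ 2 - J ^+ 2) + J *+ 2 by ring.
by rewrite e subrK.
Qed.

Section Step.
Variable h : fps K.
Hypothesis h0 : h 0%N 0%N = 1.

Let h2 : ord 2 (h - 1).
Proof. by apply: nc_ord2; rewrite fpsB fps1E h0 subrr. Qed.

Lemma flip_ord2 I : ord 2 (fcomp h (flip I) - 1).
Proof.
have -> : fcomp h (flip I) - 1 = fcomp (h - 1) (flip I).
  by rewrite fcompB fcomp1 //; apply: nc_flip.
exact: (@fcomp_ordw K 2 3 isT isT 2 _ _ (flip_ord I)).
Qed.

Lemma flip_step_stab s : cong 0 s (0, 0) -> cong 0 (flip_step h s) (0, 0).
Proof.
move=> [s1 _]; rewrite /= subr0 in s1.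
split; rewrite /= !subr0; last exact: ordw_0.
apply: ordwZ; apply: ordwB; first apply: ordwB => //.
  by apply: ordwW (ordwM (flip_ord2 _) (ordw0n _)); lia.
by apply: ordwW (ordwX 2 s1); lia.
Qed.

Lemma flip_step_contr n s t : (0 <= n)%N -> cong 0 s (0, 0) -> cong 0 t (0, 0) ->
  cong n s t -> cong n.+1 (flip_step h s) (flip_step h t).
Proof.
move=> _ [s1 _] [t1 _] [d _]; rewrite /= !subr0 in s1 t1.
split; last by rewrite /= subrr; exact: ordw_0.
rewrite /= -scalerBr; apply: ordwZ.
set F := fcomp _ _; set G := fcomp h (flip (1 + t.1)).
have FG : ord (2 + (2 + n)) (F - G).
  have -> : F - G = fcomp (h - 1) (flip (1 + s.1)) - fcomp (h - 1) (flip (1 + t.1)).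
    by rewrite !fcompB !fcomp1; [rewrite -/F -/G; ring | exact: nc_flip | exact: nc_flip].
  have := @fcomp_lip K 2 3 isT isT (2 + n) 2 (h - 1) _ _ (flip_ord (1 + s.1)) (flip_ord (1 + t.1)).
  apply=> [||//]; rewrite /flip [X in ordw _ _ _ X]/=.
    have -> : - (x * (1 + s.1)) - - (x * (1 + t.1)) = - (x * (s.1 - t.1)) by ring.
    by apply: ordwN; apply: ordwM d; apply: ord_x.
  have -> : - (y * (1 + s.1)) - - (y * (1 + t.1)) = - (y * (s.1 - t.1)) by ring.
  by apply: ordwN; apply: ordwM d; apply: ord_y.
have -> : h - 1 - (F - 1) * (1 + s.1) ^+ 2 - s.1 ^+ 2 -
    (h - 1 - (G - 1) * (1 + t.1) ^+ 2 - t.1 ^+ 2) =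
  - ((F - G) * (1 + s.1) ^+ 2) - (G - 1) * (2%:R + s.1 + t.1) * (s.1 - t.1)
  - (s.1 + t.1) * (s.1 - t.1) by ring.
apply: ordwB; first apply: ordwB.
- by apply: ordwN; apply: ordwW (ordwM FG (ordw0n _)); lia.
- by apply: ordwW (ordwM (ordwM (flip_ord2 _) (ordw0n _)) d); lia.
- by apply: ordwW (ordwM (ordwD s1 t1) d); lia.
Qed.

Lemma flip_exists : exists2 I : fps K, I 0%N 0%N = 1 & I ^+ 2 * fcomp h (flip I) = h.
Proof.
have [s [[s1 s2] sT _]] := @contraction_fixpoint K 0 (0, 0) _ flip_step_stab flip_step_contr.
pose J : fps K := s.1.
have e : flip_step h (J, 0) = (J, 0).
  have e2 : s.2 = 0 by rewrite -sT.
  by move: sT; rewrite [s]surjective_pairing e2.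
exists (1 + J); last exact: (proj2 (flip_step_fix h J) e).
rewrite fpsD fps1E /= addrC; have := s1 0%N 0%N isT; rewrite /= subr0 /J => ->.
by rewrite add0r.
Qed.

End Step.

Definition rhox f : fps K := fun i j => if i is 0%N then f 0%N j else 0.

Lemma nc_0 f : f 0%N 0%N = 0 -> nc (0, f).
Proof. by []. Qed.

Lemma rhox_comp f : rhox f = fcomp f (0, y).
Proof.
move: f; apply: lin_ext => [||||k l].
- by split=> [f g|a f]; apply: fpsP => -[|i] j; rewrite /rhox ?fpsD ?fpsZ ?addr0 ?mulr0.
- by move=> n; exists n => f fn [|i] j ij //; apply: fn.
- exact: lin_fcomp.
- by apply: cont_fcomp; apply: nc_0.
rewrite fcomp_mono //=; case: k => [|k].
  rewrite expr0 mul1r -[y ^+ l]mul1r -(expr0 x) -monoE.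
  by apply: fpsP => -[|i] j; rewrite /rhox /mono.
by rewrite expr0n /= mul0r; apply: fpsP => -[|i] j.
Qed.

Lemma rhoxM f g : rhox (f * g) = rhox f * rhox g.
Proof. by rewrite !rhox_comp fcompM. Qed.

Lemma fcomp_0y F f : f 0%N 0%N = 0 -> fcomp F (0, f) = fcomp (rhox F) (0, f).
Proof.
move=> f0; rewrite rhox_comp fcompA //; congr (fcomp F _).
by rewrite /fmap_comp /= fcomp0 fcomp_fy.
Qed.

Lemma fcomp_flip0 F n : fcomp F (0, - y) 0%N n = (-1) ^+ n * F 0%N n.
Proof.
have n0 : nc (0, - y) by apply: nc_0; rewrite fpsN /fy oppr0.
pose Phi f : fps K := fun i j => if i is 0%N then (-1) ^+ j * f 0%N j else 0.
rewrite -[RHS]/(Phi F 0%N n); congr (_ 0%N n); move: F; apply: lin_ext => [||||k l].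
- exact: lin_fcomp.
- exact: cont_fcomp.
- by split=> [f g|a f]; apply: fpsP => -[|i] j;
    rewrite /Phi ?fpsD ?fpsZ ?addr0 ?mulr0 ?mulrDr // mulrCA.
- by move=> m; exists m => f fn [|i] j ij //; rewrite /Phi fn ?mulr0.
rewrite fcomp_mono //=; case: k => [|k].
  rewrite expr0 mul1r exprNn -[y ^+ l]mul1r -(expr0 x) -monoE.
  apply: fpsP => i j; rewrite -[(-1) ^+ l]/((-1 : fps K) ^+ l).
  have -> : (-1 : fps K) ^+ l = ((-1) ^+ l : K) *: 1.
    by rewrite -[in LHS](scaleN1r 1) exprZn expr1n.
  rewrite -scalerAl mul1r fpsZ /Phi /mono; case: i => [|i] /=; last by rewrite mulr0.
  by case: eqP => [->|]; rewrite ?mulr0.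
by rewrite expr0n /= mul0r; apply: fpsP => -[|i] j; rewrite /Phi /mono ?mulr0.
Qed.

(** The part of degree one in x of the equation is 2 I_1(y) = H_1(y) + H_1(-y): [I] retains the even
    part of H_1. The derivative of [H] in y does not contribute because [H] is constant on x = 0. *)
Lemma flip_first_order H I : rhox H = 1 -> I 0%N 0%N = 1 ->
  I ^+ 2 * fcomp H (flip I) = H ->
  rhox I = 1 /\ forall n, ~~ odd n -> I 1%N n = H 1%N n.
Proof.
move=> H1 I0 e; have nI := nc_flip I.
have n0y : nc (0, y) by apply: nc_0.
have yI0 : (y * rhox I) 0%N 0%N = 0 by rewrite mul_fy.
have rx : rhox x = 0 by rewrite rhox_comp fcomp_fx.
have ry : rhox y = y by rewrite rhox_comp fcomp_fy.
have rN f : rhox (- f) = - rhox f by rewrite !rhox_comp fcompN.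
have rfl F : rhox (fcomp F (flip I)) = fcomp F (0, - (y * rhox I)).
  rewrite rhox_comp fcompA //; congr (fcomp F _).
  by rewrite /fmap_comp /flip /= -!rhox_comp !rN !rhoxM rx ry mul0r oppr0.
have Ix1 : rhox I = 1.
  have := congr1 rhox e; rewrite expr2 !rhoxM rfl H1 fcomp_0y; last by rewrite fpsN yI0 oppr0.
  rewrite H1 fcomp1 ?mulr1; last by apply: nc_0; rewrite fpsN yI0 oppr0.
  move=> e2; apply/eqP; rewrite -subr_eq0; apply/eqP.
  apply: (@fps_cancel _ (rhox I + 1)).
    by rewrite fpsD fps1E /= I0 -(natrD _ 1 1) pnatr_eq0.
  by rewrite mulrDl !mulrBr e2; ring.
split=> // n en.
have := congr1 (fun f => rhox (fdx f)) e.
have rH F : rhox (fcomp F (flip I)) = fcomp F (0, - y) by rewrite rfl Ix1 mulr1.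
have dD f : fdx (- f) = - fdx f by rewrite fdx_vf (linN (lin_vf _)) -fdx_vf.
have Hy : fcomp (fdy H) (0, - y) = 0.
  have ny : (- y) 0%N 0%N = 0 by rewrite fpsN /fy oppr0.
  rewrite fcomp_0y // (_ : rhox (fdy H) = 0) ?fcomp0 //.
  apply: fpsP => -[|i] j //=; rewrite /fdy.
  have := congr1 (fun f : fps K => f 0%N j.+1) H1; rewrite /= fps1E /= => ->.
  by rewrite mulr0.
have fx1 : fdx x = 1 by rewrite fdx_vf vfx.
have fy0 : fdx y = 0 by rewrite fdx_vf vfy.
rewrite /= fdxM expr2 fdxM fdx_comp // /flip /= !dD !fdxM fx1 fy0 -/(flip I).
have rD f g : rhox (f + g) = rhox f + rhox g by rewrite !rhox_comp fcompD.
rewrite !(rD, rN, rhoxM, rH) Ix1 Hy rx ry.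
have H01 : fcomp H (0, - y) = 1.
  rewrite fcomp_0y ?H1 ?fcomp1 //; first by apply: nc_0; rewrite fpsN /fy oppr0.
  by rewrite fpsN /fy oppr0.
have r1 : rhox 1 = 1 by rewrite rhox_comp fcomp1.
rewrite H01 ?r1 !(mul0r, mul1r, mulr0, mulr1, addr0).
move=> /(congr1 (fun f : fps K => f 0%N n)) /=.
rewrite !fpsD mulrN mulr1 fpsN fcomp_flip0 -signr_odd (negbTE en) expr0 mul1r /= /fdx !mul1r.
move=> h; apply: (mulfI two0); rewrite !mulr_natl !mulr2n -{1}h.
by rewrite subrK.
Qed.

(** On the line (c x, x) the coefficient of x^N is a polynomial of degree at most N in c, the form
    required by the interpolation argument. *)
Lemma fcomp_diag F (c : K) N j : fcomp F (c *: x, x) N j =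
  if j is 0%N then \sum_(k < N.+1) c ^+ k * F k (N - k)%N else 0.
Proof.
have n0 : nc (c *: x, x) by split; rewrite /= ?fpsZ /fx /= ?mulr0.
rewrite (@fcompE _ (N + j).+1) //=.
have e k l : ((c *: x) ^+ k * x ^+ l) N j = c ^+ k * ((N == k + l)%N && (j == 0%N))%:R.
  by rewrite exprZn -scalerAl -exprD -[x ^+ _]mulr1 -(expr0 y) -monoE fpsZ.
under eq_bigr => k _ do under eq_bigr => l _ do rewrite e.
case: j {e} => [|j]; last first.
  by rewrite big1 // => k _; rewrite big1 // => l _; rewrite andbF !mulr0.
rewrite addn0; apply: eq_bigr => k _; have kN : (N - k < N.+1)%N by lia.
rewrite (bigD1 (Ordinal kN)) //= big1 ?addr0 => [|l lk].
  by rewrite subnKC; [rewrite eqxx mulr1 mulrC | rewrite -ltnS].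
rewrite (_ : (N == k + l)%N = false) ?mulr0 //.
apply/negbTE; apply: contra lk => /eqP Nkl; apply/eqP; apply: val_inj => /=; lia.
Qed.

(** By the order of [G k], its restriction to the axis starts at x^(k + 2). So on the axis the first
    integral is x^2 H(c x, x), and taking c x for an independent variable gives one series [I] with
    coefficients free of c. *)
Lemma involution_family (G : nat -> fps K) : G 0%N = u_leaf K ->
  (forall k, ord (3 + 2 * k) (G k)) -> exists I : fps K,
  [/\ I 0%N 0%N = 1, forall n, ~~ odd n -> I 1%N n = G 1%N (n + 3)%N 0%N &
      forall c, fcomp (rho (psum G c)) (flip (fcomp I (c *: x, x))) = rho (psum G c)].
Proof.
move=> G0 Gord; pose H : fps K := fun k n => G k (k + n + 2)%N 0%N.
have u0 n : u_leaf K n.+2 0%N = (n == 0%N)%:R.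
  by rewrite /u_leaf fpsB expr2 mul_fx /fx /fy /= subr0; case: n.
have H0 : H 0%N 0%N = 1 by rewrite /H G0 u0.
have H1 : rhox H = 1.
  apply: fpsP => -[|i] j; rewrite fps1E //= /H G0 add0n addn2 u0 //.
have [I I0 Ie] := flip_exists H0; have [Ix I1] := flip_first_order H1 I0 Ie.
exists I; split=> // [n en|c]; first by rewrite I1 // /H; congr (G _ _ _); lia.
have n0 : nc (c *: x, x) by split; rewrite /= ?fpsZ /fx /= ?mulr0.
set Ic := fcomp I _; have nI := nc_flip Ic.
have e : rho (psum G c) = x ^+ 2 * fcomp H (c *: x, x).
  apply: fpsP => N [|j]; last first.
    rewrite /= expr2 -mulrA mul_fx; case: N => // N; rewrite mul_fx; case: N => // N.
    by rewrite fcomp_diag.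
  rewrite /= expr2 -mulrA mul_fx; case: N => [|N].
    by rewrite /psum big1 // => k _; rewrite Gord ?mulr0.
  rewrite mul_fx; case: N => [|N].
    by rewrite /psum big1 // => k _; rewrite Gord ?mulr0 //; lia.
  rewrite fcomp_diag; apply/esym; rewrite /psum.
  rewrite (eq_bigr (fun k : 'I_N.+1 => c ^+ k * G k N.+2 0%N)) => [|k _]; last first.
    by congr (_ * _); rewrite /H; congr (G _ _ _); have := ltn_ord k; lia.
  apply: (@sum_pad _ _ _ (fun k => c ^+ k * G k N.+2 0%N)); first by lia.
  by move=> k Nk; rewrite Gord ?mulr0 //; lia.
have flipI : fmap_comp (flip I) (c *: x, x) = fmap_comp (c *: x, x) (- (x * Ic), - (x * Ic)).
  rewrite /fmap_comp /flip /= !fcompN !fcompM // fcompZ fcomp_fx // fcomp_fy // -/Ic.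
  rewrite fcomp_fx; last by split; rewrite /= fpsN mul_fx oppr0.
  by rewrite -scalerAl scalerN.
have nx : nc (- (x * Ic), - (x * Ic)) by split; rewrite /= fpsN mul_fx oppr0.
have He : Ic ^+ 2 * fcomp (fcomp H (c *: x, x)) (flip Ic) = fcomp H (c *: x, x).
  rewrite -{2}Ie fcompM // fcompX // -/Ic fcompA //.
  rewrite fcompA; [|exact: nc_flip|exact: n0]; congr (_ * fcomp H _); rewrite flipI /fmap_comp /=.
  by rewrite !fcompZ !fcomp_fx.
rewrite e fcompM // fcompX // fcomp_fx // {1}/flip /= -[in RHS]He; ring.
Qed.

End Involution.

(** * Conjugacy to a convergent field *)

Section ConjugacyNormalForm.
Variable K : numFieldType.
Implicit Types (f g h q E F U W Z : fps K) (s t sg X Y : fps K * fps K).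
Notation nc := no_constant_term.
Notation x := (fx K).
Notation y := (fy K).
Notation weighted s := (ord 2 s.1 /\ ord 3 s.2).

Lemma weighted2_nc s : weighted s -> nc s.
Proof. exact: (@weighted_nc K 2 3 isT isT). Qed.

Lemma fcomp_ord2 n g s : weighted s -> ord n g -> ord n (fcomp g s).
Proof. exact: (@fcomp_ordw K 2 3 isT isT). Qed.

Lemma fcomp_lip2 r v g s t : weighted s -> weighted t ->
  ord (2 + r) (s.1 - t.1) -> ord (3 + r) (s.2 - t.2) ->
  ord v g -> ord (v + r) (fcomp g s - fcomp g t).
Proof. exact: (@fcomp_lip K 2 3 isT isT). Qed.

Lemma weighted_fid : weighted (fid K).
Proof. by split; [exact: ord_x | exact: ord_y]. Qed.

Lemma cong_weighted n s t : cong n s t -> weighted t -> weighted s.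
Proof.
move=> [h1 h2] [t1 t2]; split.
  by rewrite -(subrK t.1 s.1); apply: ordwD t1; apply: ordwW h1; lia.
by rewrite -(subrK t.2 s.2); apply: ordwD t2; apply: ordwW h2; lia.
Qed.

Lemma fcomp_ord_inv n s f : cong 1 s (fid K) -> ord n (fcomp f s) -> ord n f.
Proof.
move=> sc; have ws := cong_weighted sc weighted_fid; have [c1 c2] := sc.
elim: n => [|n IH] h; first exact: ordw0n.
have fn : ord n f by apply: IH; apply: ordwW h; lia.
rewrite -(subKr (fcomp f s) f); apply: ordwB h _.
rewrite -{2}(fcomp_fid f) -[n.+1]addn1.
exact: fcomp_lip2 ws weighted_fid c1 c2 fn.
Qed.

Lemma fcomp_inj s f : cong 1 s (fid K) -> fcomp f s = 0 -> f = 0.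
Proof.
move=> sc h; apply: (@ordw_eq0 _ 2 3) => // n; apply: (fcomp_ord_inv sc).
by rewrite h; apply: ordw_0.
Qed.

Lemma rho_divy0 f : divy f = 0 -> f = rho f.
Proof.
move=> e; apply: fpsP => i [|j] //=.
by have := congr1 (fun g : fps K => g i j) e.
Qed.

Section Orders.
Variables (X Y sg : fps K * fps K).
Hypotheses (X_tame : tame X).
Hypotheses (sg1 : ord 4 (sg.1 - x)) (sg2 : ord 4 (sg.2 - y)).
Hypotheses (Y1 : fcomp Y.1 sg = vf_apply X sg.1) (Y2 : fcomp Y.2 sg = vf_apply X sg.2).

Lemma normal_cong : cong 1 sg (fid K).
Proof. by split=> //; apply: ordwW sg1. Qed.

Lemma tame_ord : ord 4 (X.1 - y) /\ ord 5 X.2.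
Proof.
have [[r1 r2] X10 X20 X01 _] := X_tame.
have z1 i : X.1 i 0%N = 0 by have := congr1 (fun f : fps K => f i 0%N) X10.
have z2 i : X.2 i 0%N = 0 by have := congr1 (fun f : fps K => f i 0%N) X20.
split.
  case=> [|i] [|[|j]] ij; try lia; rewrite fpsB ?z1 /fy /= ?subr0 //.
  by rewrite X01 subrr.
case=> [|i] [|[|j]] ij; try lia; rewrite ?z2 //.
exact: (r2 0%N 1%N).
Qed.

Lemma normal_orders : ord 4 (Y.1 - y) /\ ord 5 Y.2.
Proof.
have [X1 _ _ _ _] := X_tame; have [v1 v2] := tame_ord; have ns := normal_cong.
have nsg : nc sg by apply: weighted2_nc; apply: cong_weighted ns weighted_fid.
split; apply: (fcomp_ord_inv ns).
  rewrite fcompB Y1 fcomp_fy //.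
  have -> : vf_apply X sg.1 - sg.2 = (X.1 - y) + vf_apply X (sg.1 - x) - (sg.2 - y).
    by rewrite (linB (lin_vf _)) vfx; ring.
  by apply: ordwB sg2; apply: ordwD v1 _; apply: ordwW (raisesS X1 sg1); lia.
rewrite Y2 (_ : vf_apply X sg.2 = X.2 + vf_apply X (sg.2 - y)).
  by apply: ordwD v2 _; exact: raisesS X1 sg2.
by rewrite (linB (lin_vf _)) vfy addrC subrK.
Qed.

End Orders.

(** Weierstrass division: at the fixed point q, the remainder F - q (y + E) is a series in x
    alone. *)
Definition quot_step E F s : fps K * fps K := (divy (F - s.1 * E), 0).

Lemma quot_step_stab E F s : ord 4 E -> ord 5 F ->
  cong 0 s (0, 0) -> cong 0 (quot_step E F s) (0, 0).
Proof.
move=> hE hF [s1 _]; rewrite /= subr0 in s1; split; rewrite /= subr0; last exact: ordw_0.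
have h : ord 5 (F - s.1 * E) by apply: ordwB hF _; apply: ordwW (ordwM s1 hE); lia.
exact: (divy_ord h).
Qed.

Lemma quot_step_contr E F n s t : ord 4 E ->
  cong n s t -> cong n.+1 (quot_step E F s) (quot_step E F t).
Proof.
move=> hE [d _]; split; last by rewrite /= subrr; exact: ordw_0.
rewrite /= -(linB (lin_divy K)).
have -> : F - s.1 * E - (F - t.1 * E) = - ((s.1 - t.1) * E) by ring.
by have := divy_ord (ordwN (ordwM d hE)); apply: ordwW; lia.
Qed.

(** Picard iteration for Z_x = q(x, Z), Z(0, y) = y: the leaf through (0, y) as a graph over x. *)
Definition ode_step q s : fps K * fps K := (0, y + intx (fcomp q (x, s.2))).

Lemma weighted_x s : cong 1 s (0, y) -> weighted (x, s.2).
Proof.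
move=> h; split; first exact: ord_x.
rewrite /= -(subrK y s.2); apply: (ordwD _ (@ord_y K)); apply: ordwW h.2; lia.
Qed.

Lemma ode_step_stab q s : ord 2 q -> cong 1 s (0, y) -> cong 1 (ode_step q s) (0, y).
Proof.
move=> hq hs; split; rewrite /= ?subrr; first exact: ordw_0.
rewrite addrC addKr; apply: (intx_ord (n := 2)).
exact: fcomp_ord2 (weighted_x hs) hq.
Qed.

Lemma ode_step_contr q n s t : ord 2 q -> cong 1 s (0, y) -> cong 1 t (0, y) ->
  cong n s t -> cong n.+1 (ode_step q s) (ode_step q t).
Proof.
move=> hq hs ht [_ d]; split; rewrite /= ?subrr; first exact: ordw_0.
rewrite opprD addrACA subrr add0r -(linB (lin_intx K)).
have h : ord (2 + n) (fcomp q (x, s.2) - fcomp q (x, t.2)).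
  by apply: fcomp_lip2 (weighted_x hs) (weighted_x ht) _ d hq; rewrite subrr; exact: ordw_0.
by apply: ordwW (intx_ord h); lia.
Qed.

(** Its fixed point G solves Z([sg.1], G) = [sg.2]: G labels the leaf through the image point by its
    intersection with x = 0. *)
Definition leaf_step Z sg s : fps K * fps K := (0, sg.2 - fcomp (Z - y) (sg.1, s.2)).

Section LeafCoordinate.
Variables (Z : fps K) (sg : fps K * fps K).
Hypotheses (Z4 : ord 4 (Z - y)) (sg1 : ord 2 sg.1) (sg2 : ord 4 (sg.2 - y)).

Let wsg s : cong 1 s (0, y) -> weighted (sg.1, s.2).
Proof. by move=> h; split=> //; case: (weighted_x h). Qed.

Lemma leaf_exists : exists2 G : fps K, ord 4 (G - y) & fcomp Z (sg.1, G) = sg.2.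
Proof.
have [||s [sc sT _]] := @contraction_fixpoint K 1 (0, y) (leaf_step Z sg).
- move=> s hs; split; rewrite /= ?subrr; first exact: ordw_0.
  rewrite addrAC; apply: ordwB sg2 _; exact: fcomp_ord2 (wsg hs) Z4.
- move=> n s t _ hs ht [_ d]; split; rewrite /= ?subrr; first exact: ordw_0.
  have -> : sg.2 - fcomp (Z - y) (sg.1, s.2) - (sg.2 - fcomp (Z - y) (sg.1, t.2)) =
     - (fcomp (Z - y) (sg.1, s.2) - fcomp (Z - y) (sg.1, t.2)) by ring.
  apply: ordwN; have := fcomp_lip2 (wsg hs) (wsg ht) _ d Z4.
  by rewrite !addSn => h; apply: h; rewrite subrr; exact: ordw_0.
have e : s.2 = sg.2 - fcomp (Z - y) (sg.1, s.2) by rewrite -{1}sT.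
exists s.2; first exact: sc.2.
have n0 : nc (sg.1, s.2) by apply: weighted2_nc; apply: wsg.
rewrite -[RHS](subrK (fcomp (Z - y) (sg.1, s.2))) -e fcompB fcomp_fy //=.
by rewrite addrC subrK.
Qed.

End LeafCoordinate.

(** Its fixed points are the solutions s of W(s) = 0 and W_x(s) = 2 x. The leading parts of W and
    W_x, y and 2 x, are solved for and the rest is iterated. *)
Definition curve_step W s : fps K * fps K :=
  (x - 2^-1 *: fcomp (fdx W - 2 *: x) s, - fcomp (W - y) s).

Lemma weighted_x0 s : cong 1 s (x, 0) -> weighted s.
Proof.
by move=> /cong_weighted h; apply: h; split; [exact: ord_x | exact: ordw_0].
Qed.

Lemma curve_step_stab W s : ord 4 (W - y) -> ord 3 (fdx W - 2 *: x) ->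
  cong 1 s (x, 0) -> cong 1 (curve_step W s) (x, 0).
Proof.
move=> w2 w1 hs; split; rewrite /= ?subr0.
  rewrite addrAC subrr add0r; apply: ordwN; apply: ordwZ.
  exact: fcomp_ord2 (weighted_x0 hs) w1.
apply: ordwN; exact: fcomp_ord2 (weighted_x0 hs) w2.
Qed.

Lemma curve_step_contr W n s t : ord 4 (W - y) -> ord 3 (fdx W - 2 *: x) ->
  cong 1 s (x, 0) -> cong 1 t (x, 0) ->
  cong n s t -> cong n.+1 (curve_step W s) (curve_step W t).
Proof.
move=> w2 w1 hs ht [d1 d2]; split; rewrite /=.
  have e (a b : fps K) : x - 2^-1 *: a - (x - 2^-1 *: b) = - (2^-1 *: (a - b)).
    by rewrite scalerBr; ring.
  rewrite e; apply: ordwN; apply: ordwZ.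
  exact: fcomp_lip2 (weighted_x0 hs) (weighted_x0 ht) d1 d2 w1.
rewrite opprK addrC; apply: ordwBC.
exact: fcomp_lip2 (weighted_x0 hs) (weighted_x0 ht) d1 d2 w2.
Qed.

End ConjugacyNormalForm.

(** * The leaf coordinate and the curve of zeros *)

Section Leaf.
Variable K : numFieldType.
Implicit Types (f g h F U : fps K) (s : fps K * fps K).
Notation nc := no_constant_term.
Notation x := (fx K).
Notation y := (fy K).

Lemma rho_fcomp F s : nc s -> rho (fcomp F s) = fcomp F (rho s.1, rho s.2).
Proof. by move=> s0; rewrite rho_comp fcompA // /fmap_comp -!rho_comp. Qed.

Lemma rho_vf (X : fps K * fps K) f : tame X -> rho (vf_apply X f) = 0.
Proof. by case=> _ h1 h2 _ _; rewrite vfE rhoD !rhoM h1 h2 !mul0r addr0. Qed.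

Variables (X Y sg : fps K * fps K) (q Z G : fps K).
Hypotheses (X_tame : tame X).
Hypotheses (sg1 : ord 4 (sg.1 - x)) (sg2 : ord 4 (sg.2 - y)).
Hypotheses (Y1 : fcomp Y.1 sg = vf_apply X sg.1) (Y2 : fcomp Y.2 sg = vf_apply X sg.2).
Hypotheses (qE : q = divy (Y.2 - q * (Y.1 - y))).
Hypotheses (Z4 : ord 4 (Z - y)) (ZE : Z = y + intx (fcomp q (x, Z))).
Hypotheses (G4 : ord 4 (G - y)) (GE : fcomp Z (sg.1, G) = sg.2).

Let nsg : cong 1 sg (fid K). Proof. exact: normal_cong. Qed.

Let wsg : ord 2 sg.1 /\ ord 3 sg.2.
Proof. exact: cong_weighted nsg (weighted_fid K). Qed.

Let nc_sg : nc sg. Proof. exact: weighted2_nc. Qed.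

Let ord3 f : ord 4 (f - y) -> ord 3 f.
Proof.
move=> h; rewrite -(subrK y f); apply: (ordwD _ (@ord_y K)).
by apply: ordwW h; lia.
Qed.

Let wZ : ord 2 x /\ ord 3 Z. Proof. by split; [exact: ord_x | exact: ord3]. Qed.
Let nc_Z : nc (x, Z). Proof. exact: (@weighted2_nc K (x, Z) wZ). Qed.
Let wG : ord 2 sg.1 /\ ord 3 G. Proof. by split; [case: wsg | exact: ord3]. Qed.
Let nc_G : nc (sg.1, G). Proof. exact: (@weighted2_nc K (sg.1, G) wG). Qed.

(** The remainder of the division depends on x alone and vanishes on the image of the axis, where Y
    vanishes; as that image projects invertibly to the first coordinate, the remainder is zero. *)
Lemma quotientE : q * Y.1 = Y.2.
Proof.
set D := Y.2 - q * Y.1.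
have D0 : divy D = 0.
  rewrite (_ : D = (Y.2 - q * (Y.1 - y)) - y * q); last by rewrite /D; ring.
  by rewrite (linB (lin_divy K)) -qE divy_ymul subrr.
have Dr := rho_divy0 D0.
suff e : D = 0 by apply/eqP; rewrite eq_sym -subr_eq0 -/D e.
have n1 : nc (sg.1, 0) by split=> //; case: nc_sg.
have Ds : fcomp D sg = fcomp D (sg.1, 0).
  rewrite {1}Dr rho_comp fcompA //; congr (fcomp D _).
  by rewrite /fmap_comp /= fcomp_fx // fcomp0.
have nb : nc (rho sg.1, y) by split=> //=; case: nc_sg.
apply: (@fcomp_inj K (rho sg.1, y)).
  split; rewrite /= ?subrr; last exact: ordw_0.
  by rewrite -(rho_x K) -rhoB; apply: rho_ord; apply: ordwW sg1.
rewrite {1}Dr rho_comp fcompA //.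
have -> : fmap_comp (x, 0) (rho sg.1, y) = (rho sg.1, rho 0).
  by rewrite /fmap_comp /= fcomp_fx // fcomp0 (rho_comp 0) fcomp0.
rewrite -(@rho_fcomp D (sg.1, 0)) // -Ds fcompB fcompM // Y1 Y2.
by rewrite rhoB rhoM !rho_vf // mulr0 subrr.
Qed.

(** Apply X to Z([sg.1], G) = [sg.2]. Since X [sg.2] = q X [sg.1] and Z_x = q, what is left is Z_y X
    G = 0, with Z_y a unit. *)
Lemma leaf_integral : vf_apply X G = 0.
Proof.
have h : vf_apply X sg.2 = fcomp q sg * vf_apply X sg.1.
  by rewrite -Y1 -Y2 -fcompM // quotientE.
have := h; rewrite -{1}GE vf_comp //= => e.
have Zx : fdx Z = fcomp q (x, Z).
  by rewrite {1}ZE fdxD fdx_intx fdx_vf vfy add0r.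
have fm : fmap_comp (x, Z) (sg.1, G) = sg.
  by rewrite /fmap_comp /= fcomp_fx // GE; case: (sg).
move: e; rewrite Zx fcompA // fm => /eqP.
rewrite -subr_eq0 addrAC subrr add0r => /eqP e.
apply: fps_cancel e; rewrite fcomp00 //.
have -> : fdy Z 0%N 0%N = 1; last exact: oner_neq0.
rewrite /fdy mul1r; have := Z4 (i := 0%N) (j := 1%N) isT.
by rewrite fpsB /fy /= => /eqP; rewrite subr_eq0 => /eqP.
Qed.

(* [X] is tangent to the level sets of [G]; in the coordinates [(sg.1, G)] it
   becomes [leaf_speed * d/dx]. *)
Definition leaf_speed := fcomp Y.1 (x, Z).
Notation W := leaf_speed.
Let b := rho sg.1.
Let z := rho G.

Lemma leaf_speedE : vf_apply X sg.1 = fcomp W (sg.1, G).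
Proof.
rewrite /W fcompA // -Y1; congr (fcomp _ _).
by rewrite /fmap_comp /= fcomp_fx // GE; case: (sg).
Qed.

Let W4 : ord 4 (W - y).
Proof.
have [h1 _] := normal_orders X_tame sg1 sg2 Y1 Y2.
have -> : W - y = fcomp (Y.1 - y) (x, Z) + (Z - y).
  by rewrite fcompB fcomp_fy //= addrA subrK.
by apply: ordwD Z4; apply: (@fcomp_ord2 K 4 _ (x, Z)).
Qed.

Let bx : ord 4 (b - x).
Proof. by rewrite -(rho_x K) -rhoB; apply: rho_ord. Qed.

Let z4 : ord 4 z.
Proof. by rewrite -(subr0 z) -(rho_y K) -rhoB; apply: rho_ord. Qed.

Lemma curve_cong : cong 1 (b, z) (x, 0).
Proof. by split; rewrite /= ?subr0 //; apply: ordwW bx. Qed.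

Let wb : ord 2 b /\ ord 3 z. Proof. exact: (weighted_x0 curve_cong). Qed.
Let nc_b : nc (b, z). Proof. exact: (@weighted2_nc K (b, z) wb). Qed.

Lemma curve_zero : fcomp W (b, z) = 0.
Proof.
by rewrite -(@rho_fcomp W (sg.1, G)) // -leaf_speedE rho_vf.
Qed.

(** The function P = X [sg.1] satisfies X P = W_x P because G is a first integral. Dividing by y and
    restricting to the axis identifies W_x with the transverse eigenvalue of X, which is 2 x. *)
Lemma curve_slope : fcomp (fdx W) (b, z) = 2 *: x.
Proof.
have [X1 _ X20 _ X2y] := X_tame.
rewrite -(@rho_fcomp (fdx W) (sg.1, G)) //; set F := fcomp _ _.
set P := vf_apply X sg.1; pose al := divy P.
have PE : P = y * al by apply: rho0_ymul; apply: rho_vf.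
have XP : vf_apply X P = F * P.
  by rewrite /P {1}leaf_speedE vf_comp //= leaf_integral mulr0 addr0.
have e : divy X.2 * al + vf_apply X al = F * al.
  apply: ymul_inj; rewrite mulrCA -PE -XP PE vfM vfy mulrDr mulrA.
  by rewrite -(rho0_ymul X20).
have a0 : al 0%N 0%N = 1.
  have [v1 _] := tame_ord X_tame.
  have : ord 4 (P - y).
    have -> : P - y = (X.1 - y) + vf_apply X (sg.1 - x).
      by rewrite (linB (lin_vf _)) vfx /P; ring.
    by apply: ordwD v1 _; apply: ordwW (raisesS X1 sg1); lia.
  move=> h; have := h 0%N 1%N isT; rewrite fpsB /fy /= => /eqP.
  by rewrite subr_eq0 => /eqP.
apply/eqP; rewrite -subr_eq0; apply/eqP; apply: (@fps_cancel _ (rho al)).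
  by rewrite /= a0 oner_neq0.
have := congr1 (@rho K) e; rewrite rhoD !rhoM rho_vf // X2y addr0 => {}e.
by rewrite mulrBr mulrC -e mulrC subrr.
Qed.

Let D3 : ord 3 (fdx W - 2 *: x).
Proof.
set D := fdx W - _.
have D2 : ord 2 D.
  rewrite /D (_ : fdx W = fdx (W - y)).
    by apply: ordwB; [exact: (ordw_fdx W4) | apply: ordwZ; exact: ord_x].
  by rewrite (fdx_vf (W - y)) (linB (lin_vf _)) -!fdx_vf (fdx_vf y) vfy subr0.
have d1 := @fcomp_lip2 K 1 2 D (b, z) (x, 0) wb (conj (@ord_x K) (ordw_0 _ _ _))
   curve_cong.1 curve_cong.2 D2.
have d2 : ord 3 (rho D).
  rewrite rho_comp -(subKr (fcomp D (b, z)) (fcomp D (x, 0))); apply: ordwB d1.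
  rewrite /D fcompB curve_slope fcompZ fcomp_fx //= -scalerBr; apply: ordwZ.
  by apply: ordwBC; apply: ordwW bx.
by case=> [|[|i]] [|j] ij; try lia; [apply: (d2 0%N 0%N) | apply: (d2 1%N 0%N)].
Qed.

Lemma leaf_speed_ord : ord 4 (W - y) /\ ord 3 (fdx W - 2 *: x).
Proof. by []. Qed.

(* The image of the axis [y = 0] is the curve of zeros of the analytic [leaf_speed];
   knowing also the slope there exhibits it as a fixed point of an analytic
   contraction, whence its convergence. *)
Lemma curve_fix : curve_step W (b, z) = (b, z).
Proof.
rewrite /curve_step !fcompB curve_slope curve_zero fcompZ fcomp_fx // fcomp_fy //=.
rewrite sub0r opprK -scalerBr scalerA mulVf ?scale1r ?(pnatr_eq0 K 2) //.
by rewrite opprB addrC subrK.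
Qed.

(** W = y + x^2 up to higher order, so the curve of zeros is tangent to the leaves at the origin to
    first order. This double contact is what gives an involution. *)
Lemma curve_height : ord 5 (z + x ^+ 2).
Proof.
have w2 : W 2%N 0%N = 1.
  have := D3 (i := 1%N) (j := 0%N) isT; rewrite fpsB fpsZ /fdx /fx /= mulr1.
  move=> /eqP; rewrite subr_eq0 -{2}[2%:R]mulr1 => /eqP.
  by apply: mulfI; rewrite (pnatr_eq0 K 2).
have W5 : ord 5 (W - y - x ^+ 2).
  have e : x ^+ 2 = mono 2 0 by rewrite monoE expr0 mulr1.
  move=> i j ij; rewrite e fpsB /mono; case: (ltnP (2 * i + 3 * j) 4) => h.
    rewrite W4 // sub0r; case: i ij h => [|[|[|i]]] ij h //=; rewrite ?oppr0 //; lia.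
  have [-> ->] : i = 2%N /\ j = 0%N by lia.
  by rewrite fpsB w2 /fy /= subr0 subrr.
have -> : z + x ^+ 2 = - fcomp (W - y - x ^+ 2) (b, z) - (b - x) * (b + x).
  have := congr1 snd curve_fix; rewrite /= => {1}<-.
  rewrite (fcompB (W - y)) fcompX // fcomp_fx //=.
  by set F := fcomp _ _; ring.
apply: ordwB; first by apply: ordwN; apply: fcomp_ord2 W5.
by apply: ordwW (ordwM bx (ordwD wb.1 (@ord_x K))); lia.
Qed.

(** Both sides extend to first integrals G and G(0, -U), which agree on x = 0 because U = -y there.
    So the restriction of G to the axis is a function of that of U, and an involution preserving the
    latter preserves the former. *)
Lemma leaf_invariant U : vf_apply X U = 0 -> rhox U = - y ->
  z = fcomp G (0, - rho U).
Proof.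
move=> XU U0; have [X1 X10 X20 X01 _] := X_tame.
have U00 : U 0%N 0%N = 0 by have := congr1 (fun f : fps K => f 0%N 0%N) U0; rewrite /= fpsN /fy oppr0.
have nU : nc (0, - U) by split; rewrite //= fpsN U00 oppr0.
suff e : G = fcomp G (0, - U).
  rewrite /z {1}e rho_fcomp //=; congr (fcomp G (_, _)).
    by rewrite rho_comp fcomp0.
  by rewrite !rho_comp fcompN.
apply/eqP; rewrite -subr_eq0; apply/eqP; apply: (first_integral_eq0 X1 X10 X20 X01).
  rewrite (linB (lin_vf _)) leaf_integral vf_comp //=.
  rewrite (linN (lin_vf _)) XU (lin0 (lin_vf _)) oppr0 !mulr0 addr0 subrr //.
move=> j; have : rhox (G - fcomp G (0, - U)) = 0; last first.
  by move=> /(congr1 (fun f : fps K => f 0%N j)).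
rewrite rhox_comp fcompB fcompA // /fmap_comp /= fcomp0 fcompN -!rhox_comp U0 opprK.
by rewrite -rhox_comp subrr.
Qed.

End Leaf.

(** * Convergence of the fixed points *)

Section ConvergentSolutions.
Variable R : realType.
Local Notation C := R[i]%C.
Implicit Types (f g h q E F W Z J : fps C) (s t : fps C * fps C).
Notation normc := ComplexField.Normc.normc.
Notation nc := no_constant_term.
Notation x := (fx C).
Notation y := (fy C).

Lemma quot_conv E F q : ord 4 E -> ord 5 F -> conv E -> conv F -> ord 2 q ->
  quot_step E F (q, 0) = (q, 0) -> conv q.
Proof.
move=> hE hF cE cF hq fix_q.
have [A A1 hA] := conv_small (conv_divy cF) (divy_ord hF).
have [B B1 hB] := conv_small cE hE.
pose t := (A + B)^-1; have AB0 : 0 < A + B by lra.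
have t0 : 0 < t by rewrite invr_gt0.
have tAB : (A + B) * t = 1 by rewrite divff // lt0r_neq0.
have At : A * t <= 1 by rewrite -tAB ler_pM2r //; lra.
have Bt : B * t <= 1 by rewrite -tAB ler_pM2r //; lra.
have t1 : t <= 1 by apply: le_trans At; rewrite ler_peMl // ltW.
have p0 : 0 < t ^+ 2 by rewrite exprn_gt0.
have q0 : 0 < t ^+ 3 by rewrite exprn_gt0.
have [b _] : bnd (t ^+ 2) (t ^+ 3) 1 q /\ bnd (t ^+ 2) (t ^+ 3) 1 (0 : fps C).
  apply: (fixpoint_bnd (m := 0) (s0 := (0, 0)) (T := quot_step E F) (s := (q, 0))
     (A := 1) (B := 1) p0 q0) => //.
  - by move=> s; apply: quot_step_stab.
  - by move=> n s u _ _ _; apply: quot_step_contr.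
  - by split; rewrite /= subr0 //; exact: ordw_0.
  - by apply: bndW ler01 _; exact: bnd0.
  - by apply: bndW ler01 _; exact: bnd0.
  move=> s _ s1 _; split; last by apply: bndW ler01 _; exact: bnd0.
  rewrite /= (linB (lin_divy C)).
  apply: (@bndW _ _ _ (A * t ^+ 2 + (1 * (B * t ^+ 4)) / t ^+ 3)); last first.
    apply: bndB => //; first exact: hA.
    by apply: bnd_divy => //; apply: bndM => //; exact: hB.
  have -> : 1 * (B * t ^+ 4) / t ^+ 3 = B * t by field; rewrite lt0r_neq0.
  rewrite -tAB mulrDl lerD2r ler_pM2l; last by lra.
  by rewrite expr2 ler_piMl // ltW.
exact: bnd_conv b.
Qed.

Lemma ode_conv q Z : ord 2 q -> conv q -> ord 4 (Z - y) ->
  ode_step q (0, Z) = (0, Z) -> conv Z.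
Proof.
move=> hq [r r0 [M hM]] hZ fix_Z; have M0 : 0 <= M by apply: bnd_ge0 hM.
pose m := Num.min r 1; have m0 : 0 < m by rewrite lt_min r0 ltr01.
have m1 : m <= 1 by rewrite ge_min lexx orbT.
have mr : m <= r by rewrite ge_min lexx.
have M1 : 0 < 1 + M by lra.
pose t := m / (1 + M); have t0 : 0 < t by rewrite divr_gt0.
have tM : t * (1 + M) = m by rewrite divfK // lt0r_neq0.
have tm : t <= m by rewrite -tM ler_peMr // ?(ltW t0) //; lra.
have t1 : t <= 1 by apply: le_trans m1.
have p0 : 0 < t ^+ 2 by rewrite exprn_gt0.
have q0 : 0 < t ^+ 3 by rewrite exprn_gt0.
have t2 : t ^+ 2 <= t by rewrite expr2 ler_piMl // ltW.
have t3 : t ^+ 3 <= t ^+ 2 by rewrite exprS ler_piMl // ltW.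
have t2r : t ^+ 2 <= r by apply: le_trans mr; apply: le_trans tm.
have [_ b] : bnd (t ^+ 2) (t ^+ 3) 1 (0 : fps C) /\ bnd (t ^+ 2) (t ^+ 3) r Z.
  apply: (fixpoint_bnd (m := 1) (s0 := (0, y)) (T := ode_step q) (s := (0, Z))
     (A := 1) (B := r) p0 q0) => //.
  - by move=> s; apply: ode_step_stab.
  - by move=> n s u _; apply: ode_step_contr.
  - by split; rewrite /= ?subrr //; exact: ordw_0.
  - by apply: bndW ler01 _; exact: bnd0.
  - by rewrite /=; apply: bndW (bnd_y p0 q0); apply: le_trans t2r.
  move=> s sc _ s2; split; first by apply: bndW ler01 _; exact: bnd0.
  apply: (@bndW _ _ _ (t ^+ 3 + t ^+ 2 * M)); last first.
    apply: bndD => //; first exact: bnd_y.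
    apply: bnd_intx => //; apply: bnd_comp hM => //.
      exact: (@weighted2_nc C (x, s.2) (weighted_x sc)).
    by apply: bndW t2r _; exact: bnd_x.
  apply: le_trans mr; rewrite -tM.
  apply: (@le_trans _ _ (t ^+ 2 * (1 + M))); first by rewrite mulrDr mulr1 lerD2r.
  by rewrite ler_pM2r.
exact: bnd_conv b.
Qed.

Lemma normcVn n : normc ((n.+1%:R : C)^-1) = n.+1%:R^-1.
Proof. by rewrite ComplexField.Normc.normcV normc_nat. Qed.

(** On radii t^2 and t^3 the ball of radii 2 t^2 and 2 t^3 maps into the polydisc with radii (2 t)^2
    and (2 t)^3, where the estimates of [conv_small] apply. The factor 8 in t makes the corrections
    4 A t and 16 B t at most 1 and 2. *)
Lemma curve_conv W s : ord 4 (W - y) -> ord 3 (fdx W - 2 *: x) -> conv W ->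
  cong 1 s (x, 0) -> curve_step W s = s -> conv s.1 /\ conv s.2.
Proof.
move=> w2 w1 cW sc fix_s.
have cW1 : conv (fdx W - 2 *: x).
  by apply: convB; [exact: conv_fdx | apply: convZ; exact: conv_x].
have cW2 : conv (W - y) by apply: convB => //; exact: conv_y.
have [A A1 hA] := conv_small cW1 w1; have [B B1 hB] := conv_small cW2 w2.
pose t := (8 * (A + B))^-1; have AB0 : 0 < 8 * (A + B) by lra.
have t0 : 0 < t by rewrite invr_gt0.
have tAB : 8 * (A + B) * t = 1 by rewrite divff // lt0r_neq0.
have At0 : 0 <= A * t by rewrite mulr_ge0 ?(ltW t0) //; lra.
have Bt0 : 0 <= B * t by rewrite mulr_ge0 ?(ltW t0) //; lra.
have eAB : 8 * (A * t) + 8 * (B * t) = 1 by rewrite -[RHS]tAB; ring.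
have At : A * (2 * t) <= 1 by rewrite mulrCA; lra.
have Bt : B * (2 * t) <= 1 by rewrite mulrCA; lra.
have p0 : 0 < t ^+ 2 by rewrite exprn_gt0.
have q0 : 0 < t ^+ 3 by rewrite exprn_gt0.
have tt0 : 0 < 2 * t by lra.
have [b1 b2] : bnd (t ^+ 2) (t ^+ 3) (2 * t ^+ 2) s.1 /\ bnd (t ^+ 2) (t ^+ 3) (2 * t ^+ 3) s.2.
  apply: (fixpoint_bnd (m := 1) (s0 := (x, 0)) (T := curve_step W) (s := s) p0 q0) => //.
  - by move=> u; apply: curve_step_stab.
  - by move=> n u v _; apply: curve_step_contr.
  - by rewrite /=; apply: bndW (bnd_x p0 q0); lra.
  - by apply: (@bndW _ _ _ 0); [lra | exact: bnd0].
  move=> u uc u1 u2; have nu : nc u by apply: weighted2_nc; apply: weighted_x0.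
  have u1' : bnd (t ^+ 2) (t ^+ 3) ((2 * t) ^+ 2) u.1.
    by apply: bndW u1; rewrite exprMn ler_pM2r //; lra.
  have u2' : bnd (t ^+ 2) (t ^+ 3) ((2 * t) ^+ 3) u.2.
    by apply: bndW u2; rewrite exprMn ler_pM2r //; lra.
  split=> /=.
    apply: (@bndW _ _ _ (t ^+ 2 + 2^-1 * (A * (2 * t) ^+ 3))); last first.
      apply: bndB => //; first exact: bnd_x.
      rewrite -(normcVn 1); apply: bndZ => //.
      by apply: bnd_comp (hA _ tt0 At).
    have -> : 2^-1 * (A * (2 * t) ^+ 3) = 4 * (A * t) * t ^+ 2 by lra.
    have : 4 * (A * t) * t ^+ 2 <= 1 * t ^+ 2 by rewrite ler_pM2r //; lra.
    lra.
  apply: (@bndW _ _ _ (B * (2 * t) ^+ 4)); last first.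
    by apply: bndN => //; apply: bnd_comp (hB _ tt0 Bt).
  have -> : B * (2 * t) ^+ 4 = 16 * (B * t) * t ^+ 3 by ring.
  by rewrite ler_pM2r //; lra.
by split; [exact: bnd_conv b1 | exact: bnd_conv b2].
Qed.

Lemma flip_conv h J : h 0%N 0%N = 1 -> conv h -> ord 2 J ->
  flip_step h (J, 0) = (J, 0) -> conv J.
Proof.
move=> h0 ch hJ fix_J.
have h2 : ord 2 (h - 1) by apply: nc_ord2; rewrite fpsB fps1E h0 subrr.
have [A A1 hA] := conv_small (convB ch (@conv1 R)) h2.
pose t := (8 * A)^-1; have A0 : 0 < 8 * A by lra.
have t0 : 0 < t by rewrite invr_gt0.
have tA : 8 * A * t = 1 by rewrite divff // lt0r_neq0.
have At : A * t = 1 / 8 by lra.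
have t8 : t <= 1 / 8 by rewrite -At ler_peMl // ltW.
have p0 : 0 < t ^+ 2 by rewrite exprn_gt0.
have q0 : 0 < t ^+ 3 by rewrite exprn_gt0.
have tt0 : 0 < 2 * t by lra.
have [b _] : bnd (t ^+ 2) (t ^+ 3) (1/2) J /\ bnd (t ^+ 2) (t ^+ 3) 1 (0 : fps C).
  apply: (fixpoint_bnd (m := 0) (s0 := (0, 0)) (T := flip_step h) (s := (J, 0)) p0 q0) => //.
  - by move=> s; apply: flip_step_stab.
  - by move=> n s u; apply: flip_step_contr.
  - by split; rewrite /= ?subr0 //; exact: ordw_0.
  - by apply: (@bndW _ _ _ 0); [lra | exact: bnd0].
  - by apply: bndW ler01 _; exact: bnd0.
  move=> s _ s1 _; split; last by apply: bndW ler01 _; exact: bnd0.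
  have i1 : bnd (t ^+ 2) (t ^+ 3) (3/2) (1 + s.1).
    by apply: (@bndW _ _ _ (1 + 1/2)); [lra | apply: bndD => //; exact: bnd1].
  have f1 : bnd (t ^+ 2) (t ^+ 3) ((2 * t) ^+ 2) (flip (1 + s.1)).1.
    apply: bndN => //; apply: (@bndW _ _ _ (t ^+ 2 * (3/2))).
      by rewrite exprMn mulrC ler_pM2r //; lra.
    by apply: bndM => //; exact: bnd_x.
  have f2 : bnd (t ^+ 2) (t ^+ 3) ((2 * t) ^+ 3) (flip (1 + s.1)).2.
    apply: bndN => //; apply: (@bndW _ _ _ (t ^+ 3 * (3/2))).
      by rewrite exprMn mulrC ler_pM2r //; lra.
    by apply: bndM => //; exact: bnd_y.
  have hF : fcomp h (flip (1 + s.1)) - 1 = fcomp (h - 1) (flip (1 + s.1)).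
    by rewrite fcompB fcomp1 //; apply: nc_flip.
  have At2 : A * (2 * t) <= 1 by lra.
  have ht : A * t <= 1 by lra.
  rewrite /= hF.
  apply: (@bndW _ _ _ (2^-1 * (A * t ^+ 2 + A * (2 * t) ^+ 2 * (3/2) ^+ 2 + (1/2) ^+ 2))).
    have -> : A * t ^+ 2 = A * t * t by ring.
    have -> : A * (2 * t) ^+ 2 = 4 * (A * t) * t by ring.
    rewrite At; have -> : (3/2 : R) ^+ 2 = 9/4 by field.
    have -> : (1/2 : R) ^+ 2 = 1/4 by field.
    lra.
  rewrite -{1}(normcVn 1); apply: bndZ => //; apply: bndB => //; last exact: (bndX p0 q0 2 s1).
  apply: bndB => //; first exact: (hA _ t0 ht).
  apply: bndM => //; last exact: (bndX p0 q0 2 i1).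
  by apply: bnd_comp (hA _ tt0 At2) => //; exact: nc_flip.
exact: bnd_conv b.
Qed.

End ConvergentSolutions.

(** * Convergence of the involution of an embeddable map *)

Section EmbeddedInvolution.
Variable R : realType.
Local Notation C := R[i]%C.
Implicit Types (f g U I z : fps C) (h s sg X Y : fps C * fps C).
Notation normc := ComplexField.Normc.normc.
Notation nc := no_constant_term.
Notation x := (fx C).
Notation y := (fy C).

Lemma nc_linear (a b c d : C) : nc (a *: x + b *: y, c *: x + d *: y).
Proof. by split; rewrite /= fpsD !fpsZ /fx /fy /= !mulr0 addr0. Qed.

Lemma ord4_linear f : f 0%N 0%N = 0 -> f 1%N 0%N = 0 -> f 0%N 1%N = 0 -> ord 4 f.
Proof. by move=> f0 f1 f2 [|[|i]] [|[|j]] ij //; lia. Qed.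

(** The linear part of the conjugacy is moved to the side of Y, where a linear change of variables
    preserves convergence. The remaining conjugacy is tangent to the identity. *)
Lemma normalise_conjugacy h X Y : convergent_pair Y -> conjugates h X Y ->
  exists sg Y', [/\ conv Y'.1 /\ conv Y'.2, ord 4 (sg.1 - x) /\ ord 4 (sg.2 - y),
     fcomp Y'.1 sg = vf_apply X sg.1 & fcomp Y'.2 sg = vf_apply X sg.2].
Proof.
move=> [/convergent_conv cY1 /convergent_conv cY2] [[h0 hA] [t [[t0 _] _ th hY]]].
have Yh1 : fcomp Y.1 h = vf_apply X h.1.
  by have := hY x; rewrite vfx fcomp_fx // => ->; rewrite fcompA // th fcomp_fid.
have Yh2 : fcomp Y.2 h = vf_apply X h.2.
  by have := hY y; rewrite vfy fcomp_fy // => ->; rewrite fcompA // th fcomp_fid.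
set A := linear_part h in hA; pose B := invmx A.
have [a00 a01 a10 a11] := linear_partE h.
rewrite -/A in a00 a01 a10 a11.
pose sg := (B 0 0 *: h.1 + B 0 1 *: h.2, B 1 0 *: h.1 + B 1 1 *: h.2).
pose L := (A 0 0 *: x + A 0 1 *: y, A 1 0 *: x + A 1 1 *: y).
have nL : nc L by apply: nc_linear.
have s0 : nc sg by case: h0 => z1 z2; split; rewrite /= fpsD !fpsZ z1 z2 !mulr0 addr0.
have mx2 (P Q : 'M[C]_2) i j : (P *m Q) i j = P i 0 * Q 0 j + P i 1 * Q 1 j.
  have e1 : lift ord0 ord0 = 1 :> 'I_2 by apply: val_inj.
  by rewrite mxE !big_ord_recl big_ord0 addr0 e1.
have AB i j : A i 0 * B 0 j + A i 1 * B 1 j = (i == j)%:R by rewrite -mx2 mulmxV // mxE.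
have BA i j : B i 0 * A 0 j + B i 1 * A 1 j = (i == j)%:R by rewrite -mx2 mulVmx // mxE.
have Ls : fmap_comp L sg = h.
  rewrite [RHS]surjective_pairing /fmap_comp /L /= !fcompD !fcompZ fcomp_fx // fcomp_fy //=.
  have lc (i : 'I_2) : A i 0 *: (B 0 0 *: h.1 + B 0 1 *: h.2) +
     A i 1 *: (B 1 0 *: h.1 + B 1 1 *: h.2) = (i == 0)%:R *: h.1 + (i == 1)%:R *: h.2.
    by rewrite -!AB !scalerDr !scalerDl !scalerA addrACA.
  by rewrite !lc /= !scale1r !scale0r addr0 add0r.
exists sg, (fcomp (B 0 0 *: Y.1 + B 0 1 *: Y.2) L, fcomp (B 1 0 *: Y.1 + B 1 1 *: Y.2) L).
have cl (a b : C) : conv (a *: x + b *: y).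
  by apply: convD; apply: convZ; [exact: conv_x | exact: conv_y].
split=> /=.
- have cY (a b : C) : conv (a *: Y.1 + b *: Y.2) by apply: convD; apply: convZ.
  by split; apply: (conv_comp nL); [exact: cY | exact: cl | exact: cl | exact: cY | exact: cl | exact: cl].
- have E (a b : C) g i j : (a *: h.1 + b *: h.2 - g) i j = a * h.1 i j + b * h.2 i j - g i j.
    by rewrite fpsB fpsD !fpsZ.
  have [z1 z2] := h0.
  split; apply: ord4_linear; rewrite E.
  + by rewrite z1 z2 !mulr0 addr0 subr0.
  + by rewrite -a00 -a10 BA subrr.
  + by rewrite -a01 -a11 BA subr0.
  + by rewrite z1 z2 !mulr0 addr0 subr0.
  + by rewrite -a00 -a10 BA subr0.
  + by rewrite -a01 -a11 BA subrr.
- rewrite fcompA // Ls fcompD !fcompZ Yh1 Yh2 /sg /=.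
  by have [vD vZ] := lin_vf X; rewrite vD !vZ.
- rewrite fcompA // Ls fcompD !fcompZ Yh1 Yh2 /sg /=.
  by have [vD vZ] := lin_vf X; rewrite vD !vZ.
Qed.

Lemma embedded_curve X Y sg : tame X -> conv Y.1 -> conv Y.2 ->
  ord 4 (sg.1 - x) -> ord 4 (sg.2 - y) ->
  fcomp Y.1 sg = vf_apply X sg.1 -> fcomp Y.2 sg = vf_apply X sg.2 ->
  exists G : fps C, [/\ conv (rho G), ord 5 (rho G + x ^+ 2) &
    forall U, vf_apply X U = 0 -> rhox U = - y -> rho G = fcomp G (0, - rho U)].
Proof.
move=> tX cY1 cY2 sg1 sg2 Y1 Y2.
have [Y4 Y5] := normal_orders tX sg1 sg2 Y1 Y2.
pose T := quot_step (Y.1 - y) Y.2.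
have Tst s : cong 0 s (0, 0) -> cong 0 (T s) (0, 0) by apply: quot_step_stab.
have Tco n s t : (0 <= n)%N -> cong 0 s (0, 0) -> cong 0 t (0, 0) ->
    cong n s t -> cong n.+1 (T s) (T t) by move=> _ _ _; apply: quot_step_contr.
have [s [[s2 _] sT _]] := contraction_fixpoint Tst Tco.
pose q : fps C := s.1; rewrite /= subr0 in s2; have q2 : ord 2 q by [].
have qE : q = divy (Y.2 - q * (Y.1 - y)) by rewrite {1}/q -{1}sT.
have cq : conv q.
  apply: (quot_conv Y4 Y5 _ cY2 q2); first by apply: convB => //; exact: conv_y.
  by rewrite /quot_step /= -qE.
have Ost s' : cong 1 s' (0, y) -> cong 1 (ode_step q s') (0, y) by apply: ode_step_stab.
have Oco n s' t : (1 <= n)%N -> cong 1 s' (0, y) -> cong 1 t (0, y) ->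
    cong n s' t -> cong n.+1 (ode_step q s') (ode_step q t).
  by move=> _; apply: ode_step_contr.
have [w [[_ w4] wT _]] := contraction_fixpoint Ost Oco.
pose Z : fps C := w.2; have Z4 : ord 4 (Z - y) by [].
have ZE : Z = y + intx (fcomp q (x, Z)) by rewrite {1}/Z -{1}wT.
have cZ : conv Z by apply: (ode_conv q2 cq Z4); rewrite /ode_step /= -ZE.
have s1o : ord 2 sg.1.
  rewrite -(subrK x sg.1); apply: (ordwD _ (@ord_x C)).
  by apply: ordwW sg1.
have [G G4 GE] := leaf_exists Z4 s1o sg2.
have [W4 W3] := leaf_speed_ord tX sg1 sg2 Y1 Y2 qE Z4 ZE G4 GE.
have Zn : nc (x, Z).
  split=> //=; have := Z4 0%N 0%N isT.
  by rewrite fpsB /fy /= subr0.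
have cW : conv (leaf_speed Y Z) by apply: conv_comp => //; exact: conv_x.
have cc := curve_cong sg1 G4.
have cf := curve_fix tX sg1 sg2 Y1 Y2 qE Z4 ZE G4 GE.
have [_ cz] := curve_conv W4 W3 cW cc cf.
exists G; split; first exact: cz.
  exact: (curve_height tX sg1 sg2 Y1 Y2 qE Z4 ZE G4 GE).
move=> U; exact: (leaf_invariant tX sg1 sg2 Y1 Y2 qE Z4 ZE G4 GE).
Qed.

Definition divx f : fps C := fun i j => f i.+1 j.

Lemma conv_divx f : conv f -> conv (divx f).
Proof.
move=> [r r0 [M hM]]; have r20 : 0 < r / 2 by lra.
apply: (@bnd_conv _ (r / 2) r (M / r)) => //.
apply: bnd_dom (bnd_fdx r0 r0 hM) => // i j.
rewrite /fdx ComplexField.Normc.normcM normc_nat ler_peMl ?normc_ge0 //.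
by rewrite ler1n.
Qed.

Lemma divx_mul f : (forall j, f 0%N j = 0) -> f = x * divx f.
Proof. by move=> f0; apply: fpsP => -[|i] j; rewrite mul_fx. Qed.

(** The convergent series [rho G] is preserved by the involution and equals -x^2 times a unit;
    dividing by x^2 leaves the equation solved by [flip_step], now with analytic data. *)
Lemma involution_conv X Y h U I : tame X -> convergent_pair Y -> conjugates h X Y ->
  vf_apply X U = 0 -> rhox U = - y -> I 0%N 0%N = 1 ->
  fcomp (rho U) (flip I) = rho U -> conv I.
Proof.
move=> tX cY hXY XU U0 I0 UI.
have [sg [Y' [[c1 c2] [s1 s2] e1 e2]]] := normalise_conjugacy cY hXY.
have [G [cz z5 zU]] := embedded_curve tX c1 c2 s1 s2 e1 e2.
have {}zU := zU U XU U0; have nI := nc_flip I.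
have U00 : U 0%N 0%N = 0.
  by have := congr1 (fun f : fps C => f 0%N 0%N) U0; rewrite /= fpsN /fy oppr0.
have nU : nc (0, - rho U) by split; rewrite //= fpsN /= U00 oppr0.
have zI : fcomp (rho G) (flip I) = rho G.
  have e : fmap_comp (0, - rho U) (flip I) = (0, - rho U).
    by rewrite /fmap_comp /= fcomp0 fcompN UI.
  by rewrite zU (fcompA _ nU nI) e.
have x2 : x ^+ 2 = mono 2 0 by rewrite monoE expr0 mulr1.
have z0 : forall i, (i < 2)%N -> forall j, rho G i j = 0.
  move=> i i2 [|j] //; have := z5 i 0%N; rewrite x2 fpsD /mono.
  case: i i2 => [|[|i]] //= _ hz; have := hz isT; rewrite addr0; exact.
pose ze := - divx (divx (rho G)).
have zE : rho G = - (x ^+ 2 * ze).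
  rewrite /ze mulrN opprK expr2 -mulrA -!divx_mul // => j; last exact: z0.
  by rewrite /divx z0.
have ze0 : ze 0%N 0%N = 1.
  have := z5 2%N 0%N isT; rewrite x2 fpsD /mono /= => /eqP.
  by rewrite addr_eq0 => /eqP e; rewrite /ze fpsN /divx /= e opprK.
have cze : conv ze by apply: convN; do 2!apply: conv_divx.
have key : I ^+ 2 * fcomp ze (flip I) = ze.
  apply: (@xmul_inj C); apply: (@xmul_inj C).
  have := zI; rewrite {1}zE fcompN fcompM // fcompX // fcomp_fx // zE {1}/flip /=.
  move=> /(congr1 (fun f : fps C => - f)); rewrite !opprK => e.
  by rewrite [RHS]mulrA -[x * x]expr2 -e; ring.
have IE : I = 1 + (I - 1) by rewrite addrC subrK.
have fixJ : flip_step ze (I - 1, 0) = (I - 1, 0).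
  by apply/flip_step_fix; rewrite -IE.
rewrite IE; apply: convD; first exact: conv1.
apply: (flip_conv ze0 cze _ fixJ).
by apply: nc_ord2; rewrite fpsB fps1E I0 subrr.
Qed.

Lemma conv_coef_bound f : conv f ->
  exists M, forall n, normc (f n 0%N) <= M ^+ n.+1.
Proof.
move=> [r r0 [M hM]]; have M0 : 0 <= M by apply: bnd_ge0 hM.
exists ((1 + M) * (1 + r^-1)) => n.
have := bnd_coef r0 r0 n 0 hM; rewrite expr0 mulr1 => h.
have ri : 0 <= r^-1 by rewrite invr_ge0 ltW.
apply: (@le_trans _ _ (M / r ^+ n)); first by rewrite ler_pdivlMr // exprn_gt0.
rewrite exprMn -exprVn; apply: ler_pM => //; first by rewrite exprn_ge0.
  apply: (@le_trans _ _ (1 + M)); first by rewrite lerDr.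
  by rewrite exprS ler_peMr ?addr_ge0 // exprn_ege1 // lerDl.
apply: (@le_trans _ _ ((1 + r^-1) ^+ n)).
  by rewrite lerXn2r ?nnegrE ?addr_ge0 // lerDr.
by rewrite exprS ler_peMl ?exprn_ge0 ?addr_ge0 // lerDl.
Qed.

End EmbeddedInvolution.

(** * Conclusion *)

Section UnipotentMaps.
Variable K : numFieldType.
Implicit Types (X phi : fps K * fps K).

Lemma cong_fid_coef phi : cong 1 phi (fid K) ->
  [/\ phi.1 0%N 0%N = 0, phi.2 0%N 0%N = 0, phi.1 1%N 0%N = 1,
      phi.2 1%N 0%N = 0 & phi.2 0%N 1%N = 1].
Proof.
move=> [h1 h2]; have e (f g : fps K) i j n : ord n (f - g) -> (2 * i + 3 * j < n)%N -> f i j = g i j.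
  by move=> h /h /eqP; rewrite fpsB subr_eq0 => /eqP.
split.
- exact: (e _ _ 0%N 0%N _ h1).
- exact: (e _ _ 0%N 0%N _ h2).
- exact: (e _ _ 1%N 0%N _ h1).
- exact: (e _ _ 1%N 0%N _ h2).
- exact: (e _ _ 0%N 1%N _ h2).
Qed.

Lemma cong_unipotent phi : cong 1 phi (fid K) -> unipotent_diffeo phi.
Proof.
move=> /cong_fid_coef[z1 z2 a00 a10 a11].
suff [dU dE] : linear_part phi \in unitmx /\
    forall a : K, eigenvalue (linear_part phi) a <-> a = 1 by [].
have [] := linear_partE phi; move: (linear_part phi) => A e00 _ e10 e11.
have dA (a : K) : \det (A - a%:M) = (1 - a) ^+ 2.
  by rewrite det_mx2 !mxE e00 e11 e10 a00 a11 a10 /= !mulr1n !mulr0n !subr0 mulr0 subr0 expr2.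
split.
  rewrite unitmxE -[A]subr0 -(raddf0 (@scalar_mx K 2)) dA subr0 expr1n.
  exact: unitr1.
move=> a; rewrite /eigenvalue /eigenspace kermx_eq0 row_free_unit unitmxE dA.
rewrite unitfE expf_eq0 /= negbK subr_eq0 eq_sym; split=> [/eqP //|->]; exact: eqxx.
Qed.

Lemma raises_nilpotent X : raises X 1 -> nilpotent_vf X.
Proof.
move=> [h1 h2]; split; first by split; [exact: h1 0%N 0%N isT | exact: h2 0%N 0%N isT].
exists 2%N; have [] := linear_partE X.
move: (linear_part X) => A e00 _ e10 e11.
rewrite (h1 1%N 0%N) // in e00; rewrite (h2 1%N 0%N) // in e10.
rewrite (h2 0%N 1%N) // in e11.
have o1 : lift ord0 ord0 = 1 :> 'I_2 by apply: val_inj.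
apply/matrixP => i j; rewrite expr2 -mulmxE !mxE !big_ord_recl big_ord0 addr0 o1.
by case: (ord2_cases i) => ->; rewrite ?e10 ?e11 ?e00 !mul0r ?add0r //;
   case: (ord2_cases j) => ->; rewrite ?e10 ?e11 mulr0.
Qed.

End UnipotentMaps.

Section Embeddability.
Variable R : realType.
Local Notation C := R[i]%C.
Notation normc := ComplexField.Normc.normc.
Notation x := (fx C).
Notation y := (fy C).

(** The set from which [flog] chooses is inhabited by [log_exists], and [is_exp_raises1] controls
    whichever element is chosen. *)
Lemma flogP (phi : fps C * fps C) : cong 1 phi (fid C) ->
  raises (flog phi) 1 /\ phi = (expvf (flog phi) x, expvf (flog phi) y).
Proof.
move=> c1; have [X X1 Xphi] := log_exists c1.
have : nilpotent_vf (flog phi) /\ is_exp (flog phi) phi.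
  rewrite /flog; set P := [set Z | _]%classic.
  have PX : P X.
    split; first exact: raises_nilpotent.
    exact: raises_is_exp X1 (cong_unipotent c1) Xphi.
  exact: (xgetI _ PX).
move=> [nX eX]; have r1 := is_exp_raises1 c1 nX eX; split; first exact: r1.
have n0 : no_constant_term phi := eX.1.1.1.
rewrite !(is_exp_raises _ r1 eX) fcomp_fx // fcomp_fy //.
exact: surjective_pairing.
Qed.

Lemma embeddable_involution (c d : C) (U I : fps C) :
  embeddable_formal_class (map_cd c d) -> fcomp U (map_cd c d) = U ->
  (forall j, U 0%N j = u_leaf C 0%N j) -> I 0%N 0%N = 1 ->
  fcomp (rho U) (flip I) = rho U -> conv I.
Proof.
move=> [Y cY [h hXY]] Uphi U0 I0 UI.
have [c1 m1 m2 m3 m4] := map_cd_props c d.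
have [X1 Xphi] := flogP c1.
have tX := tame_log c1 m1 m2 m3 m4 X1 Xphi.
have XU : vf_apply (flog (map_cd c d)) U = 0.
  by apply: (expvf_fix X1); rewrite (expvf_comp U X1) -Xphi Uphi.
apply: (involution_conv tX cY hXY XU _ I0 UI).
apply: fpsP => -[|i] j /=; rewrite fpsN /fy /= ?oppr0 // U0.
by rewrite /u_leaf fpsB expr2 mul_fx /fy sub0r.
Qed.

(** Interpolation is used twice: in c for fixed d, to isolate the coefficient of c, then in d on
    that coefficient. The bound obtained in the first use may depend on d, which is all that the
    second requires. *)
Lemma embeddable_coef_bound : (forall c d : R,
    embeddable_formal_class (map_cd (real_complex R c) (real_complex R d))) ->
  exists M : R, forall n, odd n -> normc (G_d C 1 (n + 2)%N 0%N) <= M ^+ n.+1.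
Proof.
(* Only the even coefficients of degree one of the involution are known, and they sit at odd n after
   the shift by one. *)
move=> emb; pose a n k : C := if odd n then G_d C k (n + 2)%N 0%N else 0.
suff [M hM] : exists M : R, forall n k, (k <= n)%N -> normc (a n k) <= M ^+ n.+1.
  by exists M => n n1; have := hM n 1%N; rewrite /a n1; apply; case: n n1.
apply: pointwise_poly_boundC => d.
have [G [G0 Gord Gfix GU G1]] := first_integral_family (real_complex R d).
have [I [I0 I1 Iinv]] := involution_family G0 Gord.
pose b n k := I k (n - k)%N.
have [M hM] : exists M : R, forall n k, (k <= n)%N -> normc (b n k) <= M ^+ n.+1.
  apply: pointwise_poly_boundC => c; set cc := real_complex R c.
  have cI : conv (fcomp I (cc *: x, x)).
    apply: (embeddable_involution (emb c d) (Gfix cc) (GU cc) _ (Iinv cc)).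
    by rewrite fcomp_diag big_ord_recl big_ord0 expr0 mul1r addr0.
  have [M hM] := conv_coef_bound cI; exists M => n.
  by have := hM n; rewrite fcomp_diag.
have M0 : 0 <= `|M| by [].
exists `|M| => n; rewrite /a; have [on|_] := boolP (odd n); last first.
  rewrite big1 => [|k _]; last by rewrite mulr0.
  by rewrite ComplexField.Normc.normc0 exprn_ge0.
case: n on => // n en; rewrite /= in en.
have h := hM n.+1 1%N isT; rewrite /b subn1 /= I1 // G1 in h.
have e : psum (G_d C) (real_complex R d) (n + 3)%N 0%N =
    \sum_(k < n.+2) real_complex R d ^+ k * G_d C k (n.+1 + 2)%N 0%N.
  have -> : (n + 3 = n.+1 + 2)%N by lia.
  rewrite /psum; apply/esym.
  apply: (@sum_pad _ _ _ (fun k => real_complex R d ^+ k * G_d C k (n.+1 + 2)%N 0%N)).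
    by lia.
  have [_ _ _ go] := G_d_eqs C.
  by move=> k nk; rewrite go ?mulr0 //; lia.
rewrite -e; apply: le_trans h _; rewrite -normrX; exact: ler_norm.
Qed.

(** By [exp_le_fact4] at 8 A, (2 A)^(8 A) <= (8 A)!, and 2 A exceeds A. *)
Lemma factorial_growth A : (0 < A)%N -> (A ^ (8 * A) < (8 * A)`!)%N.
Proof.
move=> A0; have h := exp_le_fact4 (8 * A).
have e : ((8 * A) ^ (8 * A) = 4 ^ (8 * A) * (2 ^ (8 * A) * A ^ (8 * A)))%N.
  by rewrite -!expnMn; congr (_ ^ _)%N; lia.
rewrite e leq_pmul2l ?expn_gt0 // in h; apply: leq_trans h.
rewrite -[X in (X < _)%N]mul1n ltn_pmul2r ?expn_gt0 ?A0 //.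
by apply: leq_trans (ltn_expl (8 * A) (isT : 1 < 2)%N); lia.
Qed.

Lemma factorial_beats_geometric (M u v : R) : 1 <= u -> 1 <= v ->
  exists2 n, (0 < n)%N & u * v ^+ n * M ^+ (2 * n + 4) < (2 * n + 4)`!%:R.
Proof.
move=> u1 v1; pose Q := u * v * (1 + `|M|).
have u0 : 0 < u by apply: lt_le_trans u1.
have v0 : 0 < v by apply: lt_le_trans v1.
have M1 : 0 < 1 + `|M| by rewrite ltr_pwDl.
have Q0 : 0 < Q by rewrite !mulr_gt0.
pose A := Num.bound Q; have QA : Q < A%:R by apply: archi_boundP; apply: ltW.
have A0 : (0 < A)%N by rewrite -(ltr_nat R); apply: lt_trans QA.
(* Chosen so that 2 n + 4 = 8 A. *)
exists (4 * A - 2)%N; first by lia.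
have -> : (2 * (4 * A - 2) + 4 = 8 * A)%N by lia.
apply: (@le_lt_trans _ _ ((A ^ (8 * A))%:R)); last by rewrite ltr_nat factorial_growth.
apply: (@le_trans _ _ (Q ^+ (8 * A))); last first.
  by rewrite natrX lerXn2r ?nnegrE ?ler0n ?(ltW Q0) // ltW.
have n8 : (4 * A - 2 <= 8 * A)%N by lia.
have k0 : (0 < 8 * A)%N by lia.
move: (8 * A)%N (4 * A - 2)%N n8 k0 => k n nk k0.
apply: (@le_trans _ _ (u * v ^+ n * (1 + `|M|) ^+ k)).
  rewrite ler_pM2l ?mulr_gt0 ?exprn_gt0 //; apply: le_trans (ler_norm _) _.
  by rewrite normrX lerXn2r ?nnegrE ?(ltW M1) // lerDr.
rewrite /Q !exprMn ler_pM2r ?exprn_gt0 //; apply: ler_pM.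
- exact: ltW.
- by rewrite exprn_ge0 // ltW.
- by rewrite ler_eXnr // ltW.
- by rewrite ler_weXn2l.
Qed.

Lemma not_all_embeddable : exists c d : R,
  ~ embeddable_formal_class (map_cd (real_complex R c) (real_complex R d)).
Proof.
apply: contrapT => nex.
have [M hM] : exists M : R, forall n, odd n -> normc (G_d C 1 (n + 2)%N 0%N) <= M ^+ n.+1.
  apply: embeddable_coef_bound => c d; apply: contrapT => nh.
  by apply: nex; exists c, d.
have key n : (0 < n)%N -> (2 * n + 4)`!%:R / 54 / 900 ^+ n <= M ^+ (2 * n + 4) :> R.
  move=> n0; have := G_d_bound C n0.
  have hodd : odd (2 * n + 3) by rewrite oddD oddM.
  have e3 : (2 * n + 3 + 2 = 2 * n + 5)%N by lia.
  have e4 : ((2 * n + 3).+1 = 2 * n + 4)%N by lia.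
  have h := hM _ hodd; rewrite e3 e4 in h.
  have e : `|G_d C 1 (2 * n + 5)%N 0%N| = real_complex R (normc (G_d C 1 (2 * n + 5)%N 0%N)).
    by rewrite normc_def; case: (G_d C 1 _ _).
  rewrite e => h2.
  have : real_complex R ((2 * n + 4)`!%:R / 54 / 900 ^+ n) <=
         real_complex R (normc (G_d C 1 (2 * n + 5)%N 0%N)).
    apply: le_trans h2; rewrite !rmorphM !fmorphV rmorphXn !rmorph_nat.
    exact: lexx.
  by rewrite lecR => h3; apply: le_trans h3 h.
have g54 : (1 : R) <= 54 by rewrite (ler_nat R 1 54).
have g900 : (1 : R) <= 900 by rewrite (ler_nat R 1 900).
have [n n0 hn] := factorial_beats_geometric M g54 g900.
have h54 : (0 : R) < 54 by rewrite (ltr0n R 54).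
have h900 : (0 : R) < 900 ^+ n by apply: exprn_gt0; rewrite (ltr0n R 900).
have := key n n0; rewrite (ler_pdivrMr _ _ h900) (ler_pdivrMr _ _ h54) leNgt.
by rewrite mulrC (mulrC (M ^+ _)) mulrA hn.
Qed.

End Embeddability.

Local Open Scope complex_scope.

Theorem mainTheorem1 (R : realType) :
  exists phi : fps R[i] * fps R[i],
    [/\ unipotent_diffeo phi, convergent_pair phi &
        ~ embeddable_formal_class phi].
Proof.
have [c [d h]] := not_all_embeddable R.
exists (map_cd (real_complex R c) (real_complex R d)); split; last exact: h.
- by apply: cong_unipotent; have [] := map_cd_props (real_complex R c) (real_complex R d).
- exact: map_cd_convergent.
Qed.
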